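(* Let $r, \ell \in \mathbb{N}$ with $2r \le \ell \le 4r-1$. Then there exists $n_0 \in \mathbb{N}$ such that the following holds. Suppose $H$ is a $4r$-uniform hypergraph on $n \ge n_0$ vertices, where $4r$ divides $n$. If $$\delta_\ell(H) > \delta(n,4r,\ell),$$ then $H$ contains a perfect matching.
   Context: A perfect matching in a hypergraph $H$ is a collection of vertex-disjoint edges of $H$ covering $V(H)$. For a $k$-uniform hypergraph $H$ and an $\ell$-element set $S\subseteq V(H)$ ($0\le \ell\le k-1$), $d_H(S)$ is the number of edges of $H$ containing $S$; the minimum $\ell$-degree $\delta_\ell(H)$ is the minimum of $d_H(S)$ over all $\ell$-element subsets $S$ of $V(H)$. Let $V$ be a set of $n$ vertices and let $A, B$ be a partition of $V$ into non-empty sets (the order of $A,B$ matters). $\mathcal{B}_{n,k}(A,B)$ is the $k$-uniform hypergraph on $V=A\cup B$ whose edges are all $k$-subsets of $V$ meeting $A$ in an odd number of vertices; $\overline{\mathcal{B}}_{n,k}(A,B)$ is its complement, whose edges are all $k$-subsets of $V$ meeting $A$ in an even number of vertices. For $k\ge 2$ with $k$ dividing $n$, $\mathcal{H}_{\text{ext}}(n,k)$ is the collection consisting of the following hypergraphs: all $\overline{\mathcal{B}}_{n,k}(A,B)$ with $|A|$ odd; if $n/k$ is odd, additionally all $\mathcal{B}_{n,k}(A,B)$ with $|A|$ even; if $n/k$ is even, additionally all $\mathcal{B}_{n,k}(A,B)$ with $|A|$ odd. For $k/2\le \ell\le k-1$, $\delta(n,k,\ell)$ denotes the maximum of $\delta_\ell(F)$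 over all $F\in \mathcal{H}_{\text{ext}}(n,k)$. *)

(* Defs.v *)
From mathcomp Require Import all_boot.

Set Implicit Arguments.
Unset Strict Implicit.
Unset Printing Implicit Defensive.

Section Hypergraphs.

Variable T : finType.

(* A hypergraph with vertex set T is identified with its edge set. *)
Implicit Types (H : {set {set T}}) (M : {set {set T}}) (S A : {set T}).

Definition uniform (k : nat) H : Prop := forall e, e \in H -> #|e| = k.

Definition perfect_matching H M : bool :=
  [&& M \subset H, trivIset M & cover M == [set: T]].

Definition degree H S : nat := #|[set e in H | S \subset e]|.

(* The value #|H| assigned to the empty minimum bounds every degree from above,
   so as soon as T has at least l elements it does not affect the result. *)
Definition min_degree (l : nat) H : nat :=
  \big[minn/#|H|]_(S : {set T} | #|S| == l) degree H S.

(* In both definitions the second part of the partition is B := ~: A. *)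
Definition odd_hypergraph (k : nat) A : {set {set T}} :=
  [set e : {set T} | (#|e| == k) && odd #|e :&: A|].

Definition even_hypergraph (k : nat) A : {set {set T}} :=
  [set e : {set T} | (#|e| == k) && ~~ odd #|e :&: A|].

Definition H_ext (k : nat) : {set {set {set T}}} :=
  [set F | [exists A : {set T},
    [&& A != set0, ~: A != set0 &
      [|| (F == even_hypergraph k A) && odd #|A|,
          [&& odd (#|T| %/ k), F == odd_hypergraph k A & ~~ odd #|A|]
        | [&& ~~ odd (#|T| %/ k), F == odd_hypergraph k A & odd #|A|]]]]].

End Hypergraphs.

Definition delta_ext (n k l : nat) : nat :=
  \max_(F in H_ext 'I_n k) min_degree l F.

(* Main.v *)
Require Import Defs.
From mathcomp Require Import all_boot all_order all_algebra fingroup perm.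
From mathcomp Require Import ring lra zify.

(** Write k = 4r and m = k / 2 = 2r, and let n be the number of vertices. The
    hypothesis on the minimum l-degree is used in two ways. The exact inequality
    says that H is not contained in any of the extremal parity hypergraphs. The
    approximate consequence is that every m-set lies in at least (1/2 - o(1)) of
    all possible edges ([m_degree_prob]), because one extremal hypergraph, with an
    odd part of about n/2 vertices, already has all its l-degrees near 1/2 and
    lower bounds on l-degrees pass to smaller sets. All counting is done with
    averages over sequences of vertices, that is, with probabilities for
    independent uniform vertices, so that repetitions cost only O(1/n).

    Compare the links of two vertices x and y, each of density about 1/2. If they
    share a positive proportion of (k-1)-sets then x and y can be exchanged:
    there are many sets S for which both S + x and S + y have perfect matchings.
    If they do not, then the links are nearly complementary. Hence there are two
    cases ([dichotomy]).

    - Every two vertices can be exchanged, directly or through a positive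
      proportion of intermediate vertices. Then every k-set Q has many absorbers,
      sets A such that both A and A + Q have perfect matchings. The method of
      conditional expectations gives a small disjoint family of absorbers in which
      every Q is absorbed linearly often ([absorbing_family]). It remains to match
      nearly everything outside the family ([near_perfect]) and to absorb the few
      vertices left over ([absorb_leftover]).

    - Some pair x, y cannot be exchanged. Then nearly all links agree with the
      link of x or with the link of y, and these two are complementary. So
      exchanging a vertex for one of the same kind keeps the status of a k-tuple,
      and exchanging it for one of the other kind reverses it: up to a small error
      H consists of the k-sets that meet A in a prescribed parity, and
      |A| is about n/2 because both links have density about 1/2. In such a
      hypergraph only the parity of |A| can obstruct a perfect matching, and if it
      does then H, not being contained in the extremal hypergraph, has an edge of
      the other parity, which removes the obstruction. The exceptional vertices
      are covered greedily and the rest falls into two almost complete k-partite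
      pieces ([extremal_matching]).

    For the almost perfect matching, take a maximum matching and let U be the set
    of vertices that it misses. If U is large, call an m-set heavy when many m-sets
    of U complete it to an edge. Disjoint heavy sets inside the union of j edges of
    the matching can be completed disjointly inside U, so by maximality there are
    at most j of them. For m edges this bounds the density of heavy transversals
    by m / k = 1/2. Equality would force the heavy transversals to be determined
    by a single coordinate ([dictator]), and two overlapping choices of m edges
    then contradict the bound for m + 1 edges ([heavy_rows_lt]). So the density is
    below 1/2 by a constant that depends on k only, against the degree condition.

    The argument is valid for every even k >= 4 ([even_threshold]). *)

Set Implicit Arguments.
Unset Strict Implicit.
Unset Printing Implicit Defensive.

Import Order.TTheory GRing.Theory Num.Theory.
Local Open Scope ring_scope.

(** * Averages over sequences of vertices *)

(** A sealed copy of the rational numbers: with the carrier opaque, conversion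
    never evaluates numerals, which makes linear arithmetic fast. *)
Fact QQ : archiRealFieldType. Proof. exact: rat. Qed.

Section Average.
Variable T : finType.
Implicit Types (F G : seq T -> QQ) (P Q : seq T -> bool).

(** The expectation of F at a sequence of j independent uniform elements of T.
    The recursion on the first entry makes the Fubini rule [avg_cat] immediate. *)
Fixpoint avg (j : nat) (F : seq T -> QQ) : QQ :=
  if j is j'.+1 then (\sum_(x : T) avg j' (fun s => F (x :: s))) / #|T|%:R
  else F [::].

Definition prob j P := avg j (fun s => (P s)%:R).

Lemma avg_le j F G : (forall s, size s = j -> F s <= G s) -> avg j F <= avg j G.
Proof.
elim: j F G => [|j IH] F G h /=; first exact: h.
rewrite ler_wpM2r ?invr_ge0 ?ler0n //; apply: ler_sum => x _.
by apply: IH => s hs; apply: h; rewrite /= hs.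
Qed.

Lemma eq_avg j F G : (forall s, size s = j -> F s = G s) -> avg j F = avg j G.
Proof.
by move=> h; apply/eqP; rewrite eq_le; apply/andP; split; apply: avg_le => s hs;
  rewrite h.
Qed.

Lemma avg_cat i j F :
  avg (i + j) F = avg i (fun s => avg j (fun t => F (s ++ t))).
Proof. by elim: i F => [//|i IH] F /=; congr (_ / _); apply: eq_bigr => x _. Qed.

Lemma avgZ j c F : avg j (fun s => c * F s) = c * avg j F.
Proof.
elim: j F => [//|j IH] F /=; rewrite mulrA mulr_sumr; congr (_ / _).
by apply: eq_bigr => x _; exact: IH.
Qed.

Lemma avg_sum (I : Type) (r : seq I) (p : pred I) j (F : I -> seq T -> QQ) :
  avg j (fun s => \sum_(i <- r | p i) F i s) = \sum_(i <- r | p i) avg j (F i).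
Proof.
elim: j F => [//|j IH] F /=; rewrite -mulr_suml exchange_big /=.
by congr (_ / _); apply: eq_bigr => x _; exact: IH.
Qed.

Lemma avgD j F G : avg j (fun s => F s + G s) = avg j F + avg j G.
Proof.
elim: j F G => [//|j IH] F G /=; rewrite -mulrDl -big_split /=; congr (_ / _).
by apply: eq_bigr => x _; exact: IH.
Qed.

Lemma avgN j F : avg j (fun s => - F s) = - avg j F.
Proof. by rewrite -mulN1r -avgZ; apply: eq_avg => s _; rewrite mulN1r. Qed.

Lemma avgB j F G : avg j (fun s => F s - G s) = avg j F - avg j G.
Proof. by rewrite avgD avgN. Qed.

Lemma avg_div j c F : avg j (fun s => F s / c) = avg j F / c.
Proof. by rewrite mulrC -avgZ; apply: eq_avg => s _; rewrite mulrC. Qed.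

Lemma avg_ge0 j F : (forall s, size s = j -> 0 <= F s) -> 0 <= avg j F.
Proof.
move=> h; have -> : 0 = avg j (fun s => 0 * F s) by rewrite avgZ mul0r.
by apply: avg_le => s hs; rewrite mul0r h.
Qed.

Lemma prob_ge0 j P : 0 <= prob j P.
Proof. by apply: avg_ge0 => s _; rewrite ler0n. Qed.

Lemma prob_le j P Q : (forall s, size s = j -> P s -> Q s) -> prob j P <= prob j Q.
Proof.
move=> h; apply: avg_le => s hs; rewrite ler_nat; case hP: (P s) => //=.
by rewrite (h s hs hP).
Qed.

Lemma eq_prob j P Q : (forall s, size s = j -> P s = Q s) -> prob j P = prob j Q.
Proof. by move=> h; apply: eq_avg => s hs; rewrite h. Qed.

Lemma prob_or j P Q : prob j (fun s => P s || Q s) <= prob j P + prob j Q.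
Proof.
rewrite -avgD; apply: avg_le => s _; rewrite -natrD ler_nat.
by case: (P s); case: (Q s).
Qed.

Lemma prob_split j P Q :
  prob j P = prob j (fun s => P s && Q s) + prob j (fun s => P s && ~~ Q s).
Proof.
by rewrite -avgD; apply: eq_avg => s _; rewrite -natrD; case: (P s); case: (Q s).
Qed.

Hypothesis T0 : (0 < #|T|)%N.

Lemma cardT_neq0 : #|T|%:R != 0 :> QQ.
Proof. by rewrite pnatr_eq0 -lt0n. Qed.

Lemma cardT_gt0 : 0 < #|T|%:R :> QQ.
Proof. by rewrite ltr0n. Qed.

Lemma avg_cst j c : avg j (fun => c) = c.
Proof.
elim: j => [//|j IH] /=.
rewrite (eq_bigr (fun => c)); last by move=> x _; exact: IH.
by rewrite sumr_const -[c *+ _]mulr_natr mulfK // cardT_neq0.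
Qed.

Lemma prob_le1 j P : prob j P <= 1.
Proof. by rewrite -(avg_cst j 1); apply: avg_le => s _; rewrite (ler_nat _ _ 1) leq_b1. Qed.

Lemma probT j : prob j (fun => true) = 1.
Proof. exact: avg_cst. Qed.

Lemma probC j P : prob j (fun s => ~~ P s) = 1 - prob j P.
Proof. by apply/eqP; rewrite eq_sym subr_eq -(probT j) (prob_split j _ P) addrC. Qed.

Lemma avg_exists_ge j F c : c <= avg j F -> exists2 s, size s = j & c <= F s.
Proof.
elim: j F => [|j IH] F /= h; first by exists [::].
suff [x /IH [s hs hF]]: exists x, c <= avg j (fun s => F (x :: s)).
  by exists (x :: s); rewrite /= ?hs.
apply/existsP; apply: contraLR h; rewrite negb_exists => /forallP h.
rewrite -ltNge ltr_pdivrMr ?cardT_gt0 //.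
rewrite [X in _ < X](_ : _ = \sum_(x : T) c); last first.
  by rewrite sumr_const mulr_natr.
have [x _] : exists x : T, x \in predT by apply/card_gt0P.
by apply: ltr_sum => [|y _]; [apply/hasP; exists x; rewrite ?mem_index_enum | rewrite ltNge h].
Qed.

Lemma avg_exists_le j F c : avg j F <= c -> exists2 s, size s = j & F s <= c.
Proof.
rewrite -lerN2 -avgN => /avg_exists_ge [s hs h]; exists s => //.
by rewrite -lerN2.
Qed.

Lemma prob_exists j P : 0 < prob j P -> exists2 s, size s = j & P s.
Proof.
move=> h; have [s hs] := avg_exists_ge (lexx (prob j P)).
by move/(lt_le_trans h); rewrite ltr0n lt0b; exists s.
Qed.

Lemma avg_1 F : avg 1 F = (\sum_x F [:: x]) / #|T|%:R.
Proof. by []. Qed.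

Lemma avg_cons j F : avg j.+1 F = avg 1 (fun s => avg j (fun t => F (s ++ t))).
Proof. exact: (avg_cat 1). Qed.

Lemma prob1_mem (Z : {set T}) : prob 1 (has (mem Z)) = #|Z|%:R / #|T|%:R.
Proof.
rewrite /prob avg_1; congr (_ / _); rewrite -sum1_card natr_sum [RHS]big_mkcond /=.
by apply: eq_bigr => x _; rewrite orbF; case: (x \in Z).
Qed.

Lemma prob_hit j (Z : {set T}) : prob j (has (mem Z)) <= j%:R * (#|Z|%:R / #|T|%:R).
Proof.
elim: j => [|j IH]; first by rewrite mul0r.
rewrite /prob avg_cons.
apply: (@le_trans _ _ (avg 1 (fun s => (has (mem Z) s)%:R + prob j (has (mem Z))))).
  apply: avg_le => s _; rewrite -[X in X + _](avg_cst j) -avgD; apply: avg_le => t _.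
  by rewrite has_cat -natrD ler_nat; case: has; case: has.
rewrite avgD avg_cst -/(prob _ _) prob1_mem -natr1 mulrDl mul1r; lra.
Qed.

Lemma prob_not_uniq j : prob j (fun s => ~~ uniq s) <= j%:R ^+ 2 / #|T|%:R.
Proof.
have n0 := cardT_gt0; have hi : 0 <= #|T|%:R^-1 :> QQ by rewrite invr_ge0 ltW.
elim: j => [|j IH]; first by rewrite /prob /= expr0n mul0r.
have -> : prob j.+1 (fun s => ~~ uniq s) =
  avg 1 (fun x => prob j (fun s => ~~ uniq (x ++ s))) by rewrite /prob avg_cons.
apply: (@le_trans _ _ (avg 1 (fun x => prob j (fun s => ~~ uniq s) + j%:R * (1 / #|T|%:R)))).
  apply: avg_le => -[//|x [|//]] _.
  apply: (@le_trans _ _ (prob j (fun s => ~~ uniq s || has (mem [set x]) s))).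
    apply: prob_le => s _ /=; rewrite negb_and negbK => /orP [h|->//].
    by apply/orP; right; apply/hasP; exists x; rewrite ?inE.
  apply: le_trans (prob_or _ _ _) _; rewrite lerD2l.
  by have := prob_hit j [set x]; rewrite cards1.
rewrite avgD !avg_cst -natr1 sqrrD; have j0: 0 <= j%:R :> QQ by [].
apply: le_trans (lerD IH (lexx _)) _; rewrite !mulrDl.
have : 0 <= j%:R * #|T|%:R^-1 :> QQ by rewrite mulr_ge0.
lra.
Qed.

Lemma exchange_avg i j (F : seq T -> seq T -> QQ) :
  avg i (fun s => avg j (fun t => F s t)) = avg j (fun t => avg i (fun s => F s t)).
Proof.
elim: i F => [//|i IH] F /=.
rewrite avg_div avg_sum; congr (_ / _); apply: eq_bigr => x _; exact: IH.
Qed.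

(** Independence of the entries, for events that constrain each entry separately. *)
Lemma prob_all_cat i j (A B : {set T}) :
  prob (i + j) (fun s => all (mem A) (take i s) && all (mem B) (drop i s)) =
  (#|A|%:R / #|T|%:R) ^+ i * (#|B|%:R / #|T|%:R) ^+ j.
Proof.
have h (Z : {set T}) l : prob l (all (mem Z)) = (#|Z|%:R / #|T|%:R) ^+ l.
  elim: l => [//|l IH]; rewrite /prob avg_cons.
  have -> : avg 1 (fun s => avg l (fun t => (all (mem Z) (s ++ t))%:R))
    = avg 1 (fun s => prob l (all (mem Z)) * (has (mem Z) s)%:R).
    apply: eq_avg => -[//|x [|//]] _; rewrite mulrC -avgZ; apply: eq_avg => t _ /=.
    by rewrite orbF -natrM mulnb.
  by rewrite avgZ -/(prob 1 _) prob1_mem IH exprSr.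
rewrite -!h /prob avg_cat mulrC -avgZ; apply: eq_avg => s hs.
rewrite mulrC -avgZ; apply: eq_avg => t _.
by rewrite take_size_cat // drop_size_cat // -natrM mulnb.
Qed.

End Average.

(** * Hypergraphs, matchings and degrees *)

(** The passage between expectations and counting. *)
Lemma avg_tuple (T : finType) j (F : seq T -> QQ) : (0 < #|T|)%N ->
  avg j F * #|T|%:R ^+ j = \sum_(t : j.-tuple T) F t.
Proof.
move=> T0; elim: j F => [|j IH] F /=.
  by rewrite mulr1 (big_pred1 [tuple]) // => t; apply/esym/eqP; exact: tuple0.
rewrite exprS mulrA divfK ?cardT_neq0 // mulr_suml.
rewrite (reindex (fun p : T * j.-tuple T => [tuple of p.1 :: p.2])) /=; last first.
  exists (fun t => (thead t, [tuple of behead t])) => [[x t] _|t _] /=.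
    by congr pair; apply: val_inj.
  by rewrite [RHS]tuple_eta.
rewrite -(pair_bigA _ (fun x (t : j.-tuple T) => F (x :: t))) /=.
by apply: eq_bigr => x _; rewrite IH.
Qed.

Section Hypergraph.
Variables (T : finType).
Implicit Types (H M : {set {set T}}) (S A B : {set T}) (s t : seq T).

Definition edge H s := [set x in s] \in H.

Lemma set_cat s t : [set x in s ++ t] = [set x in s] :|: [set x in t].
Proof. by apply/setP => x; rewrite !inE mem_cat. Qed.

Lemma edge_eq_mem H s t : s =i t -> edge H s = edge H t.
Proof. by move=> h; congr (_ \in H); apply/setP => x; rewrite !inE h. Qed.

Lemma card_seq_set s : (#|[set x in s]| <= size s)%N.
Proof. by rewrite cardsE card_size. Qed.

Lemma card_uniq_seq_set s : uniq s -> #|[set x in s]| = size s.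
Proof. by move=> h; rewrite cardsE; apply/card_uniqP. Qed.

Lemma edge_uniq k H s : uniform k H -> size s = k -> edge H s -> uniq s.
Proof.
by move=> hU hs /hU hc; apply/card_uniqP; rewrite -[LHS]cardsE hc.
Qed.

Lemma disjointsU A B S :
  [disjoint A & S] -> [disjoint B & S] -> [disjoint A :|: B & S].
Proof. by rewrite -!setI_eq0 setIUl => /eqP -> /eqP ->; rewrite setU0. Qed.

(** Here S may be a proper subset of the vertices, so that matchings can be
    assembled from pieces by [matchableU]. *)
Definition matchable H S := exists M, [/\ M \subset H, trivIset M & cover M = S].

Lemma matchable0 H : matchable H set0.
Proof.
exists set0; split; rewrite ?sub0set ?/trivIset /cover ?big_set0 ?cards0 //.
Qed.

Lemma matchable_edge H e : e \in H -> matchable H e.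
Proof.
move=> he; exists [set e]; split; rewrite ?sub1set ?/trivIset ?/cover ?big_set1 //.
Qed.

Lemma matchableU H A B :
  [disjoint A & B] -> matchable H A -> matchable H B -> matchable H (A :|: B).
Proof.
move=> dAB [M [sM tM cM]] [N [sN tN cN]]; exists (M :|: N).
split; first by rewrite subUset sM.
  by apply: trivIsetU => //; rewrite cM cN.
by rewrite /cover bigcup_setU -/(cover M) -/(cover N) cM cN.
Qed.

Lemma card_cover_uniform k H M :
  uniform k H -> M \subset H -> trivIset M -> #|cover M| = (k * #|M|)%N.
Proof.
move=> hU sM /eqP <-; rewrite (eq_bigr (fun => k)); last first.
  by move=> e he; apply: hU; apply: (subsetP sM).
by rewrite sum_nat_const mulnC.
Qed.

Lemma matchable_dvd k H S : uniform k H -> matchable H S -> (k %| #|S|)%N.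
Proof.
by move=> hU [M [sM tM <-]]; rewrite (card_cover_uniform hU sM tM) dvdn_mulr.
Qed.

(** Each edge through the entries of s arises from j! orderings of its
    remaining j vertices, and a sequence with a repetition never gives an edge. *)
Lemma degree_prob k H s j : (0 < #|T|)%N -> uniform k H -> uniq s ->
  (size s + j = k)%N ->
  prob j (fun t => edge H (s ++ t)) * #|T|%:R ^+ j =
  (degree H [set x in s] * j`!)%:R.
Proof.
move=> T0 hU us hsz; rewrite /prob avg_tuple // -natr_sum; congr _%:R.
rewrite /degree -sum_nat_const.
pose R (e : {set T}) (t : j.-tuple T) := (t \subset e :\: [set x in s]) && uniq t.
have hR (t : j.-tuple T) : (edge H (s ++ t) : nat) =
   (\sum_(e in [set e in H | [set x in s] \subset e]) R e t)%N.
  have eqR e : e \in H -> [set x in s] \subset e -> R e t -> e = [set x in s ++ t].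
    move=> he hse /andP [hsub hu]; apply/eqP; rewrite eq_sym eqEcard.
    rewrite set_cat subUset hse /=; apply/andP; split.
      by apply/subsetP => x; rewrite inE => /(subsetP hsub); rewrite inE => /andP [].
    rewrite -set_cat card_uniq_seq_set.
      by rewrite size_cat size_tuple hsz (hU _ he).
    rewrite cat_uniq us hu andbT; apply/hasPn => x /(subsetP hsub).
    by rewrite !inE => /andP [].
  case E: (edge H (s ++ t)); last first.
    rewrite big1 // => e; rewrite inE => /andP [he hse].
    by case hr: (R e t) => //; move: E; rewrite /edge -(eqR e he hse hr) he.
  have hin : [set x in s ++ t] \in [set e in H | [set x in s] \subset e].
    by rewrite inE [_ \in H]E set_cat subsetUl.
  rewrite (bigD1 [set x in s ++ t]) //= big1 ?addn0 => [|e]; last first.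
    rewrite inE => /andP [/andP [he hse] ne].
    by case hr: (R e t) => //; rewrite (eqR e he hse hr) eqxx in ne.
  have : uniq (s ++ t) by apply: edge_uniq hU _ E; rewrite size_cat size_tuple.
  rewrite cat_uniq => /and3P [_ hs ut]; rewrite /R ut andbT.
  suff -> : t \subset [set x in s ++ t] :\: [set x in s] by [].
  apply/subsetP => x hx; rewrite !inE mem_cat hx orbT andbT.
  by apply: contra hs => hxs; apply/hasP; exists x.
transitivity (\sum_(t : j.-tuple T)
    \sum_(e in [set e in H | [set x in s] \subset e]) R e t)%N.
  by apply: eq_bigr => t _; exact: hR.
rewrite exchange_big /=.
apply: eq_bigr => e; rewrite inE => /andP [he hse].
have ce : #|e :\: [set x in s]| = j.
  rewrite cardsD (setIidPr hse) (hU _ he) card_uniq_seq_set // -hsz; lia.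
have -> : j`! = #|[set t : j.-tuple T | all [in e :\: [set x in s]] t & uniq t]|.
  by rewrite card_uniq_tuples (eq_card (B := e :\: [set x in s])) // ce ffactnn.
rewrite -sum1_card [RHS]big_mkcond /=.
apply: eq_bigr => t _; rewrite inE /R.
have -> : all [in e :\: [set x in s]] t = (t \subset e :\: [set x in s]).
  by apply/allP/subsetP.
by case: (_ && _).
Qed.

End Hypergraph.

(** * Parity hypergraphs and the degree condition *)

(** The cost of sampling with replacement. *)
Lemma prob_uniq_cat (T : finType) (s : seq T) j : (0 < #|T|)%N -> uniq s ->
  prob j (fun t => ~~ uniq (s ++ t)) <= (j * (size s + j))%:R / #|T|%:R.
Proof.
move=> T0 us.
apply: (@le_trans _ _ (prob j (fun t => has (mem [set x in s]) t || ~~ uniq t))).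
  apply: prob_le => t _; rewrite cat_uniq us /= negb_and negbK.
  rewrite (eq_has (a2 := mem [set x in s])) // => x. by rewrite -!topredE /= inE.
apply: le_trans (prob_or _ _ _) _.
have h1 := prob_hit T0 j [set x in s]; have h2 := prob_not_uniq T0 j.
rewrite card_uniq_seq_set // in h1.
by rewrite natrM natrD mulrDr mulrDl -expr2 -mulrA lerD.
Qed.

Section Parity.
Variables (T : finType) (a : pred T).
Hypothesis T0 : (0 < #|T|)%N.

Definition parity (s : seq T) := odd (count a s).

Lemma parity_cat s t : parity (s ++ t) = parity s (+) parity t.
Proof. by rewrite /parity count_cat oddD. Qed.

Lemma parity_cons x s : parity (x :: s) = a x (+) parity s.
Proof. by rewrite /parity /= oddD oddb. Qed.

(** The expectation of the sign of the parity is the j-th power of the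
    expectation for one vertex. *)
Lemma parity_bias j b :
  prob j (fun t => parity t == b) =
  (1 + (-1) ^+ b * (1 - 2 * (#|a|%:R / #|T|%:R)) ^+ j) / 2.
Proof.
have E : avg j (fun t => (-1) ^+ parity t) = (1 - 2 * (#|a|%:R / #|T|%:R)) ^+ j.
  elim: j => [|j IH]; first by rewrite expr0.
  rewrite /= exprS -IH.
  rewrite (eq_bigr (fun x => (-1) ^+ a x * avg j (fun t => (-1) ^+ parity t))); last first.
    by move=> x _; rewrite -avgZ; apply: eq_avg => s _; rewrite parity_cons signr_addb.
  rewrite -mulr_suml mulrAC; congr (_ * _).
  have -> : \sum_i (-1) ^+ a i = #|T|%:R - 2 * #|a|%:R :> QQ.
    rewrite (eq_bigr (fun x => 1 - 2 * (a x)%:R)); last by move=> x _; case: (a x) => /=; rewrite ?expr1 ?expr0; ring.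
    rewrite sumrB sumr_const -mulr_sumr; congr (_ - 2 * _).
    by rewrite -sum1_card natr_sum [RHS]big_mkcond; apply: eq_bigr => x _; rewrite unfold_in; case: (a x).
  by rewrite mulrBl divff ?cardT_neq0 // mulrA.
rewrite -E -avgZ -[X in X + _](avg_cst T0 j) -avgD -avg_div; apply: eq_avg => t _.
by case: (parity t); case: b => /=; lra.
Qed.

End Parity.

Lemma parity_edge (T : finType) (A : {set T}) s : uniq s ->
  odd #|[set x in s] :&: A| = parity (mem A) s.
Proof.
move=> us; rewrite /parity -size_filter -card_uniq_seq_set ?filter_uniq //.
by congr (odd #|pred_of_set _|); apply/setP => x; rewrite !inE mem_filter andbC.
Qed.

Section MinDegree.
Variables (T : finType) (l : nat) (H : {set {set T}}).
Implicit Types S : {set T}.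

Lemma min_degree_le S : #|S| = l -> (min_degree l H <= degree H S)%N.
Proof.
move=> hS; rewrite /min_degree; move: (mem_index_enum S).
elim: (index_enum _) => [//|S' r IH]; rewrite inE big_cons => /orP [/eqP <-|/IH h].
  by rewrite hS eqxx geq_minl.
by case: ifP => // _; rewrite geq_min h orbT.
Qed.

Lemma min_degree_le_card : (min_degree l H <= #|H|)%N.
Proof.
by rewrite /min_degree; elim/big_rec: _ => // S x _ h; rewrite geq_min h orbT.
Qed.

Lemma min_degree_ge (x : QQ) : (l <= #|T|)%N ->
  (forall S, #|S| = l -> x <= (degree H S)%:R) -> x <= (min_degree l H)%:R.
Proof.
move=> hl h; rewrite /min_degree; elim/big_rec: _ => [|S y /eqP hS hy].
  have [S _ hS] : exists2 S : {set T}, S \subset [set: T] & #|S| = l.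
    have [s hs] : exists s : {set T}, s \in [set A : {set T} | #|A| == l].
      by apply/card_gt0P; rewrite card_draws bin_gt0.
    by exists s; rewrite ?subsetT //; apply/eqP; rewrite inE in hs.
  apply: le_trans (h S hS) _; rewrite ler_nat; apply: subset_leq_card.
  by apply/subsetP => e; rewrite inE => /andP [].
by rewrite /minn; case: ifP => _; [exact: h|].
Qed.

End MinDegree.

(** Needed because the extremal hypergraphs live on the vertex set 'I_n. *)
Lemma min_degree_mono (T U : finType) (f : T -> U) l
    (H : {set {set T}}) (F : {set {set U}}) :
  bijective f -> (forall e, e \in H -> f @: e \in F) ->
  (min_degree l H <= min_degree l F)%N.
Proof.
move=> [g fK gK] hf; have injf := can_inj fK.
have card_le (S : {set T}) : (degree H S <= degree F (f @: S))%N.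
  rewrite /degree -(card_imset _ (imset_inj injf)); apply: subset_leq_card.
  apply/subsetP => _ /imsetP [e he ->]; move: he; rewrite !inE => /andP [he hS].
  by rewrite hf // imsetS.
have hF : (min_degree l H <= #|F|)%N.
  apply: leq_trans (min_degree_le_card _ _) _.
  rewrite -(card_imset _ (imset_inj injf)); apply: subset_leq_card.
  by apply/subsetP => _ /imsetP [e he ->]; apply: hf.
have hS (S : {set U}) : #|S| = l -> (min_degree l H <= degree F S)%N.
  move=> hS; have eS : S = f @: (g @: S).
    by rewrite -imset_comp (eq_imset _ (g := id)) ?imset_id //; exact: gK.
  rewrite {1}eS; apply: leq_trans (card_le _); apply: min_degree_le.
  by rewrite card_imset //; exact: can_inj gK.
move: (min_degree l H) hF hS => d hF hS.
rewrite /min_degree; elim/big_rec: _ => [//|S y /eqP hSl hy].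
by rewrite leq_min hy hS.
Qed.

(** When |A| has the wrong parity, the hypergraph of all k-sets with parity p
    is one of the extremal ones, so a subhypergraph of it cannot beat the threshold.
    The condition on A gathers the three cases in the definition of [H_ext]. *)
Lemma delta_ext_barrier (T : finType) k l (H : {set {set T}}) (A : {set T}) (p : bool) :
  A != set0 -> ~: A != set0 ->
  (forall e, e \in H -> #|e| = k /\ odd #|e :&: A| = p) ->
  odd #|A| != (p && odd (#|T| %/ k)) ->
  (min_degree l H <= delta_ext #|T| k l)%N.
Proof.
move=> A0 B0 hH hA; pose f : T -> 'I_#|T| := enum_rank.
have bf : bijective f by exists enum_val; [exact: enum_rankK|exact: enum_valK].
have injf := bij_inj bf.
pose F := if p then odd_hypergraph k (f @: A) else even_hypergraph k (f @: A).
have hF : F \in H_ext 'I_#|T| k.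
  rewrite inE; apply/existsP; exists (f @: A); apply/and3P; split.
  - by rewrite -!card_gt0 card_imset ?card_gt0 in A0 *.
  - have -> : ~: (f @: A) = f @: (~: A).
      apply/setP => y; rewrite -(enum_valK y) !inE.
      by rewrite !mem_imset // inE.
    by rewrite -card_gt0 card_imset ?card_gt0.
  rewrite !card_imset // card_ord /F.
  by case: p hH hA @F => _ /=; case: (odd #|A|); case: odd => //= _; rewrite eqxx ?orbT.
apply: leq_trans (leq_bigmax_cond _ hF); apply: min_degree_mono bf _ => e he.
have [ce oe] := hH e he.
by rewrite /F; case: p oe @F hF {hH hA} => oe _ _; rewrite inE card_imset // ce eqxx
   -imsetI ?card_imset ?oe //; move=> ? ? ? ?; apply: injf.
Qed.

Section DegreeLower.
Variables (n k l : nat).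
Hypotheses (n4 : (4 <= n)%N) (lk : (l < k)%N) (ln : (l <= n)%N).

(** The even hypergraph of a set A of odd size within 1 of n/2 is always
    extremal. Its degrees are close to one half of the maximum because the
    parity of a random sequence is nearly balanced when |A| is nearly n/2. *)
Lemma delta_ext_lower :
  (1 / 2 - (k ^ 2 + 1)%:R / n%:R) * n%:R ^+ (k - l) / ((k - l)`!)%:R
    <= (delta_ext n k l)%:R :> QQ.
Proof.
have n0 : (0 < n)%N by lia.
have T0 : (0 < #|'I_n|)%N by rewrite card_ord.
(* one of two consecutive numbers is odd *)
pose a := if odd (n./2) then n./2 else (n./2).+1.
have oa : odd a by rewrite /a; case: ifP => //= ->.
have [a0 an a1 a2] : [/\ 0 < a, a < n, n <= 2 * a + 1 & 2 * a <= n + 2]%N.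
  have hn : (n./2 * 2 <= n <= n./2 * 2 + 1)%N.
    by rewrite muln2 -{2 3}(odd_double_half n); case: (odd n) => /=; lia.
  by rewrite /a; case: ifP => o; split; lia.
pose A := [set i : 'I_n | (i < a)%N].
have cA : #|A| = a.
  rewrite -sum1_card (eq_bigl (fun i : 'I_n => (i < a)%N)); last by move=> i; rewrite inE.
  by rewrite (big_ord_narrow (ltnW an)) sum1_card card_ord.
pose F := even_hypergraph k A.
have hF : F \in H_ext 'I_n k.
  rewrite inE; apply/existsP; exists A; rewrite eqxx cA oa -!card_gt0 cA a0 /=.
  by rewrite andbT cardsCs setCK cA card_ord subn_gt0.
apply: (@le_trans _ _ (min_degree l F)%:R); last by rewrite ler_nat; exact: (leq_bigmax_cond _ hF).
have uF : uniform k F by move=> e; rewrite inE => /andP [/eqP].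
apply: min_degree_ge; first by rewrite card_ord.
move=> S hS; set j := (k - l)%N.
pose s := enum S; have us : uniq s by exact: enum_uniq.
have ss : size s = l by rewrite -cardE.
have eS : S = [set x in s] by apply/setP => x; rewrite inE mem_enum.
have hj : (size s + j = k)%N by rewrite ss /j subnKC // ltnW.
have := degree_prob T0 uF us hj; rewrite -eS card_ord natrM => hdeg.
rewrite ler_pdivrMr ?ltr0n ?fact_gt0 // -hdeg ler_wpM2r ?exprn_ge0 //.
have h1 : prob j (fun t => parity (mem A) t == parity (mem A) s) <=
   prob j (fun t => edge F (s ++ t)) + prob j (fun t => ~~ uniq (s ++ t)).
  apply: le_trans (prob_or _ _ _); apply: prob_le => t ht /eqP hp.
  case: (boolP (uniq (s ++ t))) => [u|_]; last by rewrite orbT.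
  rewrite orbF /edge inE card_uniq_seq_set // size_cat ht hj eqxx /=.
  by rewrite parity_edge // parity_cat hp addbb.
have h2 := prob_uniq_cat j T0 us; rewrite card_ord in h2.
have h3 : (j * (size s + j))%:R / n%:R <= (k ^ 2)%:R / n%:R :> QQ.
  rewrite ler_wpM2r ?invr_ge0 // ler_nat hj /j; nia.
have h4 : 1 / 2 - 1 / n%:R <= prob j (fun t => parity (mem A) t == parity (mem A) s).
  rewrite parity_bias // card_ord cardE -cardE cA.
  set x := 1 - _; have n0' : 0 < n%:R :> QQ by rewrite ltr0n.
  have n4' : 4 <= n%:R :> QQ by rewrite (ler_nat _ 4).
  have hx : `|x| <= 2 / n%:R.
    have -> : x = (n%:R - 2 * a%:R) / n%:R by rewrite /x mulrBl divff ?gt_eqF // mulrA.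
    rewrite normrM normfV (ger0_norm (ltW n0')) ler_wpM2r ?invr_ge0 // ler_norml.
    have a1' : n%:R <= 2 * a%:R + 1 :> QQ by rewrite -natrM natr1 ler_nat -addn1.
    have a2' : 2 * a%:R <= n%:R + 2 :> QQ by rewrite -natrM -natrD ler_nat.
    lra.
  have hx1 : `|x| <= 1 by apply: le_trans hx _; rewrite ler_pdivrMr //; lra.
  have : `|x ^+ j| <= 2 / n%:R.
    have -> : j = j.-1.+1 by rewrite prednK // /j subn_gt0.
    rewrite normrX exprSr; apply: le_trans hx; rewrite ler_piMl //.
    by rewrite exprn_ile1.
  rewrite ler_norml => /andP [h5 h6]; case: (parity _ _); rewrite ?expr1 ?expr0; lra.
rewrite natrD mulrDl; lra.
Qed.

End DegreeLower.

Section Codegree.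
Variables (T : finType) (k l : nat) (H : {set {set T}}).
Hypotheses (n4 : (4 <= #|T|)%N) (lk : (l < k)%N) (ln : (l <= #|T|)%N).
Hypothesis uH : uniform k H.

Lemma l_degree_prob : (delta_ext #|T| k l < min_degree l H)%N ->
  forall s, uniq s -> size s = l ->
  1 / 2 - (k ^ 2 + 1)%:R / #|T|%:R <= prob (k - l) (fun t => edge H (s ++ t)).
Proof.
move=> hd s us ss; have T0 : (0 < #|T|)%N by lia.
have hj : (size s + (k - l) = k)%N by rewrite ss subnKC // ltnW.
have := degree_prob T0 uH us hj; rewrite natrM => h.
have h1 := delta_ext_lower n4 lk ln.
have h2 : (delta_ext #|T| k l)%:R <= (degree H [set x in s])%:R :> QQ.
  rewrite ler_nat; apply: leq_trans (ltnW hd) (min_degree_le _ _).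
  by rewrite card_uniq_seq_set.
have := le_trans h1 h2.
rewrite ler_pdivrMr ?ltr0n ?fact_gt0 // -h ler_pM2r //.
by rewrite exprn_gt0 // ltr0n.
Qed.

(** Extend s at random to l vertices and use [l_degree_prob]; repetitions
    account for the larger error term. *)
Lemma m_degree_prob m : (delta_ext #|T| k l < min_degree l H)%N -> (m <= l)%N ->
  forall s, uniq s -> size s = m ->
  1 / 2 - (2 * k ^ 2 + 1)%:R / #|T|%:R <= prob (k - m) (fun t => edge H (s ++ t)).
Proof.
move=> hd ml s us ss; have T0 : (0 < #|T|)%N by lia.
have -> : (k - m = (l - m) + (k - l))%N by lia.
rewrite /prob avg_cat.
have h0 := prob_uniq_cat (l - m) T0 us.
have h1 : ((l - m) * (size s + (l - m)))%:R / #|T|%:R <= (k ^ 2)%:R / #|T|%:R :> QQ.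
  by rewrite ler_wpM2r ?invr_ge0 // ler_nat ss; nia.
apply: (@le_trans _ _ (avg (l - m) (fun q => (1 / 2 - (k ^ 2 + 1)%:R / #|T|%:R) - (~~ uniq (s ++ q))%:R))).
  rewrite avgB avg_cst // -/(prob _ _); move: (le_trans h0 h1); rewrite !natrD !mulrDl natrM; lra.
apply: avg_le => q hq; case: (boolP (uniq (s ++ q))) => u /=.
  rewrite subr0; apply: le_trans (l_degree_prob hd u _) _; first by rewrite size_cat ss hq subnKC.
  by rewrite le_eqVlt; apply/orP; left; apply/eqP; apply: eq_prob => t _; rewrite catA.
apply: le_trans (avg_ge0 (fun t _ => _)) => //.
have : 0 <= (k ^ 2 + 1)%:R / #|T|%:R :> QQ by rewrite divr_ge0.
lra.
Qed.

End Codegree.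

(** * Functions that are balanced on all parallel classes *)

Local Close Scope ring_scope.

Section Dictator.
Variables (D : finType) (k m : nat).
Implicit Types (y z w : {ffun D -> 'I_k}) (a b : D).

Definition update y a (p : 'I_k) := [ffun r => if r == a then p else y r].

Lemma update_id y a : update y a (y a) = y.
Proof. by apply/ffunP => r; rewrite ffunE; case: eqP => // ->. Qed.

Lemma update_update y a p q : update (update y a p) a q = update y a q.
Proof. by apply/ffunP => r; rewrite !ffunE; case: eqP. Qed.

Lemma updateC y a b p q : b != a -> update (update y a p) b q = update (update y b q) a p.
Proof.
move=> ba; apply/ffunP => r; rewrite !ffunE; case: (altP (r =P b)) => // ->.
by rewrite (negPf ba).
Qed.

(** Change the entries of y into those of z one coordinate at a time. *)
Lemma depends_only (h : {ffun D -> 'I_k} -> bool) (A : pred D) :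
  (forall y b p, b \in A -> h (update y b p) = h y) ->
  forall y z, (forall r, r \notin A -> y r = z r) -> h y = h z.
Proof.
move=> hA y z hyz.
pose mix (s : seq D) := [ffun r => if r \in s then z r else y r].
suff mixE s : h (mix s) = h y.
  rewrite -(mixE (enum D)); congr h; apply/ffunP => r.
  by rewrite ffunE mem_enum.
elim: s => [|r s IH]; first by congr h; apply/ffunP => r; rewrite ffunE.
have -> : mix (r :: s) = update (mix s) r (z r).
  apply/ffunP => t; rewrite !ffunE inE; case: eqP => [->|_] //.
case: (boolP (r \in A)) => [rA|rA]; first by rewrite hA.
suff -> : update (mix s) r (z r) = mix s by [].
apply/ffunP => t; rewrite !ffunE; case: eqP => // ->.
by rewrite (hyz _ rA) if_same.
Qed.

Variable h : {ffun D -> 'I_k} -> bool.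
Hypotheses (m0 : 0 < m) (mk : m < k) (k3 : 2 < k).
Hypothesis classes : forall pi : D -> {perm 'I_k},
  \sum_j h [ffun r => pi r j] = m.

(** Two columns that differ everywhere belong to a common parallel class, and
    swapping their entries in one coordinate gives another class; all other members
    are the same, so the two sums can only differ in these two terms. *)
Lemma dictator_swap y z a : (forall r, y r != z r) ->
  h y + h z = h (update y a (z a)) + h (update z a (y a)).
Proof.
move=> yz.
have k0 : 0 < k by lia. have k1 : 1 < k by lia.
pose j0 := Ordinal k0; pose j1 := Ordinal k1.
have j01 : j1 != j0 by [].
(* the parallel class pi has y and z as the columns j0 and j1, and pi' is pi with
   these two columns swapped in coordinate a *)
pose s r := tperm j0 (y r).
pose pi r : {perm 'I_k} := (s r * tperm (s r j1) (z r))%g.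
have pi0 r : pi r j0 = y r.
  rewrite permM [s r j0]tpermL tpermD //; last by rewrite eq_sym.
  by rewrite -[X in _ != X](tpermL j0 (y r)) (inj_eq perm_inj).
have pi1 r : pi r j1 = z r by rewrite permM tpermL.
pose pi' r : {perm 'I_k} := if r == a then (tperm j0 j1 * pi r)%g else pi r.
have := classes pi; rewrite -(classes pi').
rewrite (bigD1 j0) //= (bigD1 j1) //= [in RHS](bigD1 j0) //= [in RHS](bigD1 j1) //=.
rewrite !addnA.
have -> : [ffun r => pi r j0] = y by apply/ffunP => r; rewrite ffunE.
have -> : [ffun r => pi r j1] = z by apply/ffunP => r; rewrite ffunE.
have -> : [ffun r => pi' r j0] = update y a (z a).
  apply/ffunP => r; rewrite !ffunE /pi'; case: eqP => [->|_] //.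
  by rewrite permM tpermL.
have -> : [ffun r => pi' r j1] = update z a (y a).
  apply/ffunP => r; rewrite !ffunE /pi'; case: eqP => [->|_] //.
  by rewrite permM tpermR.
move=> E; apply/eqP; move/eqP: E.
rewrite (eq_bigr (fun j => h [ffun r => pi' r j] : nat)) ?eqn_add2r // => j.
case/andP=> n0 n1; congr (nat_of_bool (h _)); apply/ffunP => r; rewrite !ffunE /pi'.
by case: eqP => // _; rewrite [RHS]permM tpermD // eq_sym.
Qed.

(** By [dictator_swap] the effect of changing coordinate a from p0 to p1 is the
    same at y and at any z that differs from y everywhere; as k > 2, any w is two such
    steps away from y. *)
Lemma dictator_pivot y a p : h y != h (update y a p) ->
  exists p0 p1, forall w, h (update w a p0) = false /\ h (update w a p1) = true.
Proof.
move=> hy.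
have [p0 [p1 [h0 h1]]] : exists p0 p1, h (update y a p0) = false /\ h (update y a p1) = true.
  case E: (h y) hy => /=; case E': (h _) => // _.
    by exists p, (y a); rewrite update_id.
  by exists (y a), p; rewrite update_id.
exists p0, p1.
have p01 : p0 != p1 by apply: contraFN h0 => /eqP ->; rewrite h1.
have step x z : h (update x a p0) = false -> h (update x a p1) = true ->
    (forall r, x r != z r) -> h (update z a p0) = false /\ h (update z a p1) = true.
  move=> x0 x1 xz.
  have := @dictator_swap (update x a p0) (update z a p1) a.
  rewrite !update_update !ffunE eqxx x0 x1.
  have hne r : (update x a p0) r != (update z a p1) r.
    by rewrite !ffunE; case: (r == a); [exact: p01|exact: xz].
  by move=> /(_ hne); do 2!case: (h _).
move=> w.
have hx (u v : 'I_k) : exists t, (u != t) && (t != v).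
  have : 0 < #|~: [set u; v]|.
    by rewrite cardsCs setCK card_ord cards2; case: eqP; lia.
  case/card_gt0P=> t; rewrite !inE negb_or => /andP [tu tv].
  by exists t; rewrite eq_sym tu.
(* z differs everywhere from y and from w, so that y -> z -> w are two steps *)
pose z := [ffun r => xchoose (hx (y r) (w r))].
have hz r : (y r != z r) && (z r != w r) by rewrite ffunE; exact: (xchooseP (hx (y r) (w r))).
have [z0 z1] := step y z h0 h1 (fun r => proj1 (andP (hz r))).
exact: step z0 z1 (fun r => proj2 (andP (hz r))).
Qed.

(** Two coordinates cannot both matter: by [dictator_pivot] a suitable value of
    the first forces h to be true, while a suitable value of the second forces h to be
    false. *)
Lemma dictator : exists a (F : {set 'I_k}), #|F| = m /\ forall y, h y = (y a \in F).
Proof.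
have diag : \sum_j h [ffun => j] = m.
  rewrite -(classes (fun => 1%g)); apply: eq_bigr => j _; congr (nat_of_bool (h _)).
  by apply/ffunP => r; rewrite !ffunE perm1.
have [a [y [p hy]]] : exists a y p, h y != h (update y a p).
  case: (boolP [exists a, [exists y, [exists p, h y != h (update y a p)]]]).
    by move/existsP=> [a /existsP [y /existsP [p hp]]]; exists a, y, p.
  move=> hn; exfalso.
  have hc y z : h y = h z.
    apply: (@depends_only h predT) => // x b p _; apply/eqP; rewrite eq_sym.
    apply: contraNT hn => hp; apply/existsP; exists b; apply/existsP; exists x.
    by apply/existsP; exists p.
  have k0 : 0 < k by lia.
  move: diag; rewrite (eq_bigr (fun => h [ffun => Ordinal k0] : nat)).
    rewrite sum_nat_const card_ord; case: (h _); lia.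
  by move=> j _; rewrite (hc _ [ffun => Ordinal k0]).
have [p0 [p1 hp]] := dictator_pivot hy.
exists a, [set q | h [ffun => q]]; split.
  rewrite -[RHS]diag -sum1_card [LHS]big_mkcond; apply: eq_bigr => j _.
  by rewrite inE; case: (h _).
move=> w; rewrite inE; apply: (@depends_only h (predC1 a)); last first.
  by move=> r; rewrite !inE negbK => /eqP ->; rewrite ffunE.
move=> z b q; rewrite inE => ba; apply/eqP; rewrite eq_sym; apply/negP => /negP hq.
have [q0 [q1 hb]] := dictator_pivot hq.
have [_ e1] := hp (update z b q0); have [e2 _] := hb (update z a p1).
by move: e1; rewrite -updateC // e2.
Qed.

End Dictator.

(** Every column occurs equally often in the cyclic shifts of a given parallel
    class, so the average over the shifts is governed by the density of h. If that
    density is extreme, then each class attains the bound. *)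
Lemma class_average (D : finType) k m (h : {ffun D -> 'I_k} -> bool) : 0 < k ->
  (forall pi : D -> {perm 'I_k}, \sum_j h [ffun r => pi r j] <= m) ->
  k * (\sum_y h y) <= m * k ^ #|D| /\
  (k * (\sum_y h y) = m * k ^ #|D| ->
   forall pi : D -> {perm 'I_k}, \sum_j h [ffun r => pi r j] = m).
Proof.
case: k h => [//|k] h _ hle.
have E (pi : D -> {perm 'I_k.+1}) :
    k.+1 * (\sum_y h y) = \sum_(y : {ffun D -> 'I_k.+1}) \sum_j h [ffun r => pi r (j + y r)%R].
  transitivity (\sum_(j < k.+1) \sum_y h y); first by rewrite sum_nat_const card_ord.
  rewrite [RHS]exchange_big /=; apply: eq_bigr => j _.
  rewrite (reindex (fun y : {ffun D -> 'I_k.+1} => [ffun r => pi r (j + y r)%R])) //=.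
  exists (fun y : {ffun D -> 'I_k.+1} => [ffun r => ((pi r)^-1%g (y r) - j)%R]) => y _;
    apply/ffunP => r; rewrite !ffunE.
  + by rewrite permK addrC addKr.
  + by rewrite addrC subrK permKV.
have le_all (pi : D -> {perm 'I_k.+1}) y : \sum_j h [ffun r => pi r (j + y r)%R] <= m.
  pose s r := perm (@GRing.addIr _ (y r : 'I_k.+1)).
  apply: leq_trans (hle (fun r => (s r * pi r)%g)).
  rewrite leq_eqVlt; apply/orP; left; apply/eqP; apply: eq_bigr => j _.
  by congr (nat_of_bool (h _)); apply/ffunP => r; rewrite !ffunE permM permE.
have cst : \sum_(y : {ffun D -> 'I_k.+1}) m = m * k.+1 ^ #|D|.
  by rewrite sum_nat_const mulnC card_ffun card_ord.
(* averaging over the translations y of the class pi *)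
split; first by rewrite (E (fun => 1%g)) -cst; apply: leq_sum => y _.
move=> eq pi; apply/eqP; rewrite eqn_leq hle /= leqNgt; apply/negP => lt.
have : k.+1 * (\sum_y h y) < m * k.+1 ^ #|D|.
  rewrite (E pi) -cst (bigD1 [ffun => 0%R]) //= [X in _ < X](bigD1 [ffun => 0%R]) //=.
  rewrite -addSn; apply: leq_add; last by apply: leq_sum.
  apply: leq_trans lt; rewrite ltnS leq_eqVlt; apply/orP; left; apply/eqP.
  apply: eq_bigr => j _; congr (nat_of_bool (h _)); apply/ffunP => r.
  by rewrite !ffunE addr0.
by rewrite eq ltnn.
Qed.

(** * Heavy transversals of m + 1 rows *)

Lemma enum_set (U : finType) (F : {set U}) m : #|F| = m ->
  exists e : 'I_m -> U, injective e /\ forall j, e j \in F.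
Proof.
by move=> <-; exists (fun j => enum_val j); split; [exact: enum_val_inj|exact: enum_valP].
Qed.

Section Rows.
Variables (T : finType) (k m : nat).
Hypotheses (m2 : 1 < m) (km : k = 2 * m).
Variables (psi : 'I_m.+1 -> 'I_k -> T) (hv : {set T} -> bool).
Hypothesis psi_inj : forall r p r' p', psi r p = psi r' p' -> r = r' /\ p = p'.

(** A transversal of the rows other than c. Indexing it by functions on all rows
    lets blocks that omit different rows be compared entry by entry. *)
Definition block (c : 'I_m.+1) (y : {ffun 'I_m.+1 -> 'I_k}) : {set T} :=
  [set psi r (y r) | r in [set~ c]].

Hypothesis aug : forall (I : finType) (J : {set I}) (q : I -> {set T}) (C : {set 'I_m.+1}),
  (forall i, i \in J -> hv (q i)) ->
  (forall i j, i \in J -> j \in J -> i != j -> [disjoint q i & q j]) ->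
  (forall i, i \in J -> q i \subset [set psi r p | r in C, p in 'I_k]) ->
  #|J| <= #|C|.

Lemma block_disjoint c c' (y z : {ffun 'I_m.+1 -> 'I_k}) :
  (forall r, y r != z r) -> [disjoint block c y & block c' z].
Proof.
move=> yz; rewrite disjoint_subset; apply/subsetP => _ /imsetP [r _ ->].
rewrite !inE; apply/negP => /imsetP [r' _ /psi_inj [<- e]].
by have := yz r; rewrite e eqxx.
Qed.

Lemma block_sub (c : 'I_m.+1) y (C : {set 'I_m.+1}) :
  [set~ c] \subset C -> block c y \subset [set psi r p | r in C, p in 'I_k].
Proof.
move=> sC; apply/subsetP => _ /imsetP [r hr ->]; apply/imset2P.
by exists r (y r) => //; apply: (subsetP sC).
Qed.

(** For each omitted row the bound on disjoint heavy blocks gives density at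
    most 1/2. If all omitted rows had density exactly 1/2, then each time heaviness
    would be decided by one row: row a when row 0 is omitted, and some row b <> a
    when row a is omitted. Then m heavy blocks through row a that avoid the heavy
    half of row b, and m heavy blocks that use it, are 2m disjoint heavy blocks in
    m + 1 rows, too many because m > 1. *)
Lemma heavy_rows_lt :
  \sum_c \sum_(y : {ffun 'I_m.+1 -> 'I_k}) hv (block c y) < m.+1 * (m * k ^ m).
Proof.
have k0 : 0 < k by lia.
pose h c (y : {ffun 'I_m.+1 -> 'I_k}) := hv (block c y).
have cls c (pi : 'I_m.+1 -> {perm 'I_k}) : \sum_j h c [ffun r => pi r j] <= m.
  have -> : \sum_j h c [ffun r => pi r j] = #|[set j | h c [ffun r => pi r j]]|.
    rewrite -sum1_card [RHS]big_mkcond; apply: eq_bigr => j _.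
    by rewrite inE; case: (h _ _).
  have cC : #|[set~ c]| = m by rewrite cardsC1 card_ord.
  rewrite -[X in _ <= X]cC; apply: (aug (q := fun j => block c [ffun r => pi r j])).
  - by move=> j; rewrite inE.
  - move=> i j _ _ ij; apply: block_disjoint => r; rewrite !ffunE.
    by rewrite (inj_eq perm_inj).
  - by move=> j _; apply: block_sub.
have avgc c := class_average k0 (cls c).
have le_c c : \sum_y h c y <= m * k ^ m.
  have [le _] := avgc c; rewrite card_ord expnS mulnCA leq_pmul2l // in le.
rewrite ltnNge; apply/negP => ge.
have eq_c c : \sum_y h c y = m * k ^ m.
  apply/eqP; rewrite eqn_leq le_c leqNgt; apply/negP => lt.
  suff : \sum_c \sum_y h c y < m.+1 * (m * k ^ m) by rewrite ltnNge ge.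
  rewrite (bigD1 c) //= mulSn -addSn; apply: leq_add => //.
  apply: (@leq_trans (\sum_(i | i != c) (m * k ^ m))); first exact: leq_sum.
  by rewrite sum_nat_const cardC1 card_ord.
have dict c : exists a (F : {set 'I_k}), #|F| = m /\ forall y, h c y = (y a \in F).
  apply: dictator; [lia|lia|lia|].
  have [_ eqv] := avgc c; apply: eqv.
  by rewrite card_ord eq_c expnS mulnCA.
have dict_ne c a (F : {set 'I_k}) : #|F| = m -> (forall y, h c y = (y a \in F)) -> a != c.
  move=> cF hF; apply/eqP => ac.
  have [p pF] : exists p, p \in F by apply/card_gt0P; lia.
  have [q qF] : exists q, q \in ~: F by apply/card_gt0P; rewrite cardsCs setCK card_ord; lia.
  have hpq : h c (update [ffun => q] a p) = h c [ffun => q].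
    congr hv; apply: eq_in_imset => r; rewrite !inE => rc.
    by rewrite !ffunE ac (negPf rc).
  by move: hpq qF; rewrite !hF !ffunE eqxx inE pF => <-.
have [a [F [cF hF]]] := dict ord0.
have [b [G [cG hG]]] := dict a.
have ba := dict_ne _ _ _ cG hG.
have cFc : #|~: F| = m by rewrite cardsCs setCK card_ord; lia.
have cGc : #|~: G| = m by rewrite cardsCs setCK card_ord; lia.
have [eF [iF mF]] := enum_set cF; have [eF' [iF' mF']] := enum_set cFc.
have [eG [iG mG]] := enum_set cG; have [eG' [iG' mG']] := enum_set cGc.
(* the rows other than a and b are split by F too, which keeps the batches apart *)
pose y1 j := [ffun r : 'I_m.+1 => if r == b then eG' j else eF j].
pose y2 j := [ffun r : 'I_m.+1 => if r == b then eG j else eF' j].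
pose q (i : bool * 'I_m) := if i.1 then block ord0 (y1 i.2) else block a (y2 i.2).
have ne_c (A : {set 'I_k}) u v : u \in A -> v \in ~: A -> u != v.
  by move=> uA; rewrite inE; apply: contraNneq => <-.
suff : #|[set: bool * 'I_m]| <= #|[set: 'I_m.+1]|.
  by rewrite !cardsT card_prod card_bool !card_ord; lia.
apply: (aug (q := q)).
- move=> [[] j] _; rewrite /q /=.
    by have := hF (y1 j); rewrite ffunE eq_sym (negPf ba) mF.
  by have := hG (y2 j); rewrite ffunE eqxx mG.
- move=> [[] i] [[] j] _ _; rewrite xpair_eqE /= => ij;
    apply: block_disjoint => r; rewrite !ffunE; case: (r == b).
  + by rewrite (inj_eq iG').
  + by rewrite (inj_eq iF).
  + by rewrite eq_sym (ne_c G).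
  + by rewrite (ne_c F).
  + by rewrite (ne_c G).
  + by rewrite eq_sym (ne_c F).
  + by rewrite (inj_eq iG).
  + by rewrite (inj_eq iF').
- by move=> [[] i] _; apply: block_sub; rewrite subsetT.
Qed.

End Rows.

(** * Greedy completion and rows *)

Local Open Scope ring_scope.

(** Completes disjoint sets to disjoint edges one at a time: the vertices
    already in use are few, so they spoil only a small part of the many completions. *)
Lemma greedy_extension (T : finType) k (H : {set {set T}}) j (c : QQ)
    (Y Z : {set T}) (qs : seq {set T}) :
  (0 < #|T|)%N -> (0 < k)%N -> uniform k H ->
  (forall q, q \in qs ->
     c <= prob j (fun t => ([set x in t] :|: q \in H) && all (mem Y) t)) ->
  pairwise (fun A B : {set T} => [disjoint A & B]) qs ->
  (forall q, q \in qs -> q \subset Z) ->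
  (j * (#|Z| + j * size qs))%:R / #|T|%:R < c ->
  exists M : {set {set T}}, [/\ M \subset H, trivIset M,
    \bigcup_(q <- qs) q \subset cover M,
    cover M \subset \bigcup_(q <- qs) q :|: (Y :\: Z) & #|M| = size qs].
Proof.
move=> T0 k0 uH; elim: qs Z => [|q qs IH] Z hq.
  move=> _ _ _; exists set0; rewrite big_nil; split; rewrite ?sub0set ?cards0 //.
    by rewrite /trivIset /cover !big_set0 cards0.
  by rewrite /cover big_set0 sub0set.
move=> /= /andP [/allP dq pq] hZ hc.
have [t st /andP [/andP [tH tY] tZ]] : exists2 t, size t = j &
    (([set x in t] :|: q \in H) && all (mem Y) t) && ~~ has (mem Z) t.
  apply: (prob_exists T0).
  have h1 := hq q (mem_head _ _).
  rewrite (prob_split j _ (has (mem Z))) in h1.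
  have h2 : prob j (fun s => (([set x in s] :|: q \in H) && all (mem Y) s) && has (mem Z) s)
     <= prob j (has (mem Z)) by apply: prob_le => s _ /andP [].
  have h3 := prob_hit T0 j Z.
  have h4 : j%:R * (#|Z|%:R / #|T|%:R) <= (j * (#|Z| + j * (size qs).+1))%:R / #|T|%:R :> QQ.
    by rewrite mulrA -natrM ler_wpM2r ?invr_ge0 // ler_nat leq_mul2l leq_addr orbT.
  lra.
set W := [set x in t]; set e := W :|: q.
have WY : W \subset Y by apply/subsetP => x; rewrite inE => /(allP tY).
have WZ : [disjoint W & Z].
  rewrite disjoint_subset; apply/subsetP => x; rewrite !inE => xt.
  by apply: contra tZ => xZ; apply/hasP; exists x.
have qZ : q \subset Z by apply: hZ; rewrite mem_head.
have qsZ : \bigcup_(q <- qs) q \subset Z.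
  rewrite big_seq; elim/big_rec: _ => [|A B hA hB]; first exact: sub0set.
  by rewrite subUset hB hZ // inE hA orbT.
have dqs : [disjoint q & \bigcup_(q <- qs) q].
  rewrite big_seq; elim/big_rec: _ => [|A B hA hB]; first by rewrite -setI_eq0 setI0.
  by rewrite disjoint_sym disjointsU // disjoint_sym // dq.
have [M [MH tM qM cM sM]] : exists M : {set {set T}}, [/\ M \subset H, trivIset M,
    \bigcup_(q <- qs) q \subset cover M,
    cover M \subset \bigcup_(q <- qs) q :|: (Y :\: (Z :|: W)) & #|M| = size qs].
  apply: IH => //.
  - by move=> A hA; apply: hq; rewrite inE hA orbT.
  - by move=> A hA; apply: subset_trans (subsetUl _ _); apply: hZ; rewrite inE hA orbT.
  - apply: le_lt_trans hc; rewrite ler_wpM2r ?invr_ge0 // ler_nat leq_mul2l.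
    apply/orP; right; rewrite mulnS addnA leq_add2r.
    apply: leq_trans (leq_card_setU _ _).1 _; rewrite leq_add2l -st.
    exact: card_seq_set.
have de : [disjoint e & cover M].
  apply: disjointWr cM _; rewrite /e disjointsU //.
    rewrite disjoint_sym disjointsU //.
      by apply: disjointWl qsZ _; rewrite disjoint_sym.
    rewrite disjoint_subset; apply/subsetP => x; rewrite !inE negb_or.
    by case/andP => /andP [].
  rewrite disjoint_sym disjointsU //; first by rewrite disjoint_sym.
  rewrite disjoint_subset; apply/subsetP => x; rewrite !inE negb_or.
  by case/andP => /andP [xZ _] _; apply: contra xZ; apply: (subsetP qZ).
have eM : e \notin M.
  apply/negP => eM; have : e != set0 by rewrite -card_gt0 (uH _ tH).
  by move/set0Pn => [x xe]; move/pred0P/(_ x): de; rewrite /= xe (subsetP (bigcup_sup e eM)).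
exists (e |: M); split.
- by rewrite subUset sub1set tH.
- apply/trivIsetP => A B; rewrite !inE => /orP [/eqP->|hA] /orP [/eqP->|hB].
  + by rewrite eqxx.
  + by move=> _; apply: disjointWr de; apply: bigcup_sup.
  + by move=> _; rewrite disjoint_sym; apply: disjointWr de; apply: bigcup_sup.
  + by move: A B hA hB; apply/trivIsetP.
- rewrite big_cons /cover bigcup_setU big_set1 setUSS //.
  exact: subsetUr.
- rewrite big_cons /cover bigcup_setU big_set1 !subUset; apply/andP; split.
    apply/andP; split.
      apply: subset_trans (subsetUr _ _); rewrite subsetD WY.
      by rewrite WZ.
    by apply: subset_trans (subsetUl _ _); exact: subsetUl.
  apply: subset_trans cM _; apply: setUSS; first exact: subsetUr.
  by apply: setDS; exact: subsetUl.
- by rewrite cardsU1 eM sM.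
Qed.

Section Sums.
Variable T : finType.

Lemma avg_ffun j (F : seq T -> QQ) : (0 < #|T|)%N ->
  avg j F * #|T|%:R ^+ j = \sum_(q : {ffun 'I_j -> T}) F [seq q i | i <- enum 'I_j].
Proof.
move=> T0; rewrite avg_tuple //.
rewrite (reindex (fun q : {ffun 'I_j -> T} => [tuple q i | i < j])) //=.
exists (fun t : j.-tuple T => [ffun i => tnth t i]) => t _.
  by apply/ffunP => i; rewrite ffunE tnth_mktuple.
by apply: eq_from_tnth => i; rewrite tnth_mktuple ffunE.
Qed.

Lemma seq_ffun_set j (q : {ffun 'I_j -> T}) :
  [set x in [seq q i | i <- enum 'I_j]] = [set q i | i : 'I_j].
Proof.
apply/setP => x; rewrite inE; apply/mapP/imsetP => [[i _ ->]|[i _ ->]]; exists i => //.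
by rewrite mem_enum.
Qed.

(** Dropping coordinate c turns a sum over (j+1)-tuples into one over j-tuples. *)
Lemma sum_omit j (c : 'I_j.+1) (V : {set T}) (F : {ffun 'I_j -> T} -> nat) :
  (\sum_(s : {ffun 'I_j.+1 -> T}) (s c \in V) * F [ffun i => s (lift c i)]
   = #|V| * \sum_q F q)%N.
Proof.
rewrite (reindex (fun p : T * {ffun 'I_j -> T} =>
  [ffun r => if unlift c r is Some i then p.2 i else p.1])) /=; last first.
  exists (fun s : {ffun 'I_j.+1 -> T} => (s c, [ffun i => s (lift c i)])).
    move=> [x q] _ /=; rewrite !ffunE unlift_none; congr pair.
    by apply/ffunP => i; rewrite !ffunE liftK.
  move=> s _; apply/ffunP => r; rewrite !ffunE /=.
  by case: unliftP => [i ->|->] //; rewrite ffunE.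
transitivity (\sum_(p : T * {ffun 'I_j -> T}) (p.1 \in V) * F p.2)%N.
  apply: eq_bigr => -[x q] _; rewrite !ffunE unlift_none; congr (_ * F _)%N.
  by apply/ffunP => i; rewrite !ffunE liftK.
rewrite -(pair_bigA _ (fun x q => (x \in V) * F q)%N) /=.
rewrite -sum1_card big_distrl /= [RHS]big_mkcond; apply: eq_bigr => x _.
by rewrite -big_distrr /=; case: (x \in V).
Qed.

Lemma card_not_injective j : (0 < #|T|)%N ->
  #|[set q : {ffun 'I_j.+1 -> T} | ~~ injectiveb q]|%:R <= j.+1%:R ^+ 2 * #|T|%:R ^+ j :> QQ.
Proof.
move=> T0; have n0 := cardT_gt0 T0.
have := prob_not_uniq T0 j.+1; rewrite -(ler_pM2r (exprn_gt0 j.+1 n0)).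
rewrite /prob avg_ffun // [#|T|%:R ^+ j.+1]exprS [X in _ <= X]mulrA divfK ?gt_eqF //.
apply: le_trans; rewrite -sum1_card natr_sum big_mkcond /=.
by apply: ler_sum => q _; rewrite inE /injectiveb /dinjectiveb; case: uniq.
Qed.

End Sums.

Section FlattenRows.
Variable T : finType.

Lemma nth_flatten_uniform k x0 (es : seq {set T}) i p :
  (forall e, e \in es -> #|e| = k) -> (i < size es)%N -> (p < k)%N ->
  nth x0 (flatten [seq enum e | e : {set T} <- es]) (i * k + p) \in nth set0 es i.
Proof.
elim: es i => [//|e es IH] [|i] he hi hp /=; rewrite nth_cat -cardE he ?mem_head //.
  by rewrite add0n hp -mem_enum mem_nth // -cardE he ?mem_head.
rewrite mulSn -addnA ltnNge leq_addr /= addKn; apply: IH => // f hf.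
by apply: he; rewrite inE hf orbT.
Qed.

(** List the vertices of the edges of M, edge after edge, followed by the other
    vertices of V, and cut the list into segments of length k. *)
Lemma matching_rows k t (M : {set {set T}}) (V : {set T}) :
  (0 < k)%N -> (forall e, e \in M -> #|e| = k) -> trivIset M -> cover M \subset V ->
  #|V| = (t * k)%N ->
  exists rho : 'I_t -> 'I_k -> T,
  [/\ forall i p i' p', rho i p = rho i' p' -> i = i' /\ p = p',
      forall v, v \in V -> exists i p, v = rho i p,
      forall i p, rho i p \in V &
      forall i, exists e0, forall p e, e \in M -> rho i p \in e -> e = e0].
Proof.
move=> k0 Mk tM cM Vt.
case: (posnP t) => [t0|t0].
  have e (i : 'I_t) : False by case: i => i; rewrite t0.
  exists (fun i => match e i with end); split; try by move=> i; case: (e i).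
  have V0 : V = set0 by apply/eqP; rewrite -cards_eq0 Vt t0.
  by move=> v; rewrite V0 inE.
have [x0 _] : exists x0, x0 \in V by apply/card_gt0P; rewrite Vt muln_gt0 t0.
pose es := enum M; pose vs := flatten [seq enum e | e : {set T} <- es] ++ enum (V :\: cover M).
have memf x : (x \in flatten [seq enum e | e : {set T} <- es]) = (x \in cover M).
  apply/flattenP/bigcupP => [[s /mapP [e he ->]]|[e he xe]].
    by rewrite mem_enum => xe; exists e => //; rewrite mem_enum in he.
  by exists (enum e); [apply: map_f; rewrite mem_enum|rewrite mem_enum].
have memvs x : (x \in vs) = (x \in V).
  rewrite mem_cat memf mem_enum inE; case: (boolP (x \in cover M)) => //= xM.
  by rewrite (subsetP cM).
have sz1 : size (flatten [seq enum e | e : {set T} <- es]) = (#|M| * k)%N.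
  rewrite size_flatten /shape -map_comp sumnE big_map big_enum /=.
  by rewrite (eq_bigr (fun => k)) ?sum_nat_const // => e /Mk; rewrite -cardE.
have szvs : size vs = (t * k)%N.
  rewrite size_cat sz1 -cardE cardsD (setIidPr cM) Vt -(eqP tM).
  rewrite (eq_bigr (fun => k)) // sum_nat_const subnKC // -Vt.
  apply: leq_trans (subset_leq_card cM); rewrite -(eqP tM).
  by rewrite (eq_bigr (fun => k)) // sum_nat_const.
have uvs : uniq vs.
  apply/card_uniqP; rewrite szvs -Vt; apply: eq_card => x; exact: memvs.
have lt_idx (i : 'I_t) (p : 'I_k) : (i * k + p < t * k)%N.
  by have := ltn_ord i; have := ltn_ord p; nia.
exists (fun (i : 'I_t) (p : 'I_k) => nth x0 vs (i * k + p)); split.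
- move=> i p i' p' /eqP; rewrite nth_uniq ?szvs // => /eqP E.
  have : ((i * k + p) %/ k = (i' * k + p') %/ k)%N by rewrite E.
  have : ((i * k + p) %% k = (i' * k + p') %% k)%N by rewrite E.
  rewrite !modnMDl !divnMDl // !modn_small // !divn_small // !addn0 => e1 e2.
  by split; apply: val_inj.
- move=> v; rewrite -memvs => hv.
  have hi : (index v vs < t * k)%N by rewrite -szvs index_mem.
  have h1 : (index v vs %/ k < t)%N by rewrite ltn_divLR.
  have h2 : (index v vs %% k < k)%N by rewrite ltn_mod.
  by exists (Ordinal h1), (Ordinal h2); rewrite /= -divn_eq nth_index.
- by move=> i p; rewrite -memvs mem_nth // szvs.
- move=> i; exists (nth set0 es i) => p e eM.
  rewrite nth_cat sz1; case: ltnP => [lt|ge].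
    have iM : (i < #|M|)%N.
      by rewrite -(ltn_pmul2r k0); apply: leq_ltn_trans lt; exact: leq_addr.
    have h1 : nth x0 (flatten [seq enum e | e : {set T} <- es]) (i * k + p) \in nth set0 es i.
      by apply: nth_flatten_uniform; rewrite -?cardE // => f; rewrite mem_enum; exact: Mk.
    move=> h2; apply/eqP; apply: contraTT h2 => ne.
    have h3 : nth set0 es i \in M by rewrite -mem_enum mem_nth // -cardE.
    have := trivIsetP tM _ _ eM h3 ne; rewrite disjoint_sym disjoint_subset.
    by move/subsetP => h5; apply: h5.
  move=> he; exfalso.
  have : nth x0 (enum (V :\: cover M)) (i * k + p - #|M| * k) \in V :\: cover M.
    rewrite -mem_enum mem_nth //; have := lt_idx i p; rewrite -szvs size_cat sz1.
    by move=> h; rewrite ltn_subLR.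
  rewrite inE => /andP [/negP h _]; apply: h.
  by apply: (subsetP (bigcup_sup e eM)).
Qed.

End FlattenRows.

(** * Almost perfect matchings *)

Lemma div_nat_le (a e : QQ) : 0 < e -> exists n0, forall n, (n0 <= n)%N -> a / n%:R <= e.
Proof.
move=> e0; exists (Num.bound (`|a| / e)).+1 => n hn.
have n0 : 0 < n%:R :> QQ by rewrite ltr0n; apply: leq_trans hn.
rewrite ler_pdivrMr // (le_trans (ler_norm a)) // -ler_pdivrMl //.
have h : 0 <= `|a| / e by rewrite divr_ge0 // ltW.
rewrite mulrC; apply: le_trans (ltW (archi_boundP h)) _.
by rewrite ler_nat ltnW.
Qed.

Section NearPerfect.
Variables (T : finType) (k m : nat) (H : {set {set T}}) (V : {set T}).
Hypotheses (T0 : (0 < #|T|)%N) (m2 : (1 < m)%N) (km : k = (2 * m)%N).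
Hypotheses (uH : uniform k H) (kV : (k %| #|V|)%N).
Let n := #|T|.

Lemma max_matching : exists M : {set {set T}},
  [/\ M \subset H, trivIset M, cover M \subset V &
     forall M' : {set {set T}}, M' \subset H -> trivIset M' -> cover M' \subset V ->
       (#|M'| <= #|M|)%N].
Proof.
pose P (M : {set {set T}}) := [&& M \subset H, trivIset M & cover M \subset V].
have P0 : P set0 by rewrite /P sub0set /trivIset /cover !big_set0 cards0 sub0set eqxx.
case: (arg_maxnP (fun M : {set {set T}} => #|M|) P0) => M /and3P [h1 h2 h3] h4.
by exists M; split=> // M' a b c; apply: h4; rewrite /P a b c.
Qed.

Variables (M : {set {set T}}).
Hypotheses (MH : M \subset H) (tM : trivIset M) (MV : cover M \subset V).
Hypothesis Mmax : forall M' : {set {set T}}, M' \subset H -> trivIset M' ->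
  cover M' \subset V -> (#|M'| <= #|M|)%N.
Let U := V :\: cover M.

Variable c0 : QQ.
Hypothesis c0n : (m * (m.+1 * k + m * m.+2))%:R / n%:R < c0.

(** The set Q can be completed to an edge by a positive proportion of the
    m-tuples of vertices outside the matching. *)
Definition heavy (Q : {set T}) :=
  c0 <= prob m (fun t => ([set x in t] :|: Q \in H) && all (mem U) t).

(** More than |C| disjoint heavy sets inside the rows of C could be completed
    disjointly in U and would replace the at most |C| edges of M that meet these rows. *)
Lemma heavy_augment t (rho : 'I_t -> 'I_k -> T) :
  (forall i p i' p', rho i p = rho i' p' -> i = i' /\ p = p') ->
  (forall i p, rho i p \in V) ->
  (forall i, exists e0, forall p e, e \in M -> rho i p \in e -> e = e0) ->
  forall (r : {ffun 'I_m.+1 -> 'I_t}) (I : finType) (J : {set I}) (q : I -> {set T})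
    (C : {set 'I_m.+1}),
  (forall i, i \in J -> heavy (q i)) ->
  (forall i j, i \in J -> j \in J -> i != j -> [disjoint q i & q j]) ->
  (forall i, i \in J -> q i \subset [set rho (r a) p | a in C, p in 'I_k]) ->
  (#|J| <= #|C|)%N.
Proof.
move=> rinj rV rM r I J q C hJ dJ sJ; rewrite leqNgt; apply/negP => lt.
have k0 : (0 < k)%N by lia.
pose Z := [set rho (r a) p | a in C, p in 'I_k].
have cZ : (#|Z| <= m.+1 * k)%N.
  apply: (@leq_trans #|[set rho (r p.1) p.2 | p in setX C [set: 'I_k]]|).
    apply: subset_leq_card; apply/subsetP => _ /imset2P [a p aC _ ->].
    by apply/imsetP; exists (a, p); rewrite ?inE ?aC.
  apply: leq_trans (leq_imset_card _ _) _; rewrite cardsX cardsT card_ord leq_mul2r.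
  by apply/orP; right; rewrite -[X in (_ <= X)%N](card_ord m.+1) max_card.
have ZV : Z \subset V by apply/subsetP => _ /imset2P [a p _ _ ->]; apply: rV.
(* one set more than the rows of C allow *)
pose js := take #|C|.+1 (enum J).
have sjs : size js = #|C|.+1 by rewrite size_takel // -cardE.
have mjs i : i \in js -> i \in J by move=> /mem_take; rewrite mem_enum.
have ujs : uniq js by rewrite take_uniq // enum_uniq.
pose qs := [seq q i | i <- js].
have cC : (#|C| <= m.+1)%N by rewrite -[X in (_ <= X)%N](card_ord m.+1) max_card.
have [||||M1 [M1H tM1 _ cM1 sM1]] :=
    @greedy_extension T k H m c0 U Z qs T0 k0 uH.
- by move=> A /mapP [i hi ->]; apply: hJ; apply: mjs.
- rewrite /qs pairwise_map; apply: (sub_in_pairwise (P := mem J) (r := fun i j => i != j)).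
  + by move=> i j iJ jJ; apply: dJ.
  + by apply/allP => i; apply: mjs.
  + by rewrite -uniq_pairwise.
- by move=> A /mapP [i hi ->]; apply: sJ; apply: mjs.
- apply: le_lt_trans c0n; rewrite ler_wpM2r ?invr_ge0 // ler_nat leq_mul2l.
  apply/orP; right; apply: leq_add => //; rewrite leq_mul2l size_map sjs ltnS.
  by rewrite cC orbT.
have qsZ : \bigcup_(A <- qs) A \subset Z.
  rewrite big_seq; elim/big_rec: _ => [|A B hA hB]; first exact: sub0set.
  rewrite subUset hB andbT; case/mapP: hA => i hi ->; apply: sJ; exact: mjs.
pose M0 := [set e in M | [disjoint e & Z]].
have dM : [disjoint cover M0 & cover M1].
  rewrite disjoint_sym; apply/bigcup_disjoint => e; rewrite inE => /andP [eM eZ].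
  apply: disjointWl cM1 _; apply: disjointsU.
    by apply: disjointWl qsZ _; rewrite disjoint_sym.
  rewrite disjoint_subset; apply/subsetP => x; rewrite !inE => /andP [_ /andP [xM _]].
  by apply: contra xM => xe; apply/bigcupP; exists e.
have cM0M : cover M0 \subset cover M.
  by apply/bigcupsP => e; rewrite inE => /andP [eM _]; apply: bigcup_sup.
have card_lost : (#|M :\: M0| <= #|C|)%N.
  have : forall a : 'I_m.+1, exists e0, [forall p, forall (e | e \in M), (rho (r a) p \in e) ==> (e == e0)].
    move=> a; have [e0 he0] := rM (r a); exists e0; apply/forallP => p.
    by apply/forall_inP => e eM; apply/implyP => /he0 -> //.
  move/fin_all_exists => [f hf].
  apply: leq_trans (leq_imset_card f C); apply: subset_leq_card.
  apply/subsetP => e; rewrite !inE => /andP [h eM]; rewrite eM /= in h.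
  have [x xe] : exists x, (x \in e) && (x \in Z).
    by move/pred0Pn: h => [x /= hx]; exists x.
  case/andP: xe => xe /imset2P [a p aC _ ex]; apply/imsetP; exists a => //.
  have := hf a => /forallP /(_ p) /forall_inP /(_ e eM); rewrite -ex xe => /eqP.
  by [].
have : (#|M0 :|: M1| <= #|M|)%N.
  apply: Mmax.
  - rewrite subUset M1H andbT; apply: subset_trans MH.
    by apply/subsetP => e; rewrite inE => /andP [].
  - apply: trivIsetU => //; apply: trivIsetS tM.
    by apply/subsetP => e; rewrite inE => /andP [].
  - rewrite /cover bigcup_setU subUset (subset_trans cM0M MV) /=.
    apply: subset_trans cM1 _; rewrite subUset (subset_trans qsZ ZV) /=.
    by apply: subset_trans (subsetDl _ _) (subsetDl _ _).
have d01 : M0 :&: M1 = set0.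
  apply/setP => e; rewrite inE in_set0; apply/negP => /andP [h0 h1].
  have : e != set0 by rewrite -card_gt0 (uH (subsetP M1H _ h1)).
  case/set0Pn => x xe; move/pred0P/(_ x): dM => /=.
  by rewrite !(subsetP (bigcup_sup e _)).
rewrite cardsU d01 cards0 subn0 sM1 size_map sjs.
have sM0 : M0 \subset M by apply/subsetP => e; rewrite inE => /andP [].
rewrite -[#|M|](cardsID M0) (setIidPr sM0) leq_add2l => /leq_trans /(_ card_lost).
by rewrite ltnn.
Qed.

(** Double counting of the pairs formed by an m-tuple of U and an m-tuple of V
    that together form an edge. *)
Lemma heavy_prob (e0 d : QQ) :
  0 < d -> 0 <= e0 -> e0 <= 1 / 2 -> c0 <= e0 * d ^+ m -> m%:R ^+ 2 / n%:R <= e0 * d ^+ m ->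
  d * n%:R <= #|U|%:R ->
  (forall s, uniq s -> size s = m -> {subset s <= V} ->
     1 / 2 - e0 <= prob m (fun t => edge H (s ++ t) && all (mem V) t)) ->
  1 / 2 - 3 * e0 <= prob m (fun q => all (mem V) q && heavy [set x in q]).
Proof.
move=> d0 e00 e01 hc0 hmn hU hdeg; have n0 := cardT_gt0 T0.
set u := #|U|%:R / #|T|%:R : QQ.
have du : d <= u by rewrite ler_pdivlMr.
have um : d ^+ m <= u ^+ m by apply: lerXn2r; rewrite ?nnegrE // ltW // (lt_le_trans d0).
have um0 : 0 < u ^+ m by rewrite exprn_gt0 // (lt_le_trans d0).
have pU : prob m (all (mem U)) = u ^+ m.
  have := prob_all_cat m 0 U U; rewrite expr0 mulr1 addn0 => <-.
  by apply: eq_prob => s hs; rewrite take_oversize ?hs // drop_oversize ?hs //= andbT.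
pose X := avg m (fun s => avg m (fun q =>
  (all (mem U) s && uniq s && (edge H (s ++ q) && all (mem V) q))%:R)).
have lowX : (1 / 2 - e0) * (u ^+ m - e0 * u ^+ m) <= X.
  apply: (@le_trans _ _ ((1 / 2 - e0) * prob m (fun s => all (mem U) s && uniq s))).
    rewrite ler_wpM2l ?subr_ge0 //.
    have h1 := prob_split m (all (mem U)) uniq; rewrite pU in h1.
    have h2 : prob m (fun s : seq T => all (mem U) s && ~~ uniq s) <= prob m (fun s : seq T => ~~ uniq s).
      by apply: prob_le => s _ /andP [].
    have h3 := prob_not_uniq T0 m.
    have h4 : e0 * d ^+ m <= e0 * u ^+ m by rewrite ler_wpM2l.
    have h5 : prob m (fun s : seq T => ~~ uniq s) <= e0 * d ^+ m by apply: le_trans h3 hmn.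
    lra.
  rewrite -avgZ; apply: avg_le => s hs.
  case: (boolP (all (mem U) s && uniq s)) => /= [/andP [/allP sU us]|_].
    rewrite mulr1; apply: hdeg => // x /sU; by rewrite !inE => /andP [].
  by rewrite mulr0; apply: avg_ge0.
have upX : X <= prob m (fun q => all (mem V) q && heavy [set x in q]) * u ^+ m + c0.
  rewrite /X exchange_avg // mulrC -avgZ -[X in _ + X](avg_cst T0 m) -avgD.
  apply: avg_le => q _.
  have c00 : 0 <= c0 by apply: ltW; apply: le_lt_trans c0n; rewrite divr_ge0.
  case: (boolP (all (mem V) q)) => qV /=; last first.
    rewrite mulr0 add0r; apply: le_trans c00; rewrite -[X in _ <= X](avg_cst T0 m).
    by apply: avg_le => s _; rewrite !andbF.
  case: (boolP (heavy [set x in q])) => hq /=.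
    rewrite mulr1 -pU; apply: ler_wpDr => //; apply: prob_le => s _.
    by case/andP => /andP [].
  rewrite mulr0 add0r; apply: ltW; move: hq; rewrite /heavy -ltNge; apply: le_lt_trans.
  apply: prob_le => s _; rewrite andbT => /andP [/andP [-> _]].
  by rewrite /edge set_cat => ->.
have h6 : c0 <= e0 * u ^+ m by apply: le_trans hc0 _; rewrite ler_wpM2l.
set P := prob _ _ in upX *.
have h7 : (1 / 2 - e0) * (1 - e0) * u ^+ m <= (P + e0) * u ^+ m by nra.
rewrite ler_pM2r // in h7; nra.
Qed.

(** Average [heavy_rows_lt] over all choices of m + 1 rows; choices with a
    repeated row contribute the second term. *)
Lemma heavy_count t : #|V| = (t * k)%N ->
  (m.+1 * #|V|)%:R * (prob m (fun q => all (mem V) q && heavy [set x in q]) * n%:R ^+ m) <=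
  t%:R ^+ m.+1 * ((m.+1 * (m * k ^ m))%:R - 1)
   + m.+1%:R ^+ 2 * t%:R ^+ m * (m.+1 * k ^ m.+1)%:R :> QQ.
Proof.
move=> Vt; have k0 : (0 < k)%N by lia.
have Mk e : e \in M -> #|e| = k by move=> eM; apply: uH; apply: (subsetP MH).
have [rho [rinj rsur rV rM]] := matching_rows k0 Mk tM MV Vt.
have aug := heavy_augment rinj rV rM.
case: (posnP t) => [t0|t0].
  have -> : #|V| = 0%N by rewrite Vt t0.
  rewrite muln0 mul0r t0 expr0n /= mul0r add0r; apply: mulr_ge0 => //.
  by apply: mulr_ge0; rewrite exprn_ge0.
have tT0 : (0 < #|'I_t|)%N by rewrite card_ord.
rewrite /prob avg_ffun // -natr_sum -natrM.
pose F (q : {ffun 'I_m -> T}) : nat := [forall i, q i \in V] && heavy [set q i | i : 'I_m].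
rewrite (eq_bigr F); last first.
  move=> q _; rewrite seq_ffun_set /F; congr (nat_of_bool (_ && _)).
  apply/allP/forallP => [h i|h x /mapP [i _ ->]]; last exact: h.
  by apply: h; apply: map_f; rewrite mem_enum.
have row_eq : (m.+1 * #|V| * \sum_q F q =
   \sum_(c < m.+1) \sum_(s : {ffun 'I_m.+1 -> T}) (s c \in V) * F [ffun i => s (lift c i)])%N.
  transitivity (\sum_(c < m.+1) #|V| * \sum_q F q)%N.
    by rewrite sum_nat_const card_ord mulnA.
  by apply: eq_bigr => c _; rewrite (sum_omit c V F).
rewrite row_eq.
pose B (c : 'I_m.+1) (r : {ffun 'I_m.+1 -> 'I_t}) (y : {ffun 'I_m.+1 -> 'I_k}) :=
  heavy (block (fun a p => rho (r a) p) c y).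
have le_c (c : 'I_m.+1) :
  (\sum_(s : {ffun 'I_m.+1 -> T}) (s c \in V) * F [ffun i => s (lift c i)] <=
   \sum_(r : {ffun 'I_m.+1 -> 'I_t}) \sum_(y : {ffun 'I_m.+1 -> 'I_k}) B c r y)%N.
  rewrite pair_bigA /=.
  pose f (p : {ffun 'I_m.+1 -> 'I_t} * {ffun 'I_m.+1 -> 'I_k}) :=
    [ffun a => rho (p.1 a) (p.2 a)].
  have -> : (\sum_(p : {ffun 'I_m.+1 -> 'I_t} * {ffun 'I_m.+1 -> 'I_k}) B c p.1 p.2)%N
    = #|[set p : {ffun 'I_m.+1 -> 'I_t} * {ffun 'I_m.+1 -> 'I_k} | B c p.1 p.2]|.
    by rewrite -sum1_card [RHS]big_mkcond; apply: eq_bigr => p _; rewrite inE; case: (B _ _ _).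
  apply: leq_trans (leq_imset_card f _).
  rewrite -sum1_card [X in (_ <= X)%N]big_mkcond; apply: leq_sum => s _.
  case: (boolP (s c \in V)) => sc //; rewrite mul1n /F.
  case: (boolP (_ && _)) => // /andP [/forallP sV hs].
  suff -> : s \in f @: [set p | B c p.1 p.2] by [].
  have sV' a : s a \in V.
    by case: (unliftP c a) => [i ->|-> //]; have := sV i; rewrite ffunE.
  have /fin_all_exists2 [g1 _ hg1] : forall a, exists2 i, true & exists p, s a = rho i p.
    by move=> a; have [i [p e]] := rsur _ (sV' a); exists i => //; exists p.
  have /fin_all_exists [g2 hg2] := hg1.
  apply/imsetP; exists (finfun g1, finfun g2); last first.
    by apply/ffunP => a; rewrite !ffunE /=.
  rewrite inE /B /=.
  suff -> : block (fun a p => rho ((finfun g1) a) p) c (finfun g2)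
     = [set [ffun i => s (lift c i)] i | i : 'I_m] by [].
  apply/setP => x; apply/imsetP/imsetP => [[a]|[i _ ->]].
    rewrite !inE => ac ->; case: (unliftP c a) => [i|] ea; last by rewrite ea eqxx in ac.
    by exists i => //; rewrite !ffunE hg2 ea.
  by exists (lift c i); rewrite ?inE ?ffunE ?hg2 // eq_sym neq_lift.
apply: (@le_trans _ _ (\sum_c \sum_(r : {ffun 'I_m.+1 -> 'I_t}) \sum_y B c r y)%N%:R).
  by rewrite ler_nat; apply: leq_sum => c _.
rewrite exchange_big /= natr_sum.
pose K := ((m.+1 * (m * k ^ m))%:R - 1 : QQ).
pose N (r : {ffun 'I_m.+1 -> 'I_t}) := ~~ injectiveb r.
apply: (@le_trans _ _ (\sum_(r : {ffun 'I_m.+1 -> 'I_t}) (K + (N r)%:R * (m.+1 * k ^ m.+1)%:R))).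
  apply: ler_sum => r _; rewrite /N; case: (boolP (injectiveb r)) => /= [/injectiveP ri|_].
    rewrite mul0r addr0 lerBrDr natr1 ler_nat.
    apply: (@heavy_rows_lt _ _ _ m2 km (fun a p => rho (r a) p)).
      by move=> a p a' p' /rinj [/ri -> ->].
    exact: aug.
  rewrite mul1r; apply: ler_wpDl.
    rewrite subr_ge0 (ler_nat _ 1) !muln_gt0 expn_gt0 k0 /=; lia.
  rewrite ler_nat -[X in (X * _)%N]card_ord -sum_nat_const; apply: leq_sum => c _.
  apply: leq_trans (_ : \sum_(y : {ffun 'I_m.+1 -> 'I_k}) 1 <= _)%N.
    by apply: leq_sum => y _; apply: leq_b1.
  by rewrite sum1_card card_ffun !card_ord.
rewrite big_split /= -mulr_suml sumr_const card_ffun !card_ord -[K *+ _]mulr_natl natrX.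
rewrite lerD2l ler_wpM2r // -natr_sum.
have := card_not_injective m tT0; rewrite card_ord; apply: le_trans.
rewrite ler_nat -sum1_card [X in (_ <= X)%N]big_mkcond leq_eqVlt; apply/orP; left.
by apply/eqP; apply: eq_bigr => r _; rewrite inE /N; case: injectiveb.
Qed.

End NearPerfect.

(** The gap 1 in [heavy_rows_lt] is a fixed proportion of all transversals, so the
    admissible deficiency e0 depends on k only and not on the proportion d of
    vertices left over. This is what allows the absorbing family to be removed first. *)
Theorem near_perfect k m : (1 < m)%N -> k = (2 * m)%N ->
  exists2 e0 : QQ, 0 < e0 & forall d : QQ, 0 < d -> exists n0,
  forall (T : finType) (H : {set {set T}}) (V : {set T}),
    (n0 <= #|T|)%N -> uniform k H -> (k %| #|V|)%N ->
    (forall s, uniq s -> size s = m -> {subset s <= V} ->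
     1 / 2 - e0 <= prob m (fun t => edge H (s ++ t) && all (mem V) t)) ->
  exists M : {set {set T}}, [/\ M \subset H, trivIset M, cover M \subset V &
     #|V :\: cover M|%:R <= d * #|T|%:R].
Proof.
move=> m2 km; have k0 : (0 < k)%N by lia.
have [K eK] : exists K, K = (m.+1 * k ^ m.+1)%N by exists (m.+1 * k ^ m.+1)%N.
have K0 : (0 < K)%N by rewrite eK muln_gt0 expn_gt0 k0.
have K0' : 0 < K%:R :> QQ by rewrite ltr0n.
(* The gap is 1/K of all transversals. A third of it pays for the deficiency 3 * e0 of
   the density of heavy sets, a third for choices with a repeated row. *)
have [e0 e00 e0K] : exists2 e0 : QQ, 0 < e0 & e0 * K%:R = 1 / 9.
  exists (1 / (9 * K%:R)); first by apply: divr_gt0 => //; apply: mulr_gt0.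
  by field; rewrite gt_eqF.
have e01 : e0 <= 1 / 2.
  have K1 : 1 <= K%:R :> QQ by rewrite (ler_nat _ 1).
  by rewrite -(ler_pM2r K0') e0K; lra.
exists e0 => // d d0.
have [c0 ec0] : exists c0, c0 = e0 * d ^+ m by exists (e0 * d ^+ m).
have c00 : 0 < c0 by rewrite ec0; apply: mulr_gt0 => //; apply: exprn_gt0.
have c02 : 0 < c0 / 2 by rewrite divr_gt0.
have [n1 hn1] := div_nat_le (m * (m.+1 * k + m * m.+2))%:R c02.
have [n2 hn2] := div_nat_le (m%:R ^+ 2) c00.
have td : 0 < 1 / 3 * (d / k%:R).
  by apply: mulr_gt0; [lra|apply: divr_gt0; rewrite ?ltr0n].
have [n3 hn3] := div_nat_le (m.+1%:R ^+ 2 * K%:R) td.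
exists (maxn 1 (maxn n1 (maxn n2 n3))) => T H V.
rewrite !geq_max => /and4P [T0 h1 h2 h3] uH kV hdeg.
have n0 := cardT_gt0 T0.
have [M [MH tM MV Mmax]] := max_matching H V.
exists M; split => //; rewrite leNgt; apply/negP => hU.
have hc0 : (m * (m.+1 * k + m * m.+2))%:R / #|T|%:R < c0.
  by apply: le_lt_trans (hn1 _ h1) _; rewrite ltr_pdivrMr // ltr_pMr // (ltr_nat _ 1 2).
have hc0' : c0 <= e0 * d ^+ m by rewrite ec0.
have hn2' := hn2 _ h2; rewrite {1}ec0 in hn2'.
have := heavy_prob T0 hc0 d0 (ltW e00) e01 hc0' hn2' (ltW hU) hdeg.
set t := (#|V| %/ k)%N; have Vt : #|V| = (t * k)%N by rewrite divnK.
have := heavy_count T0 m2 km uH kV MH tM MV Mmax hc0 Vt.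
set P := prob _ _ => le1 le2.
have dV : d * #|T|%:R <= (t * k)%:R.
  by rewrite -Vt; apply: le_trans (ltW hU) _; rewrite ler_nat subset_leq_card // subsetDl.
have t0 : (0 < t)%N.
  case: (posnP t) => // e; move: dV; rewrite e mul0n.
  by rewrite leNgt mulr_gt0.
have t0' : 0 < t%:R :> QQ by rewrite ltr0n.
have h4 : m.+1%:R ^+ 2 * K%:R <= 1 / 3 * t%:R :> QQ.
  have h := hn3 _ h3; rewrite ler_pdivrMr // in h; apply: le_trans h _.
  have : d / k%:R * #|T|%:R <= t%:R by rewrite mulrAC ler_pdivrMr ?ltr0n // -natrM.
  lra.
have tkn : (t * k)%:R <= #|T|%:R :> QQ by rewrite -Vt ler_nat max_card.
have le3 : t%:R ^+ m.+1 * K%:R * (1 / 2 - 3 * e0) <=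
   (m.+1 * #|V|)%:R * (P * #|T|%:R ^+ m).
  have -> : t%:R ^+ m.+1 * K%:R * (1 / 2 - 3 * e0)
     = (m.+1 * #|V|)%:R * ((1 / 2 - 3 * e0) * (t * k)%:R ^+ m).
    rewrite Vt eK !natrM natrX !exprS exprMn; ring.
  have h5 : 0 <= 1 / 2 - 3 * e0.
    have K1 : 1 <= K%:R :> QQ by rewrite (ler_nat _ 1).
    have : e0 <= 1 / 9 by rewrite -e0K; apply: ler_peMr => //; exact: ltW.
    lra.
  rewrite ler_wpM2l // ler_pM ?exprn_ge0 //.
  by apply: lerXn2r; rewrite ?nnegrE.
have E2 : (m.+1 * (m * k ^ m))%:R = K%:R / 2 :> QQ.
  by rewrite eK expnS {2}km !natrM; field.
have := le_trans le3 le1; rewrite E2.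
have -> : m.+1%:R ^+ 2 * t%:R ^+ m * (m.+1 * k ^ m.+1)%:R = t%:R ^+ m * (m.+1%:R ^+ 2 * K%:R) :> QQ.
  by rewrite eK; ring.
rewrite [t%:R ^+ m.+1]exprS => le4.
have tm0 : 0 < t%:R ^+ m :> QQ by rewrite exprn_gt0.
have : t%:R ^+ m * (t%:R * K%:R * (1 / 2 - 3 * e0)) <=
       t%:R ^+ m * (t%:R * (K%:R / 2 - 1) + m.+1%:R ^+ 2 * K%:R) :> QQ.
  by move: le4; congr (_ <= _); ring.
rewrite ler_pM2l // => le5.
have E3 : t%:R * K%:R * (1 / 2 - 3 * e0) = t%:R * (K%:R / 2 - 3 * (e0 * K%:R)) by ring.
rewrite E3 e0K in le5.
suff : t%:R <= 0 :> QQ by rewrite leNgt t0'.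
lra.
Qed.

(** * Absorption *)

Section Absorbers.
Variables (T : finType) (k : nat) (H : {set {set T}}).
Hypotheses (T0 : (0 < #|T|)%N) (k0 : (0 < k)%N) (uH : uniform k H).
Implicit Types (x y z : T) (s t q : seq T) (A B Q Z : {set T}).

Definition matchb A :=
  [exists M : {set {set T}}, [&& M \subset H, trivIset M & cover M == A]].

Lemma matchP A : reflect (matchable H A) (matchb A).
Proof.
apply: (iffP existsP) => -[M]; first by case/and3P=> ? ? /eqP; exists M.
by case=> h1 h2 h3; exists M; rewrite h1 h2 h3 eqxx.
Qed.

Lemma matchable_perm s t :
  perm_eq s t -> matchable H [set x in s] -> matchable H [set x in t].
Proof.
move=> /perm_mem h; suff -> : [set x in s] = [set x in t] by [].
by apply/setP => x; rewrite !inE h.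
Qed.

Lemma matchable_cat s t : uniq (s ++ t) ->
  matchable H [set x in s] -> matchable H [set x in t] -> matchable H [set x in s ++ t].
Proof.
rewrite cat_uniq => /and3P [_ /hasPn h _]; rewrite set_cat; apply: matchableU.
rewrite disjoint_sym disjoint_subset; apply/subsetP => x; rewrite !inE; exact: h.
Qed.

Definition width := (k.-1 + k)%N.

(** The sequence s = s1 ++ z :: s2 exchanges x and y. For x there are the edges
    x + s1 and z + s2. For y there are either z + s1 and y + s2, where z is
    intermediate between x and y, or y + s1 and z + s2, where s1 is in both links.
    Having one length for both situations gives absorbers of a constant size. *)
Definition connects x y s :=
  [&& edge H (x :: take k.-1 s), edge H (drop k.-1 s) &
    (edge H (take k s) && edge H (y :: drop k s)) || edge H (y :: take k.-1 s)].

Lemma conn_matchl x y s : connects x y s -> uniq (x :: s) -> matchable H [set z in x :: s].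
Proof.
move=> /and3P [h1 h2 _]; rewrite -[s](cat_take_drop k.-1) -cat_cons => u.
by apply: matchable_cat => //; apply: matchable_edge.
Qed.

Lemma conn_matchr x y s : connects x y s -> uniq (y :: s) -> matchable H [set z in y :: s].
Proof.
move=> /and3P [_ h2 /orP [/andP [h3 h4]|h3]].
  have pe : perm_eq (take k s ++ y :: drop k s) (y :: s).
    by rewrite -cat1s perm_catCA /= perm_cons cat_take_drop.
  move=> u; apply: (matchable_perm pe); apply: matchable_cat.
  - by rewrite (perm_uniq pe).
  - exact: matchable_edge.
  - exact: matchable_edge.
rewrite -[s](cat_take_drop k.-1) -cat_cons => u.
by apply: matchable_cat => //; apply: matchable_edge.
Qed.

(** The sequence s is cut into consecutive pieces, the i-th of which exchanges the
    i-th entries of qs and ys. *)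
Fixpoint allconn qs ys s :=
  match qs, ys with
  | x :: qs', y :: ys' => connects x y (take width s) && allconn qs' ys' (drop width s)
  | _, _ => true
  end.

Lemma allconn_match qs ys s : size qs = size ys -> size s = (size qs * width)%N ->
  allconn qs ys s ->
  (uniq (qs ++ s) -> matchable H [set x in qs ++ s]) /\
  (uniq (ys ++ s) -> matchable H [set x in ys ++ s]).
Proof.
elim: qs ys s => [|x qs IH] [|y ys] //= s.
  rewrite mul0n => _ /size0nil -> _.
  by have := matchable0 H; rewrite set_nil.
move=> [hsz] hs /andP [hc /IH]; rewrite size_drop hs mulSn addKn => /(_ hsz erefl) [h1 h2].
have pe z qs' : perm_eq ((z :: take width s) ++ (qs' ++ drop width s)) (z :: qs' ++ s).
  by rewrite /= perm_cons perm_catCA cat_take_drop.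
split=> u; apply: (matchable_perm (pe _ _)).
  have u' : uniq ((x :: take width s) ++ (qs ++ drop width s)) by rewrite (perm_uniq (pe _ _)).
  apply: matchable_cat => //; move: u'; rewrite cat_uniq => /and3P [u1 _ u2].
    exact: conn_matchl hc u1.
  exact: h1.
have u' : uniq ((y :: take width s) ++ (ys ++ drop width s)) by rewrite (perm_uniq (pe _ _)).
apply: matchable_cat => //; move: u'; rewrite cat_uniq => /and3P [u1 _ u2].
  exact: conn_matchr hc u1.
exact: h2.
Qed.

Lemma prob_allconn c qs ys : 0 <= c -> (forall x y, c <= prob width (connects x y)) ->
  size qs = size ys -> c ^+ size qs <= prob (size qs * width) (allconn qs ys).
Proof.
move=> c0 hc; elim: qs ys => [|x qs IH] [|y ys] //= [hsz].
rewrite exprS mulSn /prob avg_cat.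
apply: (@le_trans _ _ (c ^+ size qs * prob width (connects x y))).
  by rewrite mulrC ler_wpM2l // exprn_ge0.
rewrite -avgZ; apply: avg_le => s hs; case hcs: (connects x y s); last first.
  by rewrite mulr0; apply: avg_ge0.
rewrite mulr1; apply: le_trans (IH _ hsz) _; apply: prob_le => t _ ht.
by rewrite take_size_cat // drop_size_cat // hcs.
Qed.

Definition absorbs Q A := [&& [disjoint A & Q], matchb A & matchb (A :|: Q)].

Definition absorber_size := (k + k * width)%N.

(** An edge y_1 ... y_k together with sequences that exchange the i-th vertex of Q
    with y_i absorbs Q: match each piece with y_i if Q is absent, and with the
    vertex of Q otherwise, which leaves the edge free. *)
Lemma absorber_prob c e Q Z : 0 <= c -> 0 <= e -> (forall x y, c <= prob width (connects x y)) ->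
  e <= prob k (edge H) -> #|Q| = k ->
  e * c ^+ k - (absorber_size * (#|Z :|: Q| + absorber_size))%:R / #|T|%:R <=
  prob absorber_size (fun s => absorbs Q [set x in s] && [disjoint [set x in s] & Z]).
Proof.
move=> c0 e0 hc he cQ.
pose bad := fun s => has (mem (Z :|: Q)) s || ~~ uniq s.
pose good := fun s => edge H (take k s) && allconn (enum Q) (take k s) (drop k s).
have h1 : e * c ^+ k <= prob absorber_size good.
  rewrite /prob avg_cat; apply: (@le_trans _ _ (c ^+ k * prob k (edge H))).
    by rewrite mulrC ler_wpM2l // exprn_ge0.
  rewrite -avgZ; apply: avg_le => s hs; case hes: (edge H s); last first.
    by rewrite mulr0; apply: avg_ge0.
  rewrite mulr1; have := @prob_allconn c (enum Q) s c0 hc; rewrite -cardE cQ => /(_ (esym hs)).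
  move=> /le_trans; apply; apply: prob_le => t _ ht.
  by rewrite /good take_size_cat // drop_size_cat // hes.
have h2 : prob absorber_size bad <= (absorber_size * (#|Z :|: Q| + absorber_size))%:R / #|T|%:R.
  apply: le_trans (prob_or _ _ _) _; apply: le_trans (lerD (prob_hit T0 _ _) (prob_not_uniq T0 _)) _.
  by rewrite natrM natrD mulrDr mulrDl -expr2 mulrA.
have h3 := prob_split absorber_size good bad.
have h4 : prob absorber_size (fun s => good s && bad s) <= prob absorber_size bad by apply: prob_le => s _ /andP [].
suff : prob absorber_size (fun s => good s && ~~ bad s) <=
  prob absorber_size (fun s => absorbs Q [set x in s] && [disjoint [set x in s] & Z]) by lra.
apply: prob_le => s hs /andP [/andP [g1 g2]]; rewrite negb_or negbK => /andP [/hasPn hZ us].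
have dis A : A \subset Z :|: Q -> [disjoint [set x in s] & A].
  move=> sA; rewrite disjoint_subset; apply/subsetP => x; rewrite !inE => /hZ.
  by apply: contra => /(subsetP sA).
rewrite (dis Z) ?subsetUl // /absorbs dis ?subsetUr //= andbT.
have sz1 : size (enum Q) = size (take k s) by rewrite -cardE cQ size_takel // hs leq_addr.
have sz2 : size (drop k s) = (size (enum Q) * width)%N by rewrite size_drop hs addKn -cardE cQ.
have [a1 a2] := allconn_match sz1 sz2 g2.
have uQ : uniq (enum Q ++ s).
  rewrite cat_uniq enum_uniq us andbT /=; apply/hasPn => x /hZ.
  by rewrite /= mem_enum !inE negb_or => /andP [].
have pe : perm_eq (take k s ++ (enum Q ++ drop k s)) (enum Q ++ s).
  by rewrite perm_catCA cat_take_drop.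
apply/andP; split; apply/matchP.
  by rewrite -[s](cat_take_drop k); apply: a2; rewrite cat_take_drop.
have -> : [set x in s] :|: Q = [set x in enum Q ++ s].
  by rewrite set_cat setUC; congr (_ :|: _); apply/setP => x; rewrite inE mem_enum.
apply: (matchable_perm pe).
have u' : uniq (take k s ++ (enum Q ++ drop k s)) by rewrite (perm_uniq pe).
apply: matchable_cat => //; first exact: matchable_edge.
by apply: a1; move: u'; rewrite cat_uniq => /and3P [].
Qed.

Lemma bigcup_seq_sup (ts : seq {set T}) A : A \in ts -> A \subset \bigcup_(B <- ts) B.
Proof.
elim: ts => [//|B ts IH]; rewrite inE big_cons => /orP [/eqP ->|/IH h].
  exact: subsetUl.
exact: subset_trans h (subsetUr _ _).
Qed.

Lemma card_bigcup_seq N (ts : seq {set T}) : (forall A, A \in ts -> #|A| <= N)%N ->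
  (#|\bigcup_(B <- ts) B| <= N * size ts)%N.
Proof.
elim: ts => [|B ts IH] h; first by rewrite big_nil cards0.
rewrite big_cons mulnS; apply: leq_trans (leq_card_setU _ _).1 _.
apply: leq_add; first by apply: h; rewrite mem_head.
by apply: IH => A hA; apply: h; rewrite inE hA orbT.
Qed.

(** The method of conditional expectations. The weight of Q is halved each time
    an absorber of Q is selected. On average over the next selection the total weight
    drops by the factor 1 - b/2, so some selection does at least as well. A small
    total weight in the end means that every Q has been hit often. *)
Lemma absorbing_family b tau : (k <= #|T|)%N -> 0 < b -> b <= 1 ->
  (forall Q Z, #|Q| = k -> (#|Z| <= absorber_size * tau)%N ->
    b <= prob absorber_size (fun s => absorbs Q [set x in s] && [disjoint [set x in s] & Z])) ->
  exists ts : seq {set T},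
  [/\ uniq ts, size ts = tau,
      forall A, A \in ts -> matchb A /\ (#|A| <= absorber_size)%N,
      forall A B, A \in ts -> B \in ts -> A != B -> [disjoint A & B] &
      \sum_(Q : {set T} | #|Q| == k) (2^-1) ^+ count (absorbs Q) ts <=
        'C(#|T|, k)%:R * (1 - b / 2) ^+ tau :> QQ].
Proof.
move=> kT b0 b1; elim: tau => [|tau IH] hb.
  exists [::]; split=> //; rewrite expr0 mulr1 /= sumr_const.
  by rewrite -card_draws cardsE.
have [|ts [uts sts mts dts wts]] := IH; first by move=> Q Z hQ hZ; apply: hb => //; apply: leq_trans hZ _; rewrite leq_mul2l leqnSn orbT.
pose Z := \bigcup_(B <- ts) B.
have hZ : (#|Z| <= absorber_size * tau.+1)%N.
  apply: leq_trans (_ : absorber_size * tau <= _)%N; last by rewrite leq_mul2l leqnSn orbT.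
  by rewrite -sts; apply: card_bigcup_seq => A /mts [].
pose w Q : QQ := (2^-1) ^+ count (absorbs Q) ts.
have w0 Q : 0 < w Q by rewrite exprn_gt0 ?invr_gt0.
pose ok s Q := absorbs Q [set x in s] && [disjoint [set x in s] & Z].
pose S : QQ := \sum_(Q : {set T} | #|Q| == k) w Q.
have S0 : 0 < S.
  have [Q hQ] : exists Q : {set T}, Q \in [set A : {set T} | #|A| == k].
    by apply/card_gt0P; rewrite card_draws bin_gt0.
  rewrite inE in hQ; rewrite /S (bigD1 Q) //=; apply: ltr_wpDr => //.
  by apply: sumr_ge0 => R _; apply: ltW.
have [s ss hs] : exists2 s, size s = absorber_size &
    \sum_(Q : {set T} | #|Q| == k) w Q * (1 - (ok s Q)%:R / 2) <= S * (1 - b / 2).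
  apply: (avg_exists_le T0); rewrite avg_sum /S mulr_suml; apply: ler_sum => Q /eqP cQ.
  rewrite avgZ; apply: ler_wpM2l; first exact: ltW.
  rewrite avgB avg_cst // avg_div.
  have hQ : b <= avg absorber_size (fun s => (ok s Q)%:R) := hb Q Z cQ hZ.
  lra.
have [Q0 /andP [/eqP cQ0 okQ]] : exists Q0 : {set T}, (#|Q0| == k) && ok s Q0.
  apply/existsP; apply: contraTT hs; rewrite negb_exists => /forallP hn.
  have [Q1 hQ1] : exists Q : {set T}, Q \in [set A : {set T} | #|A| == k].
    by apply/card_gt0P; rewrite card_draws bin_gt0.
  rewrite inE in hQ1.
  rewrite (eq_bigr w) => [|Q hQ]; last first.
    by have := hn Q; rewrite hQ /= => /negPf ->; rewrite mul0r subr0 mulr1.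
  by rewrite -ltNge -/S; nra.
pose A := [set x in s].
have /andP [abA dA] := okQ.
have As : A \notin ts.
  apply/negP => hA.
  have [x xs] : exists x, x \in s.
    case: (s) ss => [|x s' _]; last by exists x; rewrite mem_head.
    by move/eqP; rewrite eq_sym addn_eq0 eqn0Ngt k0.
  have xA : x \in A by rewrite inE.
  move/pred0P/(_ x): dA; rewrite /= xA.
  by rewrite (subsetP (bigcup_seq_sup hA)).
exists (A :: ts); split.
- by rewrite /= As.
- by rewrite /= sts.
- move=> B; rewrite inE => /orP [/eqP ->|/mts //]; split; last by rewrite -ss card_seq_set.
  by case/and3P: abA.
- have dis B : B \in ts -> [disjoint A & B].
    by move=> hB; apply: disjointWr dA; apply: bigcup_seq_sup.
  move=> B C; rewrite !inE => /orP [/eqP ->|hB] /orP [/eqP ->|hC].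
  + by rewrite eqxx.
  + by move=> _; apply: dis.
  + by move=> _; rewrite disjoint_sym; apply: dis.
  + exact: dts.
- rewrite exprSr mulrA; apply: (@le_trans _ _ (S * (1 - b / 2))).
    apply: le_trans hs; apply: ler_sum => Q _ /=; rewrite /w exprD mulrC.
    apply: ler_wpM2l; first exact: ltW (w0 Q).
    rewrite /ok dA andbT -/A.
    by case: (absorbs Q A) => /=; rewrite ?expr1 ?expr0; lra.
  by rewrite ler_wpM2r //; lra.
Qed.
End Absorbers.

Section Absorb.
Variables (T : finType) (k : nat) (H : {set {set T}}).
Hypotheses (k0 : (0 < k)%N).

(** Cut U into l sets of size k and let each use up an absorber of its own. *)
Lemma absorb_leftover l (U : {set T}) (ts : seq {set T}) :
  uniq ts -> (forall A, A \in ts -> matchb H A) ->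
  (forall A B, A \in ts -> B \in ts -> A != B -> [disjoint A & B]) ->
  (forall A, A \in ts -> [disjoint A & U]) ->
  #|U| = (l * k)%N ->
  (forall Q : {set T}, #|Q| = k -> (l <= count (absorbs H Q) ts)%N) ->
  matchable H (U :|: \bigcup_(A <- ts) A).
Proof.
elim: l U ts => [|l IH] U ts uts mts dts dU cU hQ.
  have -> : U = set0 by apply/eqP; rewrite -cards_eq0 cU.
  rewrite set0U {hQ dU}; elim: ts uts mts dts => [|A ts IHt] /=; first by rewrite big_nil => *; exact: matchable0.
  move=> /andP [nA uts] mts dts; rewrite big_cons; apply: matchableU.
  - have : {in ts, forall B : {set T}, [disjoint A & B]}.
      move=> B hB; apply: dts; rewrite ?mem_head ?inE ?hB ?orbT //.
      by apply: contraNneq nA => ->.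
    elim: ts {IHt nA uts mts dts} => [|B ts IHt] h; first by rewrite big_nil -setI_eq0 setI0.
    rewrite big_cons disjoint_sym; apply: disjointsU; rewrite disjoint_sym.
      by apply: h; rewrite mem_head.
    by apply: IHt => C hC; apply: h; rewrite inE hC orbT.
  - by apply/matchP; apply: mts; rewrite mem_head.
  - apply: IHt => // [B hB|B C hB hC]; first by apply: mts; rewrite inE hB orbT.
    by apply: dts; rewrite inE ?hB ?hC orbT.
have [Q QU cQ] : exists2 Q : {set T}, Q \subset U & #|Q| = k.
  have [Q] : exists Q : {set T}, Q \in [set A : {set T} | A \subset U & #|A| == k].
    by apply/card_gt0P; rewrite cards_draws bin_gt0 cU mulSn leq_addr.
  by rewrite inE => /andP [h /eqP]; exists Q.
have /hasP [A hA aQA] : has (absorbs H Q) ts by rewrite has_count; apply: leq_trans (hQ _ cQ).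
have pt := perm_to_rem hA.
have sub B : B \in rem A ts -> B \in ts by apply: mem_rem.
have nAr : A \notin rem A ts by rewrite mem_rem_uniqF.
have dAr B : B \in rem A ts -> [disjoint A & B].
  move=> hB; apply: dts => //; first exact: sub.
  by apply/eqP => e; move: nAr; rewrite {1}e hB.
have -> : U :|: \bigcup_(B <- ts) B = (A :|: Q) :|: ((U :\: Q) :|: \bigcup_(B <- rem A ts) B).
  rewrite (perm_big _ pt) big_cons /= -[in LHS](setID U Q) (setIidPr QU).
  by rewrite setUCA -!setUA.
apply: matchableU.
- have dbig (B : {set T}) : [disjoint B & U :\: Q] -> (forall C, C \in rem A ts -> [disjoint B & C]) ->
    [disjoint B & (U :\: Q) :|: \bigcup_(C <- rem A ts) C].
    move=> h1 h2; rewrite disjoint_sym; apply: disjointsU; first by rewrite disjoint_sym.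
    rewrite big_seq; elim/big_rec: _ => [|C D hC hD]; first by rewrite -setI_eq0 set0I.
    by apply: disjointsU; rewrite // disjoint_sym h2.
  apply: disjointsU; apply: dbig => //.
  + by apply: disjointWr (dU _ hA); exact: subsetDl.
  + by rewrite disjoint_sym -setI_eq0 setDE -setIA [~: Q :&: Q]setIC setICr setI0.
  + by move=> C hC; rewrite disjoint_sym; apply: disjointWr QU _; apply: dU; exact: sub.
- by apply/matchP; case/and3P: aQA.
- apply: IH.
  + exact: rem_uniq.
  + by move=> B /sub; apply: mts.
  + by move=> B C /sub hB /sub; apply: dts.
  + by move=> B /sub /dU; apply: disjointWr; exact: subsetDl.
  + by rewrite cardsD (setIidPr QU) cU cQ mulSn addKn.
  + move=> R cR; have := hQ _ cR; rewrite (seq.permP pt) /= => h.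
    by rewrite -ltnS; apply: leq_trans h _; case: (absorbs H R A).
Qed.

End Absorb.

Lemma exp_dominates k q : exists a0, forall a, (a0 <= a)%N -> ((q * a.+1) ^ k <= 2 ^ a)%N.
Proof.
case: (posnP k) => [->|k0]; first by exists 0%N => a _; rewrite expn0 expn_gt0.
exists (2 * k * (2 * k * q))%N => a ha.
set b := (a %/ (2 * k))%N; have k2 : (0 < 2 * k)%N by rewrite muln_gt0.
have hb : (2 * k * q <= b)%N by rewrite leq_divRL // mulnC.
have hab : (a.+1 <= 2 * k * b.+1)%N by rewrite mulnC; apply: ltn_ceil.
have hba : (2 * k * b <= a)%N by rewrite mulnC; apply: leq_trunc_div.
apply: leq_trans (leq_pexp2l _ hba) => //.
have -> : (2 * k * b = (b + b) * k)%N by lia.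
rewrite expnM leq_exp2r //.
apply: (@leq_trans (2 ^ b * b.+1)%N).
  apply: leq_trans (leq_mul (leqnn q) hab) _; rewrite mulnA leq_mul2r; apply/orP; right.
  by rewrite mulnC; apply: leq_trans hb _; apply: ltnW; apply: ltn_expl.
by rewrite expnD leq_mul2l; apply/orP; right; apply: ltn_expl.
Qed.

(** Bernoulli's inequality. *)
Lemma power_le_quarter (x : QQ) : 0 < x -> x <= 1 -> exists D, (0 < D)%N /\ (1 - x) ^+ D <= 1 / 4.
Proof.
move=> x0 x1; have h3 : 0 <= 3 / x by rewrite divr_ge0 // ltW.
have := archi_boundP h3; set D := Num.bound _ => hD.
exists D.+1; split=> //.
have D3 : 3 <= D.+1%:R * x.
  by rewrite -ler_pdivrMr // (le_trans (ltW hD)) // ler_nat.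
have bern : forall j, 1 + j%:R * x <= (1 + x) ^+ j.
  elim=> [|j IH]; first by rewrite mul0r addr0 expr0.
  rewrite exprS -natr1; have : 0 <= j%:R * x * x by rewrite !mulr_ge0 // ltW.
  have : (1 + x) * (1 + j%:R * x) <= (1 + x) * (1 + x) ^+ j.
    by rewrite ler_wpM2l //; lra.
  lra.
have := bern D.+1; set y := (1 + x) ^+ _ => hy.
have y4 : 4 <= y by lra.
have : ((1 - x) * (1 + x)) ^+ D.+1 <= 1.
  by apply: exprn_ile1; nra.
rewrite exprMn -/y => h.
have y0 : 0 < y by lra.
rewrite -(ler_pM2r y0); lra.
Qed.

(** Order of the constants: c fixes the density b of absorbers, then D and q are
    chosen so that D * (n / q) absorbers occupy few vertices compared with b and e1,
    while every k-set is absorbed at least n / q times. Finally the almost perfect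
    matching leaves at most n / (2q) vertices. *)
Theorem absorbing_matching k m : (1 < m)%N -> k = (2 * m)%N ->
  exists2 e1 : QQ, 0 < e1 & forall c : QQ, 0 < c -> exists n0,
  forall (T : finType) (H : {set {set T}}),
    (n0 <= #|T|)%N -> uniform k H -> (k %| #|T|)%N ->
    (forall s, uniq s -> size s = m ->
       1 / 2 - e1 <= prob m (fun t => edge H (s ++ t))) ->
    (forall x y, c <= prob (width k) (connects k H x y)) ->
  matchable H [set: T].
Proof.
move=> m2 km; have k0 : (0 < k)%N by lia.
have [e0 e00 near] := near_perfect m2 km.
have [e1 [e10 e1e0 e18]] : exists e1 : QQ, [/\ 0 < e1, 2 * e1 <= e0 & e1 <= 1 / 8].
  case: (lerP e0 (1 / 4)) => h; first by exists (e0 / 2); split; lra.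
  by exists (1 / 8); split; lra.
exists e1 => // c c0.
set N := absorber_size k.
have N0 : (0 < N)%N by rewrite /N /absorber_size; lia.
(* half of the density 1/4 * c' ^ k of absorbers; the other half is lost to the
   vertices in use and to repetitions *)
have [b bc b0] : exists2 b : QQ, b = 1 / 8 * Num.min c 1 ^+ k & 0 < b.
  exists (1 / 8 * Num.min c 1 ^+ k) => //; apply: mulr_gt0; first lra.
  by apply: exprn_gt0; rewrite lt_min c0 ltr01.
set c' := Num.min c 1 in bc.
have c'0 : 0 < c' by rewrite lt_min c0 ltr01.
have c'1 : c' <= 1 by rewrite ge_min lexx orbT.
have b1 : b <= 1.
  have : c' ^+ k <= 1 by apply: exprn_ile1 => //; exact: ltW.
  lra.
have [D [D0 hD]] : exists D, (0 < D)%N /\ (1 - b / 2) ^+ D <= 1 / 4 by apply: power_le_quarter; lra.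
have [q [q0 hq1 hq2]] : exists q, [/\ (0 < q)%N,
    (N * N * D)%:R / q%:R <= b / 2 & (m * N * D)%:R / q%:R <= e1].
  have b20 : 0 < b / 2 by lra.
  have [q1 hq1] := div_nat_le (N * N * D)%:R b20; have [q2 hq2] := div_nat_le (m * N * D)%:R e10.
  by exists (maxn 1 (maxn q1 q2)); split; [|apply: hq1|apply: hq2]; rewrite ?leq_max ?leqnn ?orbT.
have q0' : 0 < q%:R :> QQ by rewrite ltr0n.
have d0 : 0 < 1 / (2 * q%:R) :> QQ by apply: divr_gt0 => //; apply: mulr_gt0.
have [n1 hn1] := near _ d0.
have [a0 ha0] := exp_dominates k q.
have b20 : 0 < b / 2 by lra.
have [n2 hn2] := div_nat_le (N * (k + N))%:R b20.
have [n3 hn3] := div_nat_le (m%:R ^+ 2) e10.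
exists (maxn k (maxn n1 (maxn n2 (maxn n3 (maxn (2 * q) (q * a0)))))) => T H.
rewrite !geq_max => /and5P [kT h1 h2 h3 /andP [h4 h5]] uH kn hdeg hconn.
have T0 : (0 < #|T|)%N by apply: leq_trans kT.
have n0 := cardT_gt0 T0.
pose a := (#|T| %/ q)%N.
have a_a0 : (a0 <= a)%N by rewrite /a leq_divRL // mulnC.
have an : (a * q <= #|T|)%N by apply: leq_trunc_div.
have na : (#|T| < q * a.+1)%N by rewrite mulnC; apply: ltn_ceil.
have nka : (#|T| ^ k <= 2 ^ a)%N.
  by apply: leq_trans (ha0 _ a_a0); rewrite leq_exp2r // ltnW.
have a2 : #|T|%:R / (2 * q%:R) <= a%:R :> QQ.
  rewrite ler_pdivrMr; last by apply: mulr_gt0.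
  have a_gt0 : (0 < a)%N by rewrite divn_gt0 // (leq_trans _ h4) // leq_pmull.
  rewrite -!natrM ler_nat; apply: leq_trans (ltnW na) _.
  by have -> : (a * (2 * q) = q * (a + a))%N; [ring|rewrite leq_mul2l -addn1 leq_add2l a_gt0 orbT].
have eprob : 1 / 4 <= prob k (edge H).
  rewrite (_ : k = (m + m)%N); last by rewrite km mul2n addnn.
  rewrite /prob avg_cat.
  apply: (@le_trans _ _ (avg m (fun s : seq T => (1 / 2 - e1) - (~~ uniq s)%:R))).
    rewrite avgB (avg_cst T0); have := prob_not_uniq T0 m; have := hn3 _ h3.
    rewrite /prob; lra.
  apply: avg_le => s ss; case: (boolP (uniq s)) => us /=; last first.
    by apply: le_trans (avg_ge0 _) => //; lra.
  by rewrite subr0; apply: hdeg.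
have hconn' x y : c' <= prob (width k) (connects k H x y).
  by apply: le_trans (hconn x y); rewrite ge_min lexx.
have [|||ts [uts sts mts dts wts]] := @absorbing_family T k H T0 k0 b (D * a) kT.
- exact: b0.
- exact: b1.
- move=> Q Z cQ cZ.
  have q40 : 0 <= 1 / 4 :> QQ by lra.
  have le1 := @absorber_prob T k H T0 c' (1 / 4) Q Z (ltW c'0) q40 hconn' eprob cQ.
  apply: le_trans le1; rewrite -/N in cZ *.
  have le2 : (N * (#|Z :|: Q| + N))%:R / #|T|%:R <= (N * N * D)%:R / q%:R + (N * (k + N))%:R / #|T|%:R :> QQ.
    apply: (@le_trans _ _ ((N * (N * (D * a)) + N * (k + N))%:R / #|T|%:R)).
      rewrite ler_wpM2r ?invr_ge0 ?ler0n // ler_nat -mulnDr leq_mul2l; apply/orP; right.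
      rewrite addnA leq_add2r; apply: leq_trans (leq_card_setU _ _).1 _.
      by rewrite cQ leq_add2r.
    rewrite natrD mulrDl lerD2r ler_pdivrMr // mulrAC ler_pdivlMr //.
    rewrite -!natrM ler_nat.
    by have -> : (N * (N * (D * a)) * q = N * N * D * (a * q))%N; [ring|rewrite leq_mul2l an orbT].
  have le3 := hn2 _ h2.
  move: le2 le3 hq1 bc; clear; lra.
pose W := \bigcup_(A <- ts) A.
have cW : (#|W| <= N * (D * a))%N by rewrite -sts; apply: card_bigcup_seq => A /mts [].
(* fewer than a hits would leave Q alone with weight above 2 ^ - a, but the total
   weight is at most n ^ k * 4 ^ - a, where n ^ k <= 2 ^ a *)
have hits (Q : {set T}) : #|Q| = k -> (a <= count (absorbs H Q) ts)%N.
  move=> cQ; rewrite leqNgt; apply/negP => lt.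
  have le1 : (2^-1 : QQ) ^+ count (absorbs H Q) ts <= 'C(#|T|, k)%:R * (1 - b / 2) ^+ (D * a).
    apply: le_trans wts; rewrite (bigD1 Q) /=; last by apply/eqP.
    by apply: ler_wpDr => //; apply: sumr_ge0 => R _; apply: exprn_ge0; rewrite invr_ge0.
  have le2 : (1 - b / 2) ^+ (D * a) <= (1 / 4) ^+ a.
    rewrite exprM; apply: lerXn2r; rewrite ?nnegrE; last exact: hD.
      by apply: exprn_ge0; move: b1; clear; lra.
    by clear; lra.
  have le3 : 'C(#|T|, k)%:R <= 2 ^+ a :> QQ.
    rewrite -natrX ler_nat; apply: leq_trans nka.
    rewrite -(leq_pmul2r (fact_gt0 k)) bin_ffact.
    apply: (@leq_trans (#|T| ^ k)%N); last by rewrite leq_pmulr // fact_gt0.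
    by rewrite -(card_ord k) -{1 2}(card_ord #|T|) -card_inj_ffuns -card_ffun max_card.
  have le4 : (2^-1 : QQ) ^+ count (absorbs H Q) ts <= 2^-1 ^+ a.
    apply: le_trans le1 _; apply: (@le_trans _ _ (2 ^+ a * (1 / 4) ^+ a)).
      apply: ler_pM le3 le2 => //.
      by apply: exprn_ge0; move: b1; clear; lra.
    by rewrite -exprMn; apply: lerXn2r; rewrite ?nnegrE; clear; lra.
  have : (2^-1 : QQ) ^+ a < 2^-1 ^+ count (absorbs H Q) ts.
    by rewrite ltr_iXn2l //; clear; lra.
  by rewrite ltNge le4.
have mW : matchable H W.
  have := @absorb_leftover T k H 0 set0 ts uts; rewrite set0U; apply => //.
  - by move=> A /mts [].
  - by move=> A _; rewrite -setI_eq0 setI0.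
  - by rewrite cards0.
pose V := ~: W.
have cV : (#|V| + #|W| = #|T|)%N by rewrite addnC cardsC.
have kV : (k %| #|V|)%N.
  by rewrite -(dvdn_addl _ (matchable_dvd uH mW)) cV.
have [M [MH tM MV hU]] : exists M : {set {set T}}, [/\ M \subset H, trivIset M, cover M \subset V &
     #|V :\: cover M|%:R <= 1 / (2 * q%:R) * #|T|%:R :> QQ].
  apply: hn1 => // s us ss sV.
  have h6 := prob_split m (fun t => edge H (s ++ t)) (all (mem V)).
  have h7 : prob m (fun t => edge H (s ++ t) && ~~ all (mem V) t) <= m%:R * (#|W|%:R / #|T|%:R).
    apply: le_trans (prob_hit T0 m W); apply: prob_le => t _ /andP [_].
    by rewrite -has_predC; apply: sub_has => x /=; rewrite !inE negbK.
  have h8 : m%:R * (#|W|%:R / #|T|%:R) <= e1.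
    apply: le_trans hq2; rewrite mulrA ler_pdivrMr // mulrAC ler_pdivlMr //.
    rewrite -!natrM ler_nat; apply: (@leq_trans (m * (N * (D * a)) * q)%N).
      by rewrite leq_mul2r leq_mul2l cW !orbT.
    by have -> : (m * (N * (D * a)) * q = m * N * D * (a * q))%N; [ring|rewrite leq_mul2l an orbT].
  have := hdeg s us ss; lra.
pose U := V :\: cover M.
have kU : (k %| #|U|)%N.
  have cU : (#|U| + #|cover M| = #|V|)%N by rewrite cardsD (setIidPr MV) subnK // subset_leq_card.
  by rewrite -(dvdn_addl _ (matchable_dvd uH (_ : matchable H (cover M)))) ?cU //; exists M.
have [l cU] : exists l, #|U| = (l * k)%N by exists (#|U| %/ k)%N; rewrite divnK.
have la : (l <= a)%N.
  rewrite -(ler_nat QQ); apply: le_trans a2; apply: (@le_trans _ _ #|U|%:R).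
    by rewrite ler_nat cU leq_pmulr.
  by apply: le_trans hU _; rewrite mul1r mulrC.
have -> : [set: T] = cover M :|: (U :|: W).
  apply/setP => x; rewrite !inE; case: (boolP (x \in W)); case: (boolP (x \in cover M)) => //.
apply: matchableU; last 2 first.
- by exists M.
- apply: (absorb_leftover uts _ dts _ cU).
  + by move=> A /mts [].
  + move=> A hA; apply: (@disjointWl _ _ (mem W)); first exact: bigcup_seq_sup.
    by rewrite disjoint_subset; apply/subsetP => x xW; rewrite !inE xW andbF.
  + by move=> Q /hits; apply: leq_trans.
rewrite disjoint_sym; apply: disjointsU.
  by rewrite disjoint_subset; apply/subsetP => x; rewrite !inE => /andP [].
rewrite disjoint_subset; apply/subsetP => x xW; rewrite inE; apply/negP => /(subsetP MV).
by rewrite inE xW.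
Qed.

(** * Two kinds of vertices *)

Section NearConstant.
Variables (T : finType) (G : seq T -> bool) (G1 : seq T -> bool) (C : {set T}) (rho gam : QQ).
Variable (k : nat).
Hypotheses (T0 : (0 < #|T|)%N).
Hypothesis Gperm : forall s t, perm_eq s t -> G s = G t.
Hypotheses (rho0 : 0 <= rho) (C_small : #|C|%:R / #|T|%:R <= gam).
Hypothesis Glink : forall z, z \notin C -> prob k.-1 (fun t => G (z :: t) != G1 t) <= rho.

Lemma link_bound z : prob k.-1 (fun t => G (z :: t) != G1 t) <= rho + (z \in C)%:R.
Proof.
case: (boolP (z \in C)) => zC /=; last by rewrite addr0 Glink.
by apply: le_trans (prob_le1 T0 _ _) _; rewrite lerDr.
Qed.

Lemma avg_link : avg 1 (fun x => prob k.-1 (fun t => G (x ++ t) != G1 t)) <= rho + gam.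
Proof.
apply: (@le_trans _ _ (avg 1 (fun x : seq T => rho + (has (mem C) x)%:R))).
  by apply: avg_le => -[//|z [|//]] _ /=; rewrite orbF; exact: link_bound.
by rewrite avgD avg_cst // -/(prob _ _) prob1_mem lerD2l.
Qed.

(** Both links are close to the reference link G1. *)
Lemma swap_one : avg 1 (fun x => avg 1 (fun x' =>
   prob k.-1 (fun t => G (x ++ t) != G (x' ++ t)))) <= 2 * (rho + gam).
Proof.
pose f x := prob k.-1 (fun t => G (x ++ t) != G1 t).
apply: (@le_trans _ _ (avg 1 (fun x => avg 1 (fun x' => f x + f x')))).
  apply: avg_le => x _; apply: avg_le => x' _; apply: le_trans (prob_or _ _ _).
  by apply: prob_le => t _; case: (G _); case: (G _); case: (G1 _).
have -> : avg 1 (fun x => avg 1 (fun x' => f x + f x')) = avg 1 f + avg 1 f.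
  rewrite -[X in _ + X](avg_cst T0 1) -avgD; apply: eq_avg => x _.
  by rewrite avgD avg_cst.
have := avg_link; rewrite -/f; lra.
Qed.

(** Replace the first entry, then the others; by symmetry the fixed first entry
    can be moved among the common ones. *)
Lemma swap_many j i : (j + i = k)%N ->
  avg j (fun s => avg j (fun s' => prob i (fun t => G (s ++ t) != G (s' ++ t))))
  <= j%:R * (2 * (rho + gam)).
Proof.
elim: j i => [|j IH] i hk.
  rewrite mul0r /=; apply: le_trans (_ : prob i (fun => false) <= _).
    by apply: prob_le => t _; rewrite eqxx.
  by rewrite /prob avg_cst.
have hk1 : k.-1 = (j + i)%N by rewrite -hk.
pose A x s x' := prob i (fun t => G ((x ++ s) ++ t) != G ((x' ++ s) ++ t)).
pose B s x' s' := prob i (fun t => G ((x' ++ s) ++ t) != G ((x' ++ s') ++ t)).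
apply: (@le_trans _ _ (avg 1 (fun x => avg j (fun s => avg 1 (fun x' => avg j (fun s' =>
   A x s x' + B s x' s')))))).
  rewrite avg_cons; apply: avg_le => x _; apply: avg_le => s _.
  rewrite avg_cons; apply: avg_le => x' _; apply: avg_le => s' _.
  apply: le_trans (prob_or _ _ _); apply: prob_le => t _.
  by case: (G _); case: (G _); case: (G _).
have -> : avg 1 (fun x => avg j (fun s => avg 1 (fun x' => avg j (fun s' =>
     A x s x' + B s x' s')))) =
   avg 1 (fun x => avg 1 (fun x' => avg j (fun s => A x s x'))) +
   avg j (fun s => avg j (fun s' => avg 1 (fun x' => B s x' s'))).
  rewrite -[X in _ + X](avg_cst T0 1) -avgD; apply: eq_avg => x _.
  rewrite [X in _ = X + _]exchange_avg // -avgD; apply: eq_avg => s _.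
  rewrite [X in _ = _ + X]exchange_avg // -avgD; apply: eq_avg => x' _.
  by rewrite avgD avg_cst.
rewrite -natr1 mulrDl mul1r addrC; apply: lerD.
  apply: le_trans (IH i.+1 _); last by rewrite addnS -hk.
  apply: avg_le => s _; apply: avg_le => s' _.
  rewrite /prob [leRHS]avg_cons; apply: avg_le => x' _; apply: prob_le => t _.
  suff E u : G ((x' ++ u) ++ t) = G (u ++ x' ++ t) by rewrite !E.
  by apply: Gperm; rewrite -catA perm_catCA.
apply: le_trans swap_one; apply: avg_le => x _; apply: avg_le => x' _.
rewrite /prob hk1 avg_cat; apply: avg_le => s _; apply: prob_le => t _.
by rewrite !catA.
Qed.

(** If G takes the value true with probability q, then two independent samples
    differ with probability 2q(1-q). *)
Lemma near_constant : exists b,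
  prob k (fun s => G s != b) <= k%:R * (2 * (rho + gam)).
Proof.
have := swap_many (addn0 k); set q := prob k G.
have -> : avg k (fun s => avg k (fun s' => prob 0 (fun t => G (s ++ t) != G (s' ++ t))))
   = q * (1 - q) + (1 - q) * q.
  transitivity (avg k (fun s => (G s)%:R * (1 - q) + (1 - (G s)%:R) * q)).
    apply: eq_avg => s _; rewrite /prob /=.
    under eq_avg => s' _ do rewrite !cats0.
    case: (G s) => /=.
      rewrite mul1r subrr mul0r addr0 -(probC T0); apply: eq_avg => s' _.
      by case: (G s').
    rewrite mul0r subr0 mul1r add0r; apply: eq_avg => s' _.
    by case: (G s').
  rewrite avgD; congr (_ + _).
    by rewrite mulrC -avgZ; apply: eq_avg => s _; rewrite mulrC.
  rewrite [RHS]mulrC -[in RHS](avg_cst T0 k 1) -avgB -avgZ.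
  by apply: eq_avg => s _; rewrite mulrC.
move=> h; have q0 : 0 <= q by apply: prob_ge0.
have q1 : q <= 1 by apply: prob_le1.
case: (lerP q (1 / 2)) => hq.
  exists false; apply: le_trans (_ : q <= _).
    by apply: prob_le => s _; case: (G s).
  by apply: le_trans h; nra.
exists true; apply: le_trans (_ : 1 - q <= _).
  by rewrite -(probC T0); apply: prob_le => s _; case: (G s).
by apply: le_trans h; nra.
Qed.

Lemma near_constant_link : (0 < k)%N -> exists b,
  forall z, z \notin C ->
    prob k.-1 (fun t => G (z :: t) != b) <= k%:R * (2 * (rho + gam)) + 2 * rho + gam.
Proof.
move=> k0; have [b hb] := near_constant; exists b => z zC.
have h1 : prob k.-1 (fun t => G1 t != b) <= k%:R * (2 * (rho + gam)) + (rho + gam).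
  apply: le_trans (lerD hb avg_link).
  rewrite -[k in prob k (fun s => G s != b)](prednK k0) {2}/prob avg_cons -avgD.
  rewrite -[X in X <= _](avg_cst T0 1); apply: avg_le => x _.
  apply: le_trans (prob_or _ _ _); apply: prob_le => t _.
  by case: (G _); case: (G1 _); case: b {hb}.
apply: (@le_trans _ _ (prob k.-1 (fun t => G (z :: t) != G1 t) + prob k.-1 (fun t => G1 t != b))).
  apply: le_trans (prob_or _ _ _); apply: prob_le => t _.
  by case: (G _); case: (G1 _); case: b {hb h1}.
have := Glink zC; lra.
Qed.

End NearConstant.

(** Two nearly disjoint events of probability near 1/2 are nearly complementary. *)
Lemma prob_complement (T : finType) j (P Q : seq T -> bool) (e b : QQ) : (0 < #|T|)%N ->
  1 / 2 - e <= prob j P -> 1 / 2 - e <= prob j Q ->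
  prob j (fun t => P t && Q t) <= b ->
  prob j (fun t => P t != ~~ Q t) <= 2 * b + 2 * e.
Proof.
move=> T0 hP hQ hb.
have h1 := prob_split j P Q; have h2 := prob_split j (fun t => ~~ P t) Q.
have h3 := prob_split j Q P; rewrite probC // in h2.
have e1 : prob j (fun t => Q t && P t) = prob j (fun t => P t && Q t).
  by apply: eq_prob => t _; rewrite andbC.
have e2 : prob j (fun t => Q t && ~~ P t) = prob j (fun t => ~~ P t && Q t).
  by apply: eq_prob => t _; rewrite andbC.
have h4 : prob j (fun t => P t != ~~ Q t) <=
   prob j (fun t => P t && Q t) + prob j (fun t => ~~ P t && ~~ Q t).
  by apply: le_trans (prob_or _ _ _); apply: prob_le => t _; case: (P t); case: (Q t).
lra.
Qed.

(** Apart from the few vertices in C, every vertex has nearly the link that it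
    would have in the hypergraph of all k-sets of parity p. A vertex of C still lies
    in many edges of parity p whose other vertices avoid C. *)
Definition parity_structure (T : finType) k (H : {set {set T}}) (eta : QQ)
    (A C : {set T}) (p : bool) : Prop :=
  [/\ #|C|%:R <= eta * #|T|%:R,
      `|#|T|%:R - 2 * #|A|%:R| <= eta * #|T|%:R,
      forall z, z \notin C ->
        prob k.-1 (fun t => edge H (z :: t) != (parity (mem A) (z :: t) == p)) <= eta &
      forall z, z \in C -> 1 / 8 <=
        prob k.-1 (fun t => [&& edge H (z :: t), parity (mem A) (z :: t) == p & ~~ has (mem C) t])].

Section Dichotomy.
Variables (T : finType) (k : nat) (H : {set {set T}}) (e b gam : QQ).
Hypotheses (T0 : (0 < #|T|)%N) (k2 : (1 < k)%N).
Hypothesis hdeg : forall x, 1 / 2 - e <= prob k.-1 (fun t => edge H (x :: t)).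
Hypotheses (e14 : e <= 1 / 4) (b0 : 0 < b) (b14 : b <= 1 / 4) (gam0 : 0 < gam).

Definition codeg x y := prob k.-1 (fun t => edge H (x :: t) && edge H (y :: t)).
Definition similar x y := b <= codeg x y.
Definition common x y := [set z | similar x z && similar z y].

Lemma similarC x y : similar x y = similar y x.
Proof. by congr (_ <= _); apply: eq_prob => t _; rewrite andbC. Qed.

Lemma edge_prob : 1 / 4 <= prob k (edge H).
Proof.
rewrite -(prednK (ltnW k2)) /prob avg_cons -[X in X <= _](avg_cst T0 1).
apply: avg_le => -[//|z [|//]] _; apply: le_trans (hdeg z); have := e14; lra.
Qed.

Lemma conn_prob_similar x y : similar x y -> b / 4 <= prob (width k) (connects k H x y).
Proof.
move=> hxy; rewrite /width /prob avg_cat.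
apply: (@le_trans _ _ (avg k.-1 (fun s => (edge H (x :: s) && edge H (y :: s))%:R * (1 / 4)))).
  rewrite -[X in X <= _]mul1r; under eq_avg => s _ do rewrite mulrC.
  rewrite avgZ -/(prob _ _) -/(codeg x y); move: hxy; rewrite /similar; lra.
apply: avg_le => s hs; case: (boolP (_ && _)) => /=; last first.
  by move=> _; rewrite mul0r; apply: avg_ge0.
move=> /andP [h1 h2]; rewrite mul1r; apply: le_trans edge_prob _; apply: prob_le => t _ ht.
by rewrite /connects take_size_cat // drop_size_cat // h1 ht h2 orbT.
Qed.

Lemma conn_prob_common x y : gam * #|T|%:R <= #|common x y|%:R ->
  gam * b ^+ 2 <= prob (width k) (connects k H x y).
Proof.
move=> hc; have -> : width k = (k.-1 + (1 + k.-1))%N by rewrite /width add1n prednK // ltnW.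
rewrite /prob avg_cat; under eq_avg => s _ do rewrite avg_cat.
rewrite exchange_avg //.
apply: (@le_trans _ _ (avg 1 (fun z => b ^+ 2 * (has (mem (common x y)) z)%:R))).
  rewrite avgZ -/(prob _ _) prob1_mem mulrC; apply: ler_wpM2l.
    by apply: exprn_ge0; exact: ltW.
  by rewrite ler_pdivlMr // ltr0n.
apply: avg_le => -[//|z [|//]] _ /=; rewrite orbF inE.
case: (boolP (_ && _)) => [/andP [hxz hzy]|_] /=; last first.
  by rewrite mulr0; apply: avg_ge0 => s _; apply: avg_ge0.
rewrite mulr1 expr2.
apply: (@le_trans _ _ (codeg x z * codeg z y)).
  by apply: ler_pM; rewrite // ltW.
rewrite mulrC -avgZ; apply: avg_le => s hs.
case: (boolP (_ && _)) => [/andP [h1 h2]|_] /=; last by rewrite mulr0; apply: avg_ge0.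
rewrite mulr1; apply: prob_le => t ht /andP [h3 h4].
rewrite /connects take_size_cat // drop_size_cat // h1 h3 /=; apply/orP; left.
have -> : s ++ z :: t = rcons s z ++ t by rewrite cat_rcons.
have sz : size (rcons s z) = k by rewrite size_rcons hs prednK // ltnW.
rewrite take_size_cat // drop_size_cat // h4 andbT.
by rewrite (@edge_eq_mem _ _ _ (z :: s)) // => u; rewrite mem_rcons.
Qed.

(** Outside the common neighbours of x and y, a vertex z is dissimilar to x or to
    y, so its link is nearly the complement of theirs. Adding the parity of the
    number of vertices of the first kind turns the status of a tuple into a function
    with nearly constant links, to which [near_constant_link] applies. *)
Lemma split_of_dissimilar x y : ~~ similar x y -> #|common x y|%:R < gam * #|T|%:R ->
  exists (a : pred T) (p : bool),
  [/\ a x, ~~ a y, x \notin common x y, y \notin common x y &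
   forall z, z \notin common x y ->
   prob k.-1 (fun t => edge H (z :: t) != (parity a (z :: t) == p)) <=
     k%:R * (2 * (4 * b + 4 * e + gam)) + 2 * (4 * b + 4 * e) + gam].
Proof.
move=> nxy cC.
have simxx z : similar z z.
  rewrite /similar /codeg; apply: le_trans (_ : prob k.-1 (fun t => edge H (z :: t)) <= _).
    by apply: le_trans (hdeg z); have := e14; have := b14; lra.
  by apply: prob_le => t _ ->.
pose C := common x y; pose a : pred T := fun z => ~~ similar z y.
pose L t := edge H (y :: t).
pose G s := edge H s (+) parity a s.
pose G1 t := L t (+) parity a t.
have compl u v : ~~ similar u v ->
    prob k.-1 (fun t => edge H (u :: t) != ~~ edge H (v :: t)) <= 2 * b + 2 * e.
  rewrite /similar -ltNge => /ltW h.
  exact: prob_complement T0 (hdeg u) (hdeg v) h.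
have link z : z \notin C -> prob k.-1 (fun t => G (z :: t) != G1 t) <= 4 * b + 4 * e.
  have be0 : 0 <= b + e.
    have := compl x y nxy; have := prob_ge0 k.-1 (fun t => edge H (x :: t) != ~~ edge H (y :: t)).
    lra.
  have E t : (G (z :: t) != G1 t) = (edge H (z :: t) != (a z (+) L t)).
    by rewrite /G /G1 parity_cons; case: (edge H _); case: (parity a t); case: (a z); case: (L t).
  rewrite (eq_prob (fun t _ => E t)) inE negb_and -/C.
  case: (boolP (similar z y)) => hz /=; last first.
    move=> _; apply: le_trans (_ : 2 * b + 2 * e <= _); last by lra.
    apply: le_trans (compl _ _ hz); apply: prob_le => t _; rewrite /a hz /L.
    by case: (edge _ _); case: (edge _ _).
  rewrite orbF => hx; have hx' : ~~ similar z x by rewrite similarC.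
  apply: le_trans (_ : (2 * b + 2 * e) + (2 * b + 2 * e) <= _); last by lra.
  apply: le_trans (lerD (compl _ _ hx') (compl _ _ nxy)).
  apply: le_trans (prob_or _ _ _); apply: prob_le => t _; rewrite /a hz /L.
  by case: (edge _ _); case: (edge _ _); case: (edge _ _).
have Gperm s t : perm_eq s t -> G s = G t.
  move=> h; rewrite /G (edge_eq_mem _ (perm_mem h)) /parity; congr (_ (+) odd _).
  exact: (seq.permP h).
have C_small : #|C|%:R / #|T|%:R <= gam by rewrite ler_pdivrMr ?ltr0n //; exact: ltW.
have rho0 : 0 <= 4 * b + 4 * e.
  have := compl x y nxy; have := prob_ge0 k.-1 (fun t => edge H (x :: t) != ~~ edge H (y :: t)).
  lra.
have [q hq] := near_constant_link T0 Gperm rho0 C_small link (ltnW k2).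
exists a, (~~ q); split.
- exact: nxy.
- by rewrite /a negbK.
- by rewrite inE negb_and (negPf nxy) orbT.
- by rewrite inE negb_and (negPf nxy).
- move=> z zC; apply: le_trans (hq z zC); apply: prob_le => t _.
  by rewrite /G; case: (edge _ _); case: (parity _ _); case: q {hq}.
Qed.

End Dichotomy.

(** The set C consists of the common neighbours of a dissimilar pair. The edges
    through a vertex of C split into two parities, so that for one of the two sides
    many of them have parity p, and the vertex is put on that side. *)
Theorem dichotomy k : (1 < k)%N -> forall eta : QQ, 0 < eta ->
  exists e c : QQ, [/\ 0 < e, 0 < c &
  forall (T : finType) (H : {set {set T}}), (0 < #|T|)%N ->
    (forall x, 1 / 2 - e <= prob k.-1 (fun t => edge H (x :: t))) ->
  (forall x y, c <= prob (width k) (connects k H x y)) \/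
  exists A C p, parity_structure k H eta A C p].
Proof.
move=> k2 eta eta0.
(* The bias of |A| enters through its power k - 1, hence the power of th; all other
   errors are at most 72 * k * d. *)
have [th [th0 th1 th_eta]] : exists th : QQ, [/\ 0 < th, th <= 1 / 2 & 2 * th <= eta].
  case: (lerP eta 1) => h; first by exists (eta / 2); split; lra.
  by exists (1 / 2); split; lra.
have kQ : 2 <= k%:R :> QQ by rewrite (ler_nat _ 2).
have [d [d0 hd hdth]] : exists d : QQ, [/\ 0 < d, 72 * k%:R * d = th ^+ k.-1 & th ^+ k.-1 <= th].
  exists (th ^+ k.-1 / (72 * k%:R)); split.
  - by apply: divr_gt0; [apply: exprn_gt0|lra].
  - by field; lra.
  - rewrite -(prednK (_ : 0 < k.-1)%N) ?exprS; last by rewrite -ltnS prednK // ltnW.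
    rewrite -[X in _ <= X]mulr1; apply: ler_wpM2l; first exact: ltW.
    by apply: exprn_ile1; [exact: ltW|lra].
exists d, (Num.min (d / 4) (d * d ^+ 2)).
have dd0 : 0 < d * d ^+ 2 by apply: mulr_gt0 => //; apply: exprn_gt0.
split=> //; first by rewrite lt_min dd0 andbT; lra.
move=> T H T0 hdeg.
have n0 := cardT_gt0 T0.
have kd : k%:R * d <= 1 / 144 by nra.
have d144 : d <= 1 / 144 by nra.
have d18 : d <= 1 / 4 by lra.
case: (boolP [forall x, [forall y, similar k H d x y || (d * #|T|%:R <= #|common k H d x y|%:R)]]).
  move=> h; left=> x y; have /forallP/(_ x)/forallP/(_ y)/orP [hs|hc] := h.
    rewrite ge_min; apply/orP; left; exact: (conn_prob_similar T0 k2 hdeg).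
  by rewrite ge_min; apply/orP; right; exact: (conn_prob_common T0 k2).
rewrite negb_forall => /existsP [x]; rewrite negb_forall => /existsP [y].
rewrite negb_or => /andP [nxy]; rewrite -ltNge => cC; right.
have [a [p [ax ay xC yC hp]]] := split_of_dissimilar T0 k2 hdeg d18 d18 nxy cC.
move: (common k H d x y) cC xC yC hp => C cC xC yC hp.
have {}hp z : z \notin C -> prob k.-1 (fun t => edge H (z :: t) != (parity a (z :: t) == p)) <= 35 * k%:R * d.
  move=> /hp; move/le_trans; apply; nra.
have Csmall : #|C|%:R / #|T|%:R <= d by rewrite ler_pdivrMr //; exact: ltW.
have hitC : prob k.-1 (has (mem C)) <= k%:R * d.
  apply: le_trans (prob_hit T0 _ _) _; apply: ler_pM => //.
    by rewrite divr_ge0.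
  by rewrite ler_nat leq_pred.
have par_lower z b : z \notin C -> a z (+) b = p -> 1 / 2 - 36 * k%:R * d <= prob k.-1 (fun t => parity a t == b).
  move=> zC zb; have h1 := hp z zC; have h2 := hdeg z.
  have h3 : prob k.-1 (fun t => edge H (z :: t)) <=
     prob k.-1 (fun t => parity a t == b) + prob k.-1 (fun t => edge H (z :: t) != (parity a (z :: t) == p)).
    apply: le_trans (prob_or _ _ _); apply: prob_le => t _; rewrite parity_cons -zb.
    by case: (edge _ _); case: (a z); case: b {zb}; case: (parity a t).
  nra.
(* x lies in A and y does not, and both have links of density near 1/2: so both
   parities of a (k-1)-tuple have probability near 1/2 *)
have bal : `|1 - 2 * (#|a|%:R / #|T|%:R)| <= th :> QQ.
  rewrite leNgt; apply/negP => lt.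
  have hb b : 1 / 2 - 36 * k%:R * d <= prob k.-1 (fun t => parity a t == b).
    case: (boolP (a x (+) b == p)) => [/eqP|ne]; first exact: par_lower.
    apply: (par_lower y) => //; move: ne; rewrite ax (negPf ay).
    by case: b; case: p {hp par_lower}.
  have := hb true; have := hb false; rewrite !parity_bias // expr1 expr0.
  set X := (1 - _) ^+ k.-1; move=> h1 h2.
  have hX : `|X| <= th ^+ k.-1 by rewrite ler_norml -hd; apply/andP; split; lra.
  have : th ^+ k.-1 < `|X|.
    rewrite /X normrX ltr_pXn2r ?nnegrE //; first by rewrite -ltnS prednK // ltnW.
    exact: ltW.
  lra.
pose ok v z := prob k.-1 (fun t => [&& edge H (z :: t), v (+) parity a t == p & ~~ has (mem C) t]).
pose a' z := if z \in C then 1 / 8 <= ok true z else a z.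
pose A := [set z | a' z].
have okC z : z \in C -> 1 / 8 <= ok (a' z) z.
  move=> zC; rewrite /a' zC; case: (lerP (1 / 8) (ok true z)) => // h1.
  have h2 := hdeg z.
  have h3 : prob k.-1 (fun t => edge H (z :: t)) <= ok true z + ok false z + prob k.-1 (has (mem C)).
    apply: (@le_trans _ _ (prob k.-1 (fun t =>
       [&& edge H (z :: t), true (+) parity a t == p & ~~ has (mem C) t] ||
       [&& edge H (z :: t), false (+) parity a t == p & ~~ has (mem C) t]) + prob k.-1 (has (mem C)))).
      apply: le_trans (prob_or _ _ _); apply: prob_le => t _.
      by case: (edge _ _); case: (parity _ _); case: (has _ _); case: p {hp par_lower ok a' A h1}.
    by rewrite lerD2r; exact: prob_or.
  lra.
have parA t : ~~ has (mem C) t -> parity (mem A) t = parity a t.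
  move=> /hasPn h; rewrite /parity; congr (odd _); apply: eq_in_count => z /h.
  by rewrite /= !inE /a' => /negPf ->.
have cA : `|#|A|%:R - #|a|%:R| <= #|C|%:R :> QQ.
  have cc (S : {pred T}) : (#|S| = #|[pred z in S | z \in C]| + #|[pred z in S | z \notin C]|)%N.
    by rewrite -(cardID (mem C) S); congr (_ + _)%N; apply: eq_card => z; rewrite !inE // andbC.
  have e1 : #|[pred z in A | z \notin C]| = #|[pred z in a | z \notin C]|.
    apply: eq_card => z; rewrite !inE /a'; case: (boolP (z \in C)) => zC; by rewrite ?andbF ?andbT.
  have e2 (S : {pred T}) : (#|[pred z in S | z \in C]| <= #|C|)%N.
    by apply: subset_leq_card; apply/subsetP => z; rewrite inE => /andP [].
  rewrite (cc A) (cc a) e1 !natrD.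
  have := e2 (mem A); have := e2 a; rewrite -!(ler_nat QQ) => h1 h2.
  have h3 : 0 <= #|[pred z in A | z \in C]|%:R :> QQ by [].
  have h4 : 0 <= #|[pred z in a | z \in C]|%:R :> QQ by [].
  rewrite ler_norml; apply/andP; split; lra.
exists A, C, p; split.
- apply: le_trans (ltW cC) _; rewrite ler_pM2r //; nra.
- have bal' : `|#|T|%:R - 2 * #|a|%:R| <= th * #|T|%:R :> QQ.
    have -> : #|T|%:R - 2 * #|a|%:R = (1 - 2 * (#|a|%:R / #|T|%:R)) * #|T|%:R :> QQ.
      by field; rewrite gt_eqF.
    by rewrite normrM (ger0_norm (ltW n0)) ler_wpM2r // ltW.
  have h1 : #|C|%:R <= d * #|T|%:R by exact: ltW.
  have h2 : d * 2 <= th by nra.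
  move: bal' cA; rewrite !ler_norml => /andP [h3 h4] /andP [h5 h6].
  have h7 : d * 2 * #|T|%:R <= th * #|T|%:R by rewrite ler_wpM2r // ltW.
  have h8 : 2 * th * #|T|%:R <= eta * #|T|%:R by rewrite ler_wpM2r // ltW.
  apply/andP; split; lra.
- move=> z zC; apply: (@le_trans _ _ (prob k.-1 (fun t => edge H (z :: t) != (parity a (z :: t) == p))
     + prob k.-1 (has (mem C)))).
    apply: le_trans (prob_or _ _ _); apply: prob_le => t _.
    case: (boolP (has (mem C) t)) => [_|ht]; first by rewrite orbT.
    by rewrite orbF !parity_cons parA // /= inE /a' (negPf zC).
  have := hp z zC; nra.
- move=> z zC; apply: le_trans (okC z zC) _; apply: prob_le => t _.
  by case/and3P => -> h ht; rewrite ht parity_cons parA // /= inE h.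
Qed.

(** * Almost complete k-partite hypergraphs *)

Section CyclicShift.
Variables (k N : nat) (J : 'I_k.+1 -> 'I_N).
Hypothesis J_inj : injective J.

(** Shifts cyclically, by i positions, the rows selected by J, and fixes the others. *)
Definition shift (i : 'I_k.+1) (j : 'I_N) : 'I_N :=
  if [pick l | J l == j] is Some l then J (l + i) else j.

Lemma shift_J i l : shift i (J l) = J (l + i).
Proof.
by rewrite /shift; case: pickP => [l' /eqP /J_inj -> //|/(_ l)]; rewrite eqxx.
Qed.

Lemma shift_out i j : (forall l, J l != j) -> shift i j = j.
Proof. by move=> h; rewrite /shift; case: pickP => // l; rewrite (negPf (h l)). Qed.

Lemma shift_inj i : injective (shift i).
Proof.
move=> j j'; rewrite /shift.
case: pickP => [l /eqP <-|h]; case: pickP => [l' /eqP <-|h'].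
- by move=> /J_inj /addIr ->.
- by move=> e; have := h' (l + i); rewrite e eqxx.
- by move=> e; have := h (l' + i); rewrite e eqxx.
- by [].
Qed.

End CyclicShift.

(** Take the rows with the largest number of good ones. If row j0 is bad, choose k
    other rows at random and shift column i of the k+1 selected rows cyclically by i.
    Each new row contains exactly one entry of row j0, so it is bad with
    probability at most eta, and with positive probability all new rows are good. *)
Lemma good_rows k N (bad : pred {ffun 'I_k.+1 -> 'I_N}) (eta : QQ) : (0 < N)%N ->
  (forall i j, #|[set x : {ffun 'I_k.+1 -> 'I_N} | (x i == j) && bad x]|%:R <= eta * N%:R ^+ k) ->
  k.+1%:R ^+ 2 / N%:R + k.+1%:R * eta < 1 ->
  exists pi : 'I_k.+1 -> 'I_N -> 'I_N, (forall i, injective (pi i)) /\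
    forall j, ~~ bad [ffun i => pi i j].
Proof.
move=> N0 hbad hsmall.
have C0 : (0 < #|'I_N|)%N by rewrite card_ord.
pose P (pi : {ffun 'I_k.+1 -> {ffun 'I_N -> 'I_N}}) := [forall i, injectiveb (pi i)].
pose row (pi : {ffun 'I_k.+1 -> {ffun 'I_N -> 'I_N}}) j := [ffun i => pi i j].
pose good pi := [set j | ~~ bad (row pi j)].
have P0 : P [ffun => [ffun j => j]].
  by apply/forallP => i; apply/injectiveP => j j'; rewrite !ffunE.
case: (arg_maxnP (fun pi => #|good pi|) P0) => pi /forallP Ppi pimax.
have pinj i : injective (pi i) by apply/injectiveP.
exists (fun i j => pi i j); split=> // j0.
have -> : [ffun i => pi i j0] = row pi j0 by [].
apply/negP => bj0.
(* the row j0 has number 0 among the selected rows *)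
pose J t (l : 'I_k.+1) := nth j0 (j0 :: t) l.
pose new t (l : 'I_k.+1) : {ffun 'I_k.+1 -> 'I_N} := [ffun i => pi i (J t (l + i))].
have new_bad l : prob k (fun t => bad (new t l)) <= eta.
  have Nk : 0 < N%:R ^+ k :> QQ by rewrite exprn_gt0 // ltr0n.
  rewrite -(ler_pM2r Nk); have := avg_tuple k (fun t => (bad (new t l))%:R) C0.
  rewrite card_ord /prob => ->; apply: le_trans (hbad (- l) (pi (- l) j0)).
  rewrite -natr_sum ler_nat; apply: (@leq_trans #|[set t : k.-tuple 'I_N | bad (new t l)]|).
    by rewrite -sum1_card [X in (_ <= X)%N]big_mkcond; apply: leq_sum => t _; rewrite inE; case: (bad _).
  (* the rows in t can be read off from the coordinates of the new row other than - l *)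
  have inj : injective (fun t : k.-tuple 'I_N => new t l).
    move=> t t' e; apply: eq_from_tnth => c; rewrite !(tnth_nth j0).
    move/ffunP/(_ (lift ord0 c - l)): e; rewrite !ffunE [l + _]addrC subrK => /pinj.
    by rewrite /J /=.
  rewrite -(card_imset _ inj); apply: subset_leq_card.
  apply/subsetP => _ /imsetP [t ht ->]; rewrite inE in ht; rewrite inE ht andbT ffunE.
  by rewrite subrr /J.
have [t st /andP [ut ht]] : exists2 t, size t = k &
    uniq (j0 :: t) && [forall l, ~~ bad (new t l)].
  apply: (prob_exists C0).
  pose ev t := ~~ uniq ([:: j0] ++ t) || ~~ [forall l, ~~ bad (new t l)].
  have h1 : prob k ev <= k.+1%:R ^+ 2 / N%:R + k.+1%:R * eta.
    apply: le_trans (prob_or _ _ _) _; apply: lerD.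
      have /prob_uniq_cat h : uniq [:: j0] by [].
      apply: le_trans (h k C0) _; rewrite card_ord ler_wpM2r ?invr_ge0 // -natrX ler_nat.
      by rewrite add1n expnS expn1 leq_mul2r leqnSn orbT.
    have -> : k.+1%:R * eta = \sum_(l : 'I_k.+1) eta.
      by rewrite sumr_const card_ord mulr_natl.
    apply: le_trans (_ : \sum_(l : 'I_k.+1) prob k (fun t => bad (new t l)) <= _); last first.
      by apply: ler_sum.
    rewrite /prob -avg_sum; apply: avg_le => t _; rewrite negb_forall.
    case: (boolP [exists l, _]) => [/existsP [l]|_]; last by apply: sumr_ge0.
    rewrite negbK => hl; rewrite (bigD1 l) //= hl lerDl; exact: sumr_ge0.
  have := probC C0 k ev => h2.
  have h3 : prob k (fun t => ~~ ev t) <= prob k (fun t => uniq (j0 :: t) && [forall l, ~~ bad (new t l)]).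
    by apply: prob_le => t _; rewrite /ev negb_or !negbK.
  lra.
have Jinj : injective (J t).
  have lt (l : 'I_k.+1) : (l < size (j0 :: t))%N by rewrite /= st.
  by move=> l l' /eqP; rewrite nth_uniq ?lt // => /eqP h; apply: val_inj.
pose pi' := [ffun i => [ffun j => pi i (shift (J t) i j)]] : {ffun 'I_k.+1 -> {ffun 'I_N -> 'I_N}}.
have Ppi' : P pi'.
  apply/forallP => i; apply/injectiveP => j j'; rewrite !ffunE => /pinj.
  exact: shift_inj.
have le : (#|good pi'| <= #|good pi|)%N := pimax _ Ppi'; move: le; rewrite leqNgt => /negP; apply; apply: proper_card.
have rowJ l : row pi' (J t l) = new t l.
  by apply/ffunP => i; rewrite !ffunE shift_J.
apply/properP; split; last first.
  exists j0; rewrite !inE ?negbK //.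
  have -> : j0 = J t ord0 by [].
  by rewrite rowJ (forallP ht).
apply/subsetP => j; rewrite !inE => gj.
case: (boolP [exists l, J t l == j]) => [/existsP [l /eqP <-]|].
  by rewrite rowJ (forallP ht).
rewrite negb_exists => /forallP hj.
suff -> : row pi' j = row pi j by [].
by apply/ffunP => i; rewrite !ffunE shift_out.
Qed.

Section Partite.
Variables (T : finType) (k N a L : nat) (H : {set {set T}}) (A A1 B1 : {set T}) (p : bool) (eta : QQ).
Hypotheses (T0 : (0 < #|T|)%N) (N0 : (0 < N)%N) (ak : (a <= k.+1)%N).
Hypotheses (cA : #|A1| = (a * N)%N) (cB : #|B1| = ((k.+1 - a) * N)%N).
Hypotheses (sA : A1 \subset A) (sB : [disjoint B1 & A]) (pa : odd a = p).
Hypothesis typical : forall z, z \in A1 :|: B1 ->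
  prob k (fun t => edge H (z :: t) != (parity (mem A) (z :: t) == p)) <= eta.
Hypotheses (nL : (#|T| <= L * N)%N) (eta0 : 0 <= eta)
  (small : k.+1%:R ^+ 2 / N%:R + k.+1%:R * (eta * L%:R ^+ k) < 1).

(** The columns of the array are a classes of size N in A1 and k+1-a in B1, so all
    transversals have the parity p and [good_rows] finds N disjoint edges. *)
Lemma partite_matching : matchable H (A1 :|: B1).
Proof.
have dAB : [disjoint A1 & B1] by rewrite disjoint_sym; apply: disjointWr sA sB.
pose vs := enum A1 ++ enum B1.
have memvs x : (x \in vs) = (x \in A1 :|: B1) by rewrite mem_cat !mem_enum inE.
have szA : size (enum A1) = (a * N)%N by rewrite -cardE.
have szvs : size vs = (k.+1 * N)%N.
  by rewrite size_cat szA -cardE cB -mulnDl subnKC.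
have uvs : uniq vs.
  rewrite cat_uniq !enum_uniq andbT /=; apply/hasPn => x; rewrite !mem_enum => xB.
  by apply/negP => xA; move/pred0P/(_ x): dAB; rewrite /= xA xB.
have [x0 _] : exists x0 : T, x0 \in predT by apply/card_gt0P.
pose rho (j : 'I_N) (c : 'I_k.+1) := nth x0 vs (c * N + j).
have lt_idx (j : 'I_N) (c : 'I_k.+1) : (c * N + j < size vs)%N.
  rewrite szvs; apply: leq_trans (_ : (c.+1 * N <= _)%N); first by rewrite mulSn addnC ltn_add2r.
  by rewrite leq_mul2r ltn_ord orbT.
have rho_inj j c j' c' : rho j c = rho j' c' -> j = j' /\ c = c'.
  move=> /eqP; rewrite nth_uniq // => /eqP E.
  have : ((c * N + j) %/ N = (c' * N + j') %/ N)%N by rewrite E.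
  have : ((c * N + j) %% N = (c' * N + j') %% N)%N by rewrite E.
  rewrite !modnMDl !divnMDl // !modn_small // !divn_small // !addn0 => e1 e2.
  by split; apply: val_inj.
have rho_in j c : rho j c \in A1 :|: B1 by rewrite -memvs mem_nth.
have rho_sur v : v \in A1 :|: B1 -> exists j c, v = rho j c.
  rewrite -memvs => hv; have hi : (index v vs < k.+1 * N)%N by rewrite -szvs index_mem.
  have h1 : (index v vs %/ N < k.+1)%N by rewrite ltn_divLR.
  have h2 : (index v vs %% N < N)%N by rewrite ltn_mod.
  by exists (Ordinal h2), (Ordinal h1); rewrite /rho /= -divn_eq nth_index.
have rho_A j c : (rho j c \in A) = (c < a)%N.
  rewrite /rho nth_cat szA; case: ltnP => [lt|ge].
    have -> : (c < a)%N by rewrite -(ltn_pmul2r N0); apply: leq_ltn_trans lt; exact: leq_addr.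
    by apply: (subsetP sA); rewrite -mem_enum mem_nth // szA.
  have -> : (c < a)%N = false.
    apply/negbTE; rewrite -leqNgt leqNgt; apply/negP => ca; move: ge; rewrite leqNgt => /negP; apply.
    apply: leq_trans (_ : (c.+1 * N <= _)%N); first by rewrite mulSn addnC ltn_add2r.
    by rewrite leq_mul2r ca orbT.
  have : nth x0 (enum B1) (c * N + j - a * N) \in B1.
    by rewrite -mem_enum mem_nth //; have := lt_idx j c; rewrite size_cat szA => h; rewrite ltn_subLR.
  by move=> hB; apply/negbTE/negP => hA; move/pred0P/(_ (nth x0 (enum B1) (c * N + j - a * N))): sB; rewrite /= hA hB.
pose r (x : {ffun 'I_k.+1 -> 'I_N}) := [seq rho (x c) c | c <- enum 'I_k.+1].
have ur x : uniq (r x).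
  by rewrite map_inj_uniq ?enum_uniq // => c c' /rho_inj [].
have par_r x : parity (mem A) (r x) = p.
  rewrite /parity count_map (eq_count (a2 := fun c : 'I_k.+1 => (c < a)%N)); last first.
    by move=> c /=; rewrite rho_A.
  rewrite -pa; congr odd; rewrite -(count_map val (fun i => (i < a)%N)) val_enum_ord.
  have -> : k.+1 = (a + (k.+1 - a))%N by rewrite subnKC.
  rewrite iotaD count_cat add0n.
  rewrite (eq_in_count (a2 := predT)) ?count_predT ?size_iota; last first.
    by move=> i; rewrite mem_iota /= add0n => ->.
  rewrite (eq_in_count (a2 := pred0)) ?count_pred0 ?addn0 // => i.
  by rewrite mem_iota => /andP [h _]; rewrite ltnNge h.
pose bad x := ~~ edge H (r x).
have bad_count i j : #|[set x : {ffun 'I_k.+1 -> 'I_N} | (x i == j) && bad x]|%:R <= eta * L%:R ^+ k * N%:R ^+ k.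
  pose tl (x : {ffun 'I_k.+1 -> 'I_N}) : {ffun 'I_k -> T} :=
    [ffun c => rho (x (lift i c)) (lift i c)].
  pose F (t : seq T) : QQ := (edge H (rho j i :: t) != (parity (mem A) (rho j i :: t) == p))%:R.
  apply: (@le_trans _ _ (eta * #|T|%:R ^+ k)); last first.
    rewrite -mulrA ler_wpM2l // -exprMn; apply: lerXn2r; rewrite ?nnegrE ?mulr_ge0 //.
    by rewrite -natrM ler_nat.
  apply: (@le_trans _ _ (avg k F * #|T|%:R ^+ k)); last first.
    by rewrite ler_wpM2r ?exprn_ge0 //; apply: typical.
  rewrite avg_ffun // -natr_sum ler_nat.
  pose S := [set x : {ffun 'I_k.+1 -> 'I_N} | (x i == j) && bad x].
  have tinj : {in S &, injective tl}.
    move=> x y; rewrite !inE => /andP [/eqP xi _] /andP [/eqP yi _] e; apply/ffunP => c.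
    case: (unliftP i c) => [d ->|->]; last by rewrite xi yi.
    by move/ffunP/(_ d): e; rewrite !ffunE => /rho_inj [].
  rewrite -/S -(card_in_imset tinj) -sum1_card big_mkcond /=; apply: leq_sum => q _.
  case: ifP => // /imsetP [x]; rewrite inE => /andP [/eqP xi bx] ->.
  have pe : perm_eq (rho j i :: [seq tl x c | c <- enum 'I_k]) (r x).
    apply: uniq_perm; last 1 first.
    - move=> v; rewrite inE; apply/orP/mapP => [[/eqP ->|/mapP [c _ ->]]|[c _ ->]].
      + by exists i; rewrite ?mem_enum ?xi.
      + by exists (lift i c); rewrite ?mem_enum ?ffunE.
      + case: (unliftP i c) => [d ->|->]; last by left; rewrite xi.
        by right; apply/mapP; exists d; rewrite ?mem_enum ?ffunE.
    - rewrite /= map_inj_uniq ?enum_uniq ?andbT; last first.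
        by move=> c c'; rewrite !ffunE => /rho_inj [_ /lift_inj].
      apply/negP => /mapP [c _]; rewrite ffunE => /rho_inj [_ e].
      by have := neq_lift i c; rewrite -e eqxx.
    - exact: ur.
  rewrite (edge_eq_mem _ (perm_mem pe)).
  have -> : parity (mem A) (rho j i :: [seq tl x c | c <- enum 'I_k]) = parity (mem A) (r x).
    by rewrite /parity (seq.permP pe).
  by rewrite par_r eqxx; move: bx; rewrite /bad; case: (edge _ _).
have [pi [pinj pgood]] := good_rows N0 bad_count small.
pose e j := [set x in r [ffun c => pi c j]].
exists [set e j | j : 'I_N]; split.
- apply/subsetP => _ /imsetP [j _ ->]; have := pgood j; rewrite /bad negbK; exact.
- apply/trivIsetP => _ _ /imsetP [j _ ->] /imsetP [j' _ ->] ne.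
  rewrite disjoint_subset; apply/subsetP => v; rewrite !inE => /mapP [c _ ->].
  apply/negP => /mapP [c' _]; rewrite !ffunE => /rho_inj [e1 e2]; subst c'.
  by move: ne; rewrite (pinj _ _ _ e1) eqxx.
- apply/setP => v; apply/bigcupP/idP => [[_ /imsetP [j _ ->]]|/rho_sur [j [c ->]]].
    by rewrite inE => /mapP [c _ ->]; exact: rho_in.
  have /codomP [j' ej] : j \in codom (pi c) by apply/inj_card_onto.
  exists (e j'); first by apply: imset_f.
  by rewrite inE; apply/mapP; exists c; rewrite ?mem_enum // ffunE ej.
Qed.

End Partite.

(** * Hypergraphs close to a parity hypergraph *)

(** The two row types have p and k - p vertices in A. Since k - 2p is even, one
    extra edge with s vertices in A adjusts the number of vertices of A modulo
    k - 2p, and then u and v are determined by a linear system. *)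
Lemma row_types (k p n n' a' b' : nat) : (p <= 1)%N -> (4 <= k)%N -> ~~ odd k ->
  (a' + b' = k * n')%N -> odd a' = odd (p * n') ->
  (59 * n <= 128 * a')%N -> (59 * n <= 128 * b')%N -> (k * n' <= n)%N -> (64 * k <= n)%N ->
  exists s u v, [/\ (s <= k)%N, odd s = odd p,
    (a' = s + p * u + (k - p) * v)%N, (b' = (k - s) + (k - p) * u + p * v)%N &
    (n <= 8 * k * u)%N /\ (n <= 8 * k * v)%N].
Proof.
move=> p1 k4 ok ab oab ha hb kn kn'.
have n4 : (4 * n' <= n)%N by apply: leq_trans kn; rewrite leq_mul2r k4 orbT.
have pn : (p * n' <= n')%N by rewrite -[X in (_ <= X)%N]mul1n leq_mul2r p1 orbT.
have [D [eD D2 oD]] : exists D, [/\ (k = D + 2 * p)%N, (2 <= D)%N & ~~ odd D].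
  exists (k - 2 * p)%N; split; [lia|lia|].
  by rewrite oddB ?(negPf ok) ?oddM //=; lia.
have [X eX] : exists X, (a' = p * n' + X)%N by exists (a' - p * n')%N; lia.
have oX : ~~ odd X by move: oab; rewrite eX oddD; case: (odd (p * n')); case: (odd X).
pose v := (X %/ D)%N; pose w := (X %% D)%N.
have eXv : (X = v * D + w)%N by exact: divn_eq.
have wD : (w < D)%N by rewrite ltn_mod; lia.
have ow : odd w = false.
  by move: oX; rewrite eXv oddD oddM (negPf oD) andbF /= => /negbTE.
have Dk : (D <= k)%N by lia.
(* otherwise b' would be at most p * n', and so at most n / 4 *)
have vn' : (v < n')%N.
  rewrite ltnNge; apply/negP => h.
  have : (n' * D <= v * D)%N by rewrite leq_mul2r h orbT.
  have : (k * n' = n' * D + 2 * (p * n'))%N by rewrite eD; ring.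
  lia.
have [u eu] : exists u, (n' = u + v + 1)%N by exists (n' - v - 1)%N; lia.
exists (p + w)%N, u, v; rewrite oddD ow addbF.
have e1 : (p * n' = p * u + p * v + p)%N by rewrite eu; ring.
have e2 : ((k - p) * v = v * D + p * v)%N.
  by rewrite (_ : k - p = D + p)%N; [ring|lia].
have e3 : ((k - p) * u = u * D + p * u)%N.
  by rewrite (_ : k - p = D + p)%N; [ring|lia].
have e4 : (k * n' = u * D + 2 * (p * u) + v * D + 2 * (p * v) + k)%N.
  by rewrite eu eD; ring.
have l1 : (v * D <= v * k)%N by rewrite leq_mul2l Dk orbT.
have l2 : (u * D <= u * k)%N by rewrite leq_mul2l Dk orbT.
have e5 : (8 * k * u = 8 * (u * k))%N by ring.
have e6 : (8 * k * v = 8 * (v * k))%N by ring.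
rewrite e2 e3 e5 e6; split; try lia.
Qed.

Lemma odd_cover (T : finType) (H M : {set {set T}}) (A : {set T}) (p : bool) :
  M \subset H -> trivIset M -> (forall e, e \in H -> odd #|e :&: A| = p) ->
  odd #|cover M :&: A| = (p && odd #|M|).
Proof.
move=> MH tM hp.
have -> : #|cover M :&: A| = (\sum_(e in M) #|e :&: A|)%N.
  rewrite -sum1_card (eq_bigl (fun x => (x \in cover M) && (x \in A))); last by move=> x; rewrite inE.
  rewrite big_mkcondr /= big_trivIset //=; apply: eq_bigr => e _.
  by rewrite -big_mkcondr -sum1_card; apply: eq_bigl => x; rewrite inE.
have : forall r : seq {set T}, {subset r <= M} ->
    odd (\sum_(e <- r) #|e :&: A|) = p && odd (size r).
  elim=> [|e r IH] sr; first by rewrite big_nil andbF.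
  rewrite big_cons oddD IH; last by move=> f fr; apply: sr; rewrite inE fr orbT.
  rewrite hp; last by apply: (subsetP MH); apply: sr; rewrite mem_head.
  by rewrite /=; case: p {hp IH}; case: (odd (size r)).
move=> /(_ (enum M)); rewrite -cardE big_enum; apply => e.
by rewrite mem_enum.
Qed.

Lemma card_split (T : finType) (A : {set T}) i j : #|A| = (i + j)%N ->
  exists A1 A2 : {set T}, [/\ A = A1 :|: A2, [disjoint A1 & A2], #|A1| = i & #|A2| = j].
Proof.
move=> cA; have [A1] : exists S : {set T}, S \in [set S : {set T} | S \subset A & #|S| == i].
  by apply/card_gt0P; rewrite cards_draws bin_gt0 cA leq_addr.
rewrite inE => /andP [sA1 /eqP c1]; exists A1, (A :\: A1); split=> //.
- by rewrite -{1}(setID A A1) (setIidPr sA1).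
- by rewrite -setI_eq0 setDE setICA setICr setI0.
- by rewrite cardsD (setIidPr sA1) cA c1 addKn.
Qed.

Section Extremal.
Variables (T : finType) (k : nat) (H : {set {set T}}) (eta : QQ) (A C : {set T}) (p : bool).
Hypotheses (k4 : (4 <= k)%N) (ok : ~~ odd k) (uH : uniform k H) (kn : (k %| #|T|)%N).
Hypotheses (eta0 : 0 <= eta) (eta_k : 64 * k%:R ^+ 2 * eta <= 1)
  (eta_typ : 4 * eta * 4 ^+ k <= 1) (eta_row : 4 * (k%:R * (eta * (8 * k)%:R ^+ k.-1)) <= 1).
Hypothesis n_large : (64 * k ^ 3 <= #|T|)%N.
Hypothesis PS : parity_structure k H eta A C p.
Hypothesis wrong_edge : odd #|A| != (p && odd (#|T| %/ k)) ->
  exists2 e, e \in H & odd #|e :&: A| != p.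

Let k0 : (0 < k)%N. Proof. exact: leq_trans k4. Qed.
Let T0 : (0 < #|T|)%N.
Proof. by apply: leq_trans n_large; rewrite muln_gt0 expn_gt0 k0. Qed.

(** An edge of the wrong parity is used exactly when parity forbids a perfect
    matching by edges of parity p. *)
Lemma fix_parity : exists W0 b0,
  [/\ matchable H W0, #|W0| = (k * b0)%N, (b0 <= 1)%N &
      odd #|W0 :&: A| = odd #|A| (+) (p && (odd (#|T| %/ k) (+) odd b0))].
Proof.
case: (boolP (odd #|A| == (p && odd (#|T| %/ k)))) => [/eqP h|h].
  exists set0, 0%N; rewrite cards0 muln0 set0I cards0 addbF h addbb; split=> //.
  exact: matchable0.
have [e eH he] := wrong_edge h.
exists e, 1%N; rewrite muln1 (uH eH); split=> //; first exact: matchable_edge.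
by move: he h; case: (odd #|e :&: A|); case: p; case: (odd #|A|); case: (odd (_ %/ _)).
Qed.

Lemma cover_exceptional (W0 : {set T}) : (#|W0| <= k)%N ->
  exists M : {set {set T}}, [/\ M \subset H, trivIset M,
    forall e, e \in M -> odd #|e :&: A| = p,
    [disjoint W0 & cover M] & C \subset W0 :|: cover M /\ (#|M| <= #|C|)%N].
Proof.
move=> cW0; have [C_small _ _ hC] := PS.
pose H' := [set e in H | odd #|e :&: A| == p].
have uH' : uniform k H' by move=> e; rewrite inE => /andP [/uH].
pose C1 := C :\: W0; pose qs := [seq [set z] | z <- enum C1].
have c1 : (#|C1| <= #|C|)%N by rewrite subset_leq_card // subsetDl.
have n0 := cardT_gt0 T0.
have bqs : \bigcup_(q <- qs) q = C1.
  rewrite /qs big_map big_enum /=; apply/setP => x; apply/bigcupP/idP => [[z hz]|hx].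
    by rewrite inE => /eqP ->.
  by exists x => //; rewrite inE.
have [||||M [MH' tM qM cM sM]] := @greedy_extension T k H' k.-1 (1 / 8) (~: C) (W0 :|: C) qs T0 k0 uH'.
- move=> _ /mapP [z hz ->]; rewrite mem_enum inE in hz; case/andP: hz => _ zC.
  apply: le_trans (hC z zC) _; apply: prob_le => t ht /and3P [he hp /hasPn hh].
  have -> : [set x in t] :|: [set z] = [set x in z :: t].
    by rewrite setUC; apply/setP => x; rewrite !inE.
  have u : uniq (z :: t) by apply: edge_uniq uH _ he; rewrite /= ht prednK.
  rewrite inE [_ \in H]he parity_edge // (eqP hp) eqxx /=.
  by apply/allP => x /hh; rewrite /= inE.
- rewrite /qs pairwise_map; apply: (sub_in_pairwise (P := predT) (r := fun i j => i != j)).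
  + by move=> i j _ _ ij /=; rewrite disjoints1 inE.
  + by apply/allP.
  + by rewrite -uniq_pairwise enum_uniq.
- move=> _ /mapP [z hz ->]; rewrite mem_enum inE in hz; case/andP: hz => _ zC.
  by rewrite sub1set inE zC orbT.
- rewrite size_map -cardE ltr_pdivrMr //.
  have h1 : (k.-1 * (#|W0 :|: C| + k.-1 * #|C1|) <= k * (k + #|C| + k * #|C|))%N.
    apply: leq_mul; first exact: leq_pred.
    apply: leq_add; last by apply: leq_mul => //; exact: leq_pred.
    by apply: leq_trans (leq_card_setU _ _).1 _; rewrite leq_add2r.
  apply: (@le_lt_trans _ _ (k * (k + #|C| + k * #|C|))%:R); first by rewrite ler_nat.
  have kQ : 4 <= k%:R :> QQ by rewrite (ler_nat _ 4).
  have h2 : 64 * k%:R ^+ 3 <= #|T|%:R :> QQ by rewrite -natrX -natrM ler_nat.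
  rewrite natrM !natrD natrM.
  have h3 : k%:R * k%:R * #|C|%:R <= 1 / 64 * #|T|%:R :> QQ.
    have := eta_k => h4.
    apply: (@le_trans _ _ (k%:R * k%:R * (eta * #|T|%:R))); first by rewrite ler_wpM2l // mulr_ge0.
    by rewrite !mulrA ler_wpM2r //; lra.
  have h4 : k%:R * #|C|%:R <= k%:R * k%:R * #|C|%:R :> QQ.
    rewrite ler_wpM2r // -[X in X <= _]mulr1; rewrite ler_wpM2l //; lra.
  have h5 : 256 * (k%:R * k%:R) <= #|T|%:R :> QQ.
    apply: le_trans h2; rewrite exprS expr2.
    have := mulr_ge0 (ler0n QQ k) (ler0n QQ k); nra.
  have : k%:R * (k%:R + #|C|%:R + k%:R * #|C|%:R) =
     k%:R * k%:R + k%:R * #|C|%:R + k%:R * k%:R * #|C|%:R :> QQ by ring.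
  move=> ->; lra.
rewrite bqs in qM cM.
exists M; split=> //.
- by apply: subset_trans MH' _; apply/subsetP => e; rewrite inE => /andP [].
- by move=> e /(subsetP MH'); rewrite inE => /andP [_ /eqP].
- apply: disjointWr cM _; rewrite disjoint_sym; apply: disjointsU.
    by rewrite disjoint_subset; apply/subsetP => x; rewrite !inE => /andP [].
  by rewrite disjoint_subset; apply/subsetP => x; rewrite !inE negb_or => /andP [/andP [-> _] _].
- split; last by rewrite sM size_map -cardE.
  apply/subsetP => x xC; rewrite inE; case: (boolP (x \in W0)) => //= xW.
  by apply: (subsetP qM); rewrite inE xW.
Qed.

Lemma typed_edge (s : nat) (A1 B1 : {set T}) : (s <= k)%N -> odd s = p ->
  A1 \subset A -> [disjoint B1 & A] -> (#|T| <= 4 * #|A1|)%N -> (#|T| <= 4 * #|B1|)%N ->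
  exists F : {set T}, [/\ F \in H, F \subset A1 :|: B1 & #|F :&: A| = s].
Proof.
move=> sk os sA sB cA cB; have [C_small _ hT _] := PS.
have n0 := cardT_gt0 T0.
have atyp : prob k (fun t => edge H t != (parity (mem A) t == p)) <= eta + eta.
  rewrite -[k in prob k _](prednK k0) {1}/prob avg_cons.
  apply: (@le_trans _ _ (avg 1 (fun z : seq T => eta + (has (mem C) z)%:R))).
    apply: avg_le => -[//|z [|//]] _; case: (boolP (has _ _)) => /=; rewrite orbF => zC.
      apply: le_trans (prob_le1 T0 _ _) _; rewrite lerDr; exact: eta0.
    by rewrite addr0; apply: hT.
  by rewrite avgD avg_cst // -/(prob _ _) prob1_mem lerD2l ler_pdivrMr.
have pat : 4^-1 ^+ k <= prob k (fun t => all (mem A1) (take s t) && all (mem B1) (drop s t)).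
  rewrite -{1 2}(subnKC sk) prob_all_cat exprD.
  have hq (S : {set T}) : (#|T| <= 4 * #|S|)%N -> 4^-1 <= #|S|%:R / #|T|%:R :> QQ.
    by move=> h; rewrite ler_pdivlMr // ler_pdivrMl // -natrM ler_nat.
  have q0 : 0 <= 4^-1 :> QQ by rewrite invr_ge0.
  apply: ler_pM; rewrite ?exprn_ge0 //; apply: lerXn2r; rewrite ?nnegrE ?divr_ge0 //; exact: hq.
have [t st /andP [/andP [/allP tA /allP tB] te]] : exists2 t, size t = k &
   (all (mem A1) (take s t) && all (mem B1) (drop s t)) &&
   ~~ (edge H t != (parity (mem A) t == p)).
  apply: (prob_exists T0).
  have := prob_split k (fun t => all (mem A1) (take s t) && all (mem B1) (drop s t))
    (fun t => edge H t != (parity (mem A) t == p)).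
  have : prob k (fun t => (all (mem A1) (take s t) && all (mem B1) (drop s t)) &&
    (edge H t != (parity (mem A) t == p))) <= eta + eta.
    by apply: le_trans atyp; apply: prob_le => t _ /andP [].
  have : 4 * eta <= 4^-1 ^+ k.
    by rewrite exprVn -[X in _ <= X]mul1r ler_pdivlMr ?exprn_gt0 // eta_typ.
  have : 0 < 4^-1 ^+ k :> QQ by rewrite exprn_gt0 // invr_gt0.
  lra.
have cnt : count (mem A) t = s.
  rewrite -[t](cat_take_drop s) count_cat.
  rewrite (eq_in_count (a2 := predT)) ?count_predT ?size_takel ?st //; last first.
    by move=> x /tA /(subsetP sA).
  rewrite (eq_in_count (a2 := pred0)) ?count_pred0 ?addn0 // => x /tB xB.
  exact: (disjointFr sB xB).
have et : edge H t by move: te; rewrite /parity cnt os eqxx negbK => /eqP.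
exists [set x in t]; split=> //.
- apply/subsetP => x; rewrite !inE -[t](cat_take_drop s) mem_cat => /orP [/tA|/tB] h.
    by apply/orP; left.
  by apply/orP; right.
- have ut := edge_uniq uH st et.
  rewrite -cnt -size_filter -card_uniq_seq_set ?filter_uniq //.
  by congr #|pred_of_set _|; apply/setP => x; rewrite !inE mem_filter andbC.
Qed.

(** The edge that settles the parity is not under control, so it is removed
    first. From then on only edges of parity p are used, which keeps the parity of the
    number of vertices left in A in step with the number of edges still to be found. *)
Theorem extremal_matching : matchable H [set: T].
Proof.
have [W0 [b0 [mW0 cW0 b01 oW0]]] := fix_parity.
have cW0k : (#|W0| <= k)%N by rewrite cW0 -[X in (_ <= X)%N]muln1 leq_mul2l b01 orbT.
have [M [MH tM pM dWM [CW sM]]] := cover_exceptional cW0k.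
have [C_small hA hT _] := PS.
have n0 := cardT_gt0 T0.
pose W := W0 :|: cover M.
have mW : matchable H W by apply: matchableU => //; exists M.
have cM := card_cover_uniform uH MH tM.
have cW : #|W| = (k * (b0 + #|M|))%N.
  by rewrite cardsU (disjoint_setI0 dWM) cards0 subn0 cW0 cM mulnDr.
have kQ : 4 <= k%:R :> QQ by rewrite (ler_nat _ 4).
have nk3 : (64 * k ^ 3 <= #|T|)%N := n_large.
have W_small : (32 * #|W| <= #|T|)%N.
  have h1 : (k * #|C|)%:R * 64 <= #|T|%:R :> QQ.
    apply: (@le_trans _ _ (k%:R * (eta * #|T|%:R) * 64)).
      by rewrite ler_wpM2r // natrM ler_wpM2l.
    have -> : k%:R * (eta * #|T|%:R) * 64 = 64 * k%:R * eta * #|T|%:R by ring.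
    rewrite -[X in _ <= X]mul1r ler_wpM2r //; apply: le_trans eta_k.
    rewrite ler_wpM2r ?eta0 //; rewrite expr2; nra.
  have h2 : (64 * (k * #|C|) <= #|T|)%N by rewrite -(ler_nat QQ) natrM mulrC.
  have h3 : (k * (b0 + #|M|) <= k + k * #|C|)%N.
    by rewrite -mulnS leq_mul2l; apply/orP; right; rewrite -add1n leq_add.
  have h4 : (k <= k ^ 3)%N by rewrite -{1}(expn1 k) leq_pexp2l.
  rewrite cW; move: h2 h3 h4 nk3; clear; lia.
have A_lower : (63 * #|T| <= 128 * #|A|)%N /\ (128 * #|A| <= 65 * #|T|)%N.
  have h1 : eta * #|T|%:R * 64 <= #|T|%:R.
    rewrite -[X in _ <= X]mul1r mulrAC ler_wpM2r //; apply: le_trans eta_k.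
    rewrite mulrC ler_wpM2r ?eta0 // expr2; nra.
  move: hA; rewrite ler_norml => /andP [h2 h3].
  by split; rewrite -(ler_nat QQ) !natrM; lra.
pose n' := (#|T| %/ k - (b0 + #|M|))%N.
have nk : (#|T| = #|T| %/ k * k)%N by rewrite divnK.
have bM : (b0 + #|M| <= #|T| %/ k)%N.
  by rewrite leq_divRL // mulnC -cW max_card.
pose A' := A :\: W; pose B' := ~: A :\: W.
have cA' : (#|A'| + #|A :&: W| = #|A|)%N by rewrite addnC cardsID.
have cB' : (#|B'| + #|~: A :&: W| = #|~: A|)%N by rewrite addnC cardsID.
have cAW : (#|A :&: W| + #|~: A :&: W| = #|W|)%N.
  by rewrite ![_ :&: W]setIC -setDE cardsID.
have cAA : (#|A| + #|~: A| = #|T|)%N by exact: cardsC.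
have sumAB : (#|A'| + #|B'| = k * n')%N.
  rewrite /n' mulnBr -cW [(k * _)%N]mulnC -nk.
  move: cA' cB' cAW cAA; clear; lia.
have oA' : odd #|A'| = odd (p * n').
  have oM := odd_cover (subxx M) tM pM.
  have cWA : (#|A :&: W| = #|W0 :&: A| + #|cover M :&: A|)%N.
    rewrite [A :&: W]setIC /W setIUl cardsU.
    suff -> : W0 :&: A :&: (cover M :&: A) = set0 by rewrite cards0 subn0.
    apply/eqP; rewrite setI_eq0; apply: disjointWl (subsetIl _ _) _.
    exact: disjointWr (subsetIl _ _) dWM.
  have : odd #|A| = odd #|A'| (+) (odd #|W0 :&: A| (+) odd #|cover M :&: A|).
    by rewrite -cA' cWA !oddD.
  rewrite oW0 oM oddM oddb /n' oddB // oddD.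
  move: (odd #|A|) (odd #|A'|) (odd (#|T| %/ k)) (odd b0) (odd #|M|).
  by case: (p) => -[] [] [] [] [].
have hA' : (59 * #|T| <= 128 * #|A'|)%N.
  case: A_lower => h1 h2; move: h1 cA' cAW W_small; clear; lia.
have hB' : (59 * #|T| <= 128 * #|B'|)%N.
  case: A_lower => h1 h2; move: h2 cB' cAW W_small cAA; clear; lia.
have kn' : (k * n' <= #|T|)%N.
  by rewrite -sumAB; move: cA' cB' cAA; clear; lia.
have n64 : (64 * k <= #|T|)%N.
  by apply: leq_trans nk3; rewrite leq_mul2l -{1}(expn1 k) leq_pexp2l.
have [s [u [v [sk os eA eB [un vn]]]]] := row_types (leq_b1 p) k4 ok sumAB oA' hA' hB' kn' n64.
rewrite oddb in os.
have sA' : A' \subset A by exact: subsetDl.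
have dB' : [disjoint B' & A].
  by rewrite disjoint_subset; apply/subsetP => x; rewrite !inE => /andP [].
have [F [FH FAB cF]] : exists F : {set T}, [/\ F \in H, F \subset A' :|: B' & #|F :&: A| = s].
  apply: typed_edge => //; [move: hA'|move: hB']; clear; lia.
have cFk := uH FH.
have FA' : F :&: A = F :&: A'.
  apply/setP => x; rewrite !inE; case: (boolP (x \in F)) => //= xF.
  move/(subsetP FAB): xF; rewrite !inE.
    by case: (x \in W0); case: (x \in cover M); case: (x \in A).
pose A2 := A' :\: F; pose B2 := B' :\: F.
have cA2 : #|A2| = (p * u + (k - p) * v)%N.
  rewrite cardsD setIC -FA' cF eA -addnA addKn //.
have cB2 : #|B2| = ((k - p) * u + p * v)%N.
  have cFB : #|B' :&: F| = (k - s)%N.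
    rewrite -cFk -cF FA' -(cardsID A' F) addKn; congr #|pred_of_set _|.
    apply/setP => x; rewrite !inE; case: (boolP (x \in F)) => xF; rewrite ?andbF //.
    move/(subsetP FAB): xF; rewrite !inE.
    by case: (x \in W0); case: (x \in cover M); case: (x \in A).
  by rewrite cardsD cFB eB -addnA addKn.
have [A3 [A4 [eA2 dA2 cA3 cA4]]] := card_split cA2.
have [B3 [B4 [eB2 dB2 cB3 cB4]]] := card_split cB2.
have inV z : z \in A2 :|: B2 -> z \notin C.
  move=> hz; apply/negP => /(subsetP CW) zW; move: hz; rewrite !inE.
  by rewrite inE in zW; rewrite zW !andbF.
have A3A2 : A3 \subset A2 by rewrite eA2 subsetUl.
have A4A2 : A4 \subset A2 by rewrite eA2 subsetUr.
have B3B2 : B3 \subset B2 by rewrite eB2 subsetUl.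
have B4B2 : B4 \subset B2 by rewrite eB2 subsetUr.
have A2A : A2 \subset A by apply: subset_trans (subsetDl _ _) sA'.
have dB2A : [disjoint B2 & A] by apply: disjointWl (subsetDl _ _) dB'.
have kpred : k.-1.+1 = k by rewrite prednK.
have pk : (p <= k)%N by apply: leq_trans (leq_b1 p) k0.
(* each of the two types of rows, in number at least n / (8k) *)
have rows a N (A5 B5 : {set T}) : (a <= k)%N -> odd a = p -> (#|T| <= 8 * k * N)%N ->
   A5 \subset A2 -> B5 \subset B2 -> #|A5| = (a * N)%N -> #|B5| = ((k - a) * N)%N ->
   matchable H (A5 :|: B5).
  move=> ak oa nN sA5 sB5 cA5 cB5.
  have N0 : (0 < N)%N by case: (N) nN => // ; rewrite muln0 leqNgt T0.
  apply: (@partite_matching T k.-1 N a (8 * k) H A A5 B5 p eta) => //; rewrite ?kpred //.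
  - exact: subset_trans sA5 A2A.
  - exact: disjointWl sB5 dB2A.
  - by move=> z hz; apply: hT; apply: inV; apply: (subsetP (setUSS sA5 sB5)).
  - have h1 : k%:R ^+ 2 / N%:R <= 1 / 4 :> QQ.
      rewrite ler_pdivrMr ?ltr0n // -(ler_pM2l (_ : 0 < (8 * k)%:R)) ?ltr0n ?muln_gt0 //.
      apply: (@le_trans _ _ (1 / 4 * (8 * k * N)%:R)); last by rewrite !natrM; lra.
      apply: (@le_trans _ _ (1 / 4 * #|T|%:R)); last by rewrite ler_wpM2l ?ler_nat // divr_ge0.
      apply: (@le_trans _ _ (1 / 4 * (64 * k ^ 3)%:R)); last by rewrite ler_wpM2l ?ler_nat // divr_ge0.
      have -> : (8 * k)%:R * k%:R ^+ 2 = 8 * k%:R ^+ 3 :> QQ by rewrite natrM; ring.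
      have -> : 1 / 4 * (64 * k ^ 3)%:R = 16 * k%:R ^+ 3 :> QQ by rewrite natrM natrX; field.
      by rewrite ler_wpM2r ?exprn_ge0 // ler_nat.
    have := eta_row; lra.
have m1 : matchable H (A3 :|: B3) by apply: (rows p u) => //; exact: oddb.
have m2 : matchable H (A4 :|: B4).
  apply: (rows (k - p)%N v) => //; first exact: leq_subr.
    by rewrite oddB // (negPf ok) oddb.
  by rewrite subKn.
have -> : [set: T] = W :|: (F :|: ((A3 :|: B3) :|: (A4 :|: B4))).
  rewrite setUACA -eA2 -eB2; apply/setP => x; rewrite !inE.
  by case: (x \in W0); case: (x \in cover M); case: (x \in F); case: (x \in A).
have dis12 : [disjoint A3 :|: B3 & A4 :|: B4].
  have dAB : [disjoint A2 & B2] by rewrite disjoint_sym; apply: disjointWr A2A dB2A.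
  apply: disjointsU; rewrite disjoint_sym; apply: disjointsU; rewrite // disjoint_sym //.
  - exact: disjointWl A3A2 (disjointWr B4B2 dAB).
  - by rewrite disjoint_sym; exact: disjointWl A4A2 (disjointWr B3B2 dAB).
have sub34 : (A3 :|: B3) :|: (A4 :|: B4) = A2 :|: B2 by rewrite setUACA -eA2 -eB2.
apply: matchableU => //; last (apply: matchableU; [|exact: matchable_edge|exact: matchableU]).
- rewrite sub34 disjoint_sym; apply: disjointsU.
    rewrite disjoint_subset; apply/subsetP => x /(subsetP FAB).
    by rewrite !inE => /orP [] /andP [].
  apply: disjointsU; rewrite disjoint_subset; apply/subsetP => x; rewrite !inE;
    by case/and3P.
- rewrite sub34 disjoint_sym; apply: disjointsU; rewrite disjoint_subset;
    apply/subsetP => x; rewrite !inE; by case/andP.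
Qed.

End Extremal.

(** * The degree threshold *)

Lemma structure_parameter k : (4 <= k)%N -> exists eta : QQ,
  [/\ 0 < eta, eta < 1, 64 * k%:R ^+ 2 * eta <= 1, 4 * eta * 4 ^+ k <= 1 &
      4 * (k%:R * (eta * (8 * k)%:R ^+ k.-1)) <= 1].
Proof.
(* eta is the inverse of a common multiple of the products to be bounded *)
move=> k4; pose Q := (64 * k ^ 2 * (8 * k) ^ k)%N.
have k0 : (0 < k)%N by apply: leq_trans k4.
have k80 : (0 < 8 * k)%N by rewrite muln_gt0.
have Q1 : (1 < Q)%N.
  by rewrite /Q -mulnA; apply: (@leq_trans (64 * 1)%N); rewrite // leq_mul2l muln_gt0 !expn_gt0 k0 k80.
have bound X : (X <= Q)%N -> X%:R / Q%:R <= 1 :> QQ.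
  by move=> h; rewrite ler_pdivrMr ?ltr0n ?(ltnW Q1) // mul1r ler_nat.
exists Q%:R^-1; split.
- by rewrite invr_gt0 ltr0n ltnW.
- by rewrite invf_lt1 ?ltr0n ?(ltnW Q1) // (ltr_nat _ 1).
- have := bound (64 * k ^ 2)%N; rewrite natrM natrX; apply.
  by rewrite leq_pmulr // expn_gt0 k80.
- have -> : 4 * Q%:R^-1 * 4 ^+ k = (4 * 4 ^ k)%:R / Q%:R :> QQ by rewrite natrM natrX; ring.
  apply: bound; apply: leq_mul; last by rewrite leq_exp2r //; lia.
  by apply: (@leq_trans (64 * 1)%N) => //; rewrite leq_mul2l expn_gt0 k0.
- have -> : 4 * (k%:R * (Q%:R^-1 * (8 * k)%:R ^+ k.-1)) = (4 * k * (8 * k) ^ k.-1)%:R / Q%:R :> QQ.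
    by rewrite [in RHS]natrM natrX [(4 * k)%:R]natrM; move: (_ ^+ k.-1) => X; ring.
  apply: bound; apply: leq_mul; last by rewrite leq_pexp2l // leq_pred.
  by apply: leq_mul => //; rewrite expnS leq_pmulr // expn_gt0 k0.
Qed.

(** The hypothesis on the degree enters through [m_degree_prob], for sets of size m
    and for single vertices, and through [delta_ext_barrier], which provides the
    edge of the wrong parity. *)
Theorem even_threshold k m l : (1 < m)%N -> k = (2 * m)%N -> (m <= l < k)%N ->
  exists n0, forall (T : finType) (H : {set {set T}}),
    (n0 <= #|T|)%N -> (k %| #|T|)%N -> uniform k H ->
    (delta_ext #|T| k l < min_degree l H)%N -> matchable H [set: T].
Proof.
move=> m2 km /andP [ml lk].
have [k4 l1 k1] : [/\ 4 <= k, 1 <= l & 1 < k]%N by split; lia.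
have okk : ~~ odd k by rewrite km oddM.
have kmm : (k - m = m)%N by lia.
have [eta [eta0 eta1 eta_k eta_typ eta_row]] := structure_parameter k4.
have [e1 e10 absorb] := absorbing_matching m2 km.
have [e2 [c [e20 c0 dich]]] := dichotomy k1 eta0.
have [n1 hn1] := absorb c c0.
have [n2 hn2] := div_nat_le (2 * k ^ 2 + 1)%:R e10.
have [n3 hn3] := div_nat_le (2 * k ^ 2 + 1)%:R e20.
exists (maxn (4 * k) (maxn n1 (maxn n2 (maxn n3 (64 * k ^ 3)))))%N => T H.
rewrite !geq_max => /and5P [nk h1 h2 h3 h4] kn uH hdeg.
have n4 : (4 <= #|T|)%N by apply: leq_trans nk; rewrite leq_pmulr // (leq_trans _ k4).
have ln : (l <= #|T|)%N.
  by apply: leq_trans (ltnW lk) (leq_trans _ nk); rewrite leq_pmull.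
have T0 : (0 < #|T|)%N by apply: leq_trans n4.
have mdeg s : uniq s -> size s = m -> 1 / 2 - e1 <= prob m (fun t => edge H (s ++ t)).
  move=> us ss; have := m_degree_prob n4 lk ln uH hdeg ml us ss; rewrite kmm.
  by apply: le_trans; rewrite lerD2l lerN2; exact: hn2.
have vdeg x : 1 / 2 - e2 <= prob k.-1 (fun t => edge H (x :: t)).
  have := m_degree_prob n4 lk ln uH hdeg l1 (_ : uniq [:: x]) erefl; rewrite subn1 => /(_ isT).
  by apply: le_trans; rewrite lerD2l lerN2; exact: hn3.
have [conn_all|[A [C [p PS]]]] := dich T H T0 vdeg; first exact: hn1.
apply: (extremal_matching k4 okk uH kn (ltW eta0) eta_k eta_typ eta_row h4 PS).
move=> hA; have [/existsP [e /andP [eH he]]|] := boolP [exists e, (e \in H) && (odd #|e :&: A| != p)].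
  by exists e.
rewrite negb_exists => /forallP hp; exfalso.
have n0 := cardT_gt0 T0.
have [_ bal _ _] := PS; move: bal; rewrite ler_norml => /andP [b1 b2].
have lt1 : eta * #|T|%:R < #|T|%:R by rewrite gtr_pMl.
have A0 : A != set0.
  by rewrite -card_gt0 lt0n; apply/negP => /eqP e; move: b2; rewrite e mulr0 subr0 leNgt lt1.
have B0 : ~: A != set0.
  apply/negP => /eqP e; move: (cardsC A); rewrite e cards0 addn0 => cA.
  have : #|T|%:R <= eta * #|T|%:R by rewrite cA in b1; lra.
  by rewrite leNgt lt1.
have := @delta_ext_barrier T k l H A p A0 B0 _ hA; rewrite leqNgt hdeg => /(_ _)/negP; apply => //.
move=> e eH; split; first exact: uH.
by have := hp e; rewrite eH /= negbK => /eqP.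
Qed.

Local Close Scope ring_scope.

Theorem theorem1p1 (r l : nat) (r_gt0 : 0 < r) (hl : 2 * r <= l <= 4 * r - 1) :
  exists n0 : nat,
    forall (n : nat) (T : finType) (H : {set {set T}}),
      n0 <= n -> #|T| = n -> 4 * r %| n ->
      uniform (4 * r) H ->
      delta_ext n (4 * r) l < min_degree l H ->
      exists M : {set {set T}}, perfect_matching H M.
Proof.
have m2 : 1 < 2 * r by lia.
have km : 4 * r = 2 * (2 * r) by lia.
have lk : 2 * r <= l < 4 * r by lia.
have [n0 hn0] := even_threshold m2 km lk.
exists n0 => n T H hn eT; rewrite -eT in hn * => kn uH hdeg.
have [M [MH tM cM]] := hn0 T H hn kn uH hdeg.
by exists M; rewrite /perfect_matching MH tM cM eqxx.
Qed.
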